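(* Let $(b_n)_{n\ge 1}$ be a sequence in $\mathcal H$ and suppose that the forward iterates $B_n := b_n \circ \cdots \circ b_1$ converge to a nonconstant limit $B \in \mathcal H$. Then the following are equivalent: (a) Each $b_n$ is an indestructible Blaschke product. (b) $B$ is an indestructible Blaschke product.
   Context: $\mathbb D := \{z \in \mathbb C : |z|<1\}$, and $\mathcal H$ denotes the set of holomorphic self-maps of $\mathbb D$, i.e. holomorphic functions $f:\mathbb D \to \mathbb D$. Convergence of functions in $\mathcal H$ to a limit in $\mathcal H$ means pointwise convergence on $\mathbb D$ (equivalently, uniform convergence on compact subsets of $\mathbb D$). $\mathrm{Aut}(\mathbb D)$ is the group of conformal automorphisms (holomorphic bijections) of $\mathbb D$. A Blaschke product is a function of the form $B(z) = \eta \prod_{n=1}^N \frac{|z_n|}{z_n}\frac{z_n - z}{1-\overline{z_n} z}$, where $\eta \in \partial\mathbb D$, $N \in \mathbb N \cup \{\infty\}$ (with $N \ge 1$), and $(z_n) \subseteq \mathbb D$ satisfies $\sum_{n=1}^N (1-|z_n|)<\infty$; by convention $|z_n|/z_n := 1$ if $z_n = 0$. A Blaschke product $B$ is called indestructible if $T \circ B$ is again a Blaschke product for every $T \in \mathrm{Aut}(\mathbb D)$. *)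

(* Defs.v *)
From Stdlib Require Import Reals.
From Coquelicot Require Import Coquelicot.

(* Functions on the unit disc are represented by total functions [C -> C];
   every notion below depends only on their values on the disc. *)

Definition unit_disc (z : C) : Prop := (Cmod z < 1)%R.

Definition holomorphic_on_disc (f : C -> C) : Prop :=
  forall z, unit_disc z -> @ex_derive C_AbsRing C_NormedModule f z.

Definition holomorphic_self_map (f : C -> C) : Prop :=
  holomorphic_on_disc f /\ forall z, unit_disc z -> unit_disc (f z).

Definition nonconstant_on_disc (f : C -> C) : Prop :=
  exists z w, unit_disc z /\ unit_disc w /\ f z <> f w.

Definition disc_automorphism (T : C -> C) : Prop :=
  holomorphic_self_map T /\
  (forall z w, unit_disc z -> unit_disc w -> T z = T w -> z = w) /\
  (forall w, unit_disc w -> exists z, unit_disc z /\ T z = w).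

Definition C_seq_lim (u : nat -> C) (l : C) : Prop :=
  filterlim u eventually (@locally C_UniformSpace l).

Definition cvg_on_disc (f : nat -> C -> C) (g : C -> C) : Prop :=
  forall z, unit_disc z -> C_seq_lim (fun n => f n z) (g z).

(* [|a| / a], with value 1 at [a = 0]. *)
Definition unimodular_factor (a : C) : C :=
  if Ceq_dec a 0%R then RtoC 1 else (RtoC (Cmod a) / a)%C.

Definition blaschke_factor (a z : C) : C :=
  (unimodular_factor a * ((a - z) / (1 - Cconj a * z)))%C.

(* [a 1 * ... * a n]: sequences are indexed from 1 and [a 0] is never used. *)
Fixpoint C_prod (a : nat -> C) (n : nat) : C :=
  match n with
  | O => RtoC 1
  | S m => (C_prod a m * a (S m))%C
  end.

Definition finite_blaschke_product (f : C -> C) : Prop :=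
  exists (eta : C) (N : nat) (a : nat -> C),
    Cmod eta = 1%R /\ (1 <= N)%nat /\
    (forall n, (1 <= n <= N)%nat -> unit_disc (a n)) /\
    forall z, unit_disc z ->
      f z = (eta * C_prod (fun n => blaschke_factor (a n) z) N)%C.

(* [ex_series] sums from 0, hence the shift. *)
Definition infinite_blaschke_product (f : C -> C) : Prop :=
  exists (eta : C) (a : nat -> C),
    Cmod eta = 1%R /\
    (forall n, (1 <= n)%nat -> unit_disc (a n)) /\
    @ex_series R_AbsRing R_NormedModule (fun n => (1 - Cmod (a (S n)))%R) /\
    forall z, unit_disc z ->
      exists p : C,
        C_seq_lim (C_prod (fun n => blaschke_factor (a n) z)) p /\
        f z = (eta * p)%C.

Definition blaschke_product (f : C -> C) : Prop :=
  finite_blaschke_product f \/ infinite_blaschke_product f.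

Definition indestructible_blaschke (f : C -> C) : Prop :=
  blaschke_product f /\
  forall T, disc_automorphism T -> blaschke_product (fun z => T (f z)).

(* [b n o ... o b 1]; as above, [b 0] is never used. *)
Fixpoint forward_iterate (b : nat -> C -> C) (n : nat) (z : C) : C :=
  match n with
  | O => z
  | S m => b (S m) (forward_iterate b m z)
  end.

(* Main.v *)
Require Import Defs.
From Stdlib Require Import Reals Lra Lia Classical ClassicalEpsilon.
From Coquelicot Require Import Coquelicot.
From Stdlib Require Import List.
Open Scope C_scope.

(** Write [B_n] for the iterate of order [n] and [mobius w] for the
    automorphism of the disc exchanging [w] and [0]. A self-map [f] of the disc
    is an indestructible Blaschke product exactly when, for every [w], the
    modulus of [mobius w o f] at some point [z0], with [f z0] different from [w],
    is the infimum of the moduli of the finite Blaschke products that divide it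
    ([indestructible_zeros_exhaust], [zeros_exhaust_indestructible]). In terms of
    Green's function this is equality in the Lindeloef principle: the Green
    potential [g (f z) w] is the sum of the [g z a] over the solutions [a] of
    [f a = w]. In this form the property passes to compositions
    ([zeros_exhaust_comp]), to divisors ([split_zeros]) and to outer factors of a
    composition ([push_zeros]).

    Fix [n] and write [B_m = F_m o B_n]. By Schwarz-Pick,
    [mobius (F_m c) o B_m] is dominated by [mobius c o B_n]. The points [F_m c]
    stay in a compact part of the disc, because the points [F_m (B_n z)] converge
    in the disc; at a cluster point [w] of them, [mobius w o B] is dominated by
    [mobius c o B_n] ([cluster_domination]).

    If [B] is indestructible, then [mobius c o B_n] divides [mobius w o B] and so
    inherits the exhaustion by zeros; its inner factor [B_(n-1)] is removed by
    [push_zeros], which gives the indestructibility of [b_n]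
    ([factor_indestructible]).

    Conversely, if all [b_n] are indestructible, then so is [B_n], and for given
    [w] it suffices to find [c] such that [F_m c] accumulates at [w] while [c] is
    hardly farther from [B_n z0] than [w] is from [B z0]. Since [B] is not
    constant, [F_m] for large [n] nearly preserves the distance between two image
    points, hence is nearly an isometry, and attains [w] at such a place
    ([near_isometry_covers], [limit_indestructible]).

    The complex analysis behind this is reduced to one fact, the bound of
    [Cmod (G 0)] by the values of [G] on a circle ([circle_bound]), which follows
    from Goursat's theorem in logarithmic polar coordinates. It yields the
    maximum principle, also with finitely many bounded singularities
    ([punctured_max_principle]), hence the Schwarz-Pick inequality with such
    singularities; applied to a bounded function and then to its difference
    quotient, Schwarz-Pick removes singularities ([removable_singularity]), and
    zeros can be divided out ([schur_division]). *)

(** * Complex differentiability *)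

Definition C_cont (f : C -> C) (z : C) : Prop :=
  forall eps, (0 < eps)%R -> exists delta, (0 < delta)%R /\
    forall w, (Cmod (w - z) < delta)%R -> (Cmod (f w - f z) < eps)%R.

(** Stated with [Cmod] instead of filters, so that estimates apply directly;
    [ex_derive_hol_at] and [hol_at_ex_derive] give the link with [ex_derive]. *)
Definition C_has_deriv (f : C -> C) (z d : C) : Prop :=
  forall eps, (0 < eps)%R -> exists delta, (0 < delta)%R /\
    forall w, (Cmod (w - z) < delta)%R ->
      (Cmod (f w - f z - d * (w - z)) <= eps * Cmod (w - z))%R.

Definition hol_at (f : C -> C) (z : C) : Prop := exists d, C_has_deriv f z d.

Lemma Cmod_minus_sym (z w : C) : Cmod (z - w) = Cmod (w - z).
Proof. rewrite <- Cmod_opp. f_equal. ring. Qed.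

Lemma Cmod_triangle_inv (z w : C) : (Cmod z - Cmod w <= Cmod (z - w))%R.
Proof.
  pose proof (Cmod_triangle (z - w) w) as H.
  replace (z - w + w) with z in H by ring. lra.
Qed.

Lemma Cmod_triangle_via (w z x : C) :
  (Cmod (z - x) <= Cmod (z - w) + Cmod (w - x))%R.
Proof.
  replace (z - x) with ((z - w) + (w - x)) by ring. apply Cmod_triangle.
Qed.

Lemma Cmod_minus_le (z w : C) : (Cmod (z - w) <= Cmod z + Cmod w)%R.
Proof. unfold Cminus. rewrite <- (Cmod_opp w). apply Cmod_triangle. Qed.

Lemma ex_derive_hol_at (f : C -> C) (z : C) :
  @ex_derive C_AbsRing C_NormedModule f z -> hol_at f z.
Proof.
  intros [d [_ Hd]]. exists d. intros eps Heps.
  specialize (Hd z (fun P H => H) (mkposreal eps Heps)).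
  destruct Hd as [delta Hdelta]. exists delta. split; [apply cond_pos|].
  intros w Hw. specialize (Hdelta w Hw).
  change (Cmod (f w - f z - (w - z) * d) <= eps * Cmod (w - z))%R in Hdelta.
  now rewrite (Cmult_comm d).
Qed.

Lemma hol_at_ex_derive (f : C -> C) (z : C) :
  hol_at f z -> @ex_derive C_AbsRing C_NormedModule f z.
Proof.
  intros [d Hd]. exists d. split; [apply is_linear_scal_l|].
  intros x Hx. apply (is_filter_lim_locally_unique (V := AbsRing_NormedModule C_AbsRing)) in Hx.
  subst x. intros eps. destruct (Hd eps (cond_pos eps)) as [delta [Hdelta H]].
  exists (mkposreal delta Hdelta). intros w Hw.
  specialize (H w Hw).
  change (Cmod (f w - f z - (w - z) * d) <= eps * Cmod (w - z))%R.
  now rewrite (Cmult_comm _ d).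
Qed.

(** Caratheodory's form of differentiability reduces the rules of calculus to
    continuity of sums, products and composites. *)
Lemma caratheodory (f : C -> C) (z : C) :
  hol_at f z <->
  exists phi, (forall w, f w = f z + phi w * (w - z)) /\ C_cont phi z.
Proof.
  split.
  - intros [d Hd].
    exists (fun w => if Ceq_dec w z then d else (f w - f z) / (w - z)).
    split.
    + intros w. destruct (Ceq_dec w z) as [->|Hne]; [ring|].
      field. intro H. apply Hne. replace w with (w - z + z) by ring.
      rewrite H. ring.
    + intros eps Heps. destruct (Hd (eps / 2)%R) as [delta [Hdelta H]]; [lra|].
      exists delta. split; [assumption|]. intros w Hw.
      destruct (Ceq_dec z z) as [_|n]; [|congruence].
      destruct (Ceq_dec w z) as [->|Hne].
      * replace (d - d) with (RtoC 0) by ring. rewrite Cmod_0. assumption.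
      * assert (Hwz : w - z <> 0).
        { intro H0. apply Hne. replace w with (w - z + z) by ring.
          rewrite H0. ring. }
        replace ((f w - f z) / (w - z) - d)
          with ((f w - f z - d * (w - z)) / (w - z)) by (field; assumption).
        rewrite Cmod_div by assumption.
        apply Cmod_gt_0 in Hwz. specialize (H w Hw).
        apply Rle_lt_trans with (eps / 2)%R; [|lra].
        apply Rmult_le_reg_r with (Cmod (w - z)); [assumption|].
        unfold Rdiv at 1. rewrite Rmult_assoc, Rinv_l, Rmult_1_r; lra.
  - intros [phi [Hphi Hc]]. exists (phi z). intros eps Heps.
    destruct (Hc eps Heps) as [delta [Hdelta H]].
    exists delta. split; [assumption|]. intros w Hw.
    replace (f w - f z - phi z * (w - z)) with ((phi w - phi z) * (w - z)).
    + rewrite Cmod_mult. apply Rmult_le_compat_r; [apply Cmod_ge_0|].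
      left. apply H, Hw.
    + rewrite (Hphi w). ring.
Qed.

Lemma C_cont_const (c z : C) : C_cont (fun _ => c) z.
Proof.
  intros eps Heps. exists 1%R. split; [lra|]. intros w _.
  replace (c - c) with (RtoC 0) by ring. now rewrite Cmod_0.
Qed.

Lemma C_cont_id (z : C) : C_cont (fun w => w) z.
Proof. intros eps Heps. exists eps. now split. Qed.

Lemma C_cont_plus (f g : C -> C) (z : C) :
  C_cont f z -> C_cont g z -> C_cont (fun w => f w + g w) z.
Proof.
  intros Hf Hg eps Heps.
  destruct (Hf (eps / 2)%R) as [d1 [Hd1 H1]]; [lra|].
  destruct (Hg (eps / 2)%R) as [d2 [Hd2 H2]]; [lra|].
  exists (Rmin d1 d2). split; [now apply Rmin_pos|]. intros w Hw.
  specialize (H1 w (Rlt_le_trans _ _ _ Hw (Rmin_l _ _))).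
  specialize (H2 w (Rlt_le_trans _ _ _ Hw (Rmin_r _ _))).
  replace (f w + g w - (f z + g z)) with ((f w - f z) + (g w - g z)) by ring.
  eapply Rle_lt_trans; [apply Cmod_triangle|lra].
Qed.

Lemma C_cont_mult (f g : C -> C) (z : C) :
  C_cont f z -> C_cont g z -> C_cont (fun w => f w * g w) z.
Proof.
  intros Hf Hg eps Heps.
  set (K := (Cmod (f z) + Cmod (g z) + 1)%R).
  assert (HK : (1 <= K)%R)
    by (unfold K; pose proof (Cmod_ge_0 (f z)); pose proof (Cmod_ge_0 (g z)); lra).
  set (e := Rmin 1 (eps / (3 * K))).
  assert (He0 : (0 < eps / (3 * K))%R) by (apply Rdiv_lt_0_compat; lra).
  assert (He : (0 < e)%R) by (apply Rmin_pos; lra).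
  assert (HeK : (e * K <= eps / 3)%R).
  { replace (eps / 3)%R with (eps / (3 * K) * K)%R by (field; lra).
    apply Rmult_le_compat_r; [lra|apply Rmin_r]. }
  destruct (Hf e He) as [d1 [Hd1 H1]]. destruct (Hg e He) as [d2 [Hd2 H2]].
  exists (Rmin d1 d2). split; [now apply Rmin_pos|]. intros w Hw.
  specialize (H1 w (Rlt_le_trans _ _ _ Hw (Rmin_l _ _))).
  specialize (H2 w (Rlt_le_trans _ _ _ Hw (Rmin_r _ _))).
  replace (f w * g w - f z * g z)
    with ((f w - f z) * (g w - g z) + f z * (g w - g z) + (f w - f z) * g z)
    by ring.
  assert (He1 : (e <= 1)%R) by apply Rmin_l.
  pose proof (Cmod_triangle ((f w - f z) * (g w - g z) + f z * (g w - g z))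
    ((f w - f z) * g z)) as T1.
  pose proof (Cmod_triangle ((f w - f z) * (g w - g z)) (f z * (g w - g z))) as T2.
  rewrite !Cmod_mult in T1. rewrite !Cmod_mult in T2.
  unfold K in *.
  pose proof (Cmod_ge_0 (f z)); pose proof (Cmod_ge_0 (g z));
  pose proof (Cmod_ge_0 (f w - f z)); pose proof (Cmod_ge_0 (g w - g z)).
  set (x := Cmod (f w - f z)) in *. set (y := Cmod (g w - g z)) in *.
  assert (x * y <= e * 1)%R by (apply Rmult_le_compat; lra).
  assert (Cmod (f z) * y <= Cmod (f z) * e)%R by (apply Rmult_le_compat_l; lra).
  assert (x * Cmod (g z) <= e * Cmod (g z))%R by (apply Rmult_le_compat_r; lra).
  lra.
Qed.

Lemma C_cont_comp (f g : C -> C) (z : C) :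
  C_cont f (g z) -> C_cont g z -> C_cont (fun w => f (g w)) z.
Proof.
  intros Hf Hg eps Heps. destruct (Hf eps Heps) as [d1 [Hd1 H1]].
  destruct (Hg d1 Hd1) as [d2 [Hd2 H2]].
  exists d2. split; [assumption|]. intros w Hw. apply H1, H2, Hw.
Qed.

Lemma hol_at_cont (f : C -> C) (z : C) : hol_at f z -> C_cont f z.
Proof.
  intros H. apply caratheodory in H. destruct H as [phi [Hphi Hc]].
  assert (H : C_cont (fun w => f z + phi w * (w + - z)) z).
  { apply C_cont_plus; [apply C_cont_const|].
    apply C_cont_mult; [assumption|].
    apply C_cont_plus; [apply C_cont_id|apply C_cont_const]. }
  intros eps Heps. destruct (H eps Heps) as [d [Hd H1]].
  exists d. split; [assumption|]. intros w Hw.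
  rewrite (Hphi w). specialize (H1 w Hw).
  replace (f z + phi w * (w - z) - f z)
    with (f z + phi w * (w + - z) - (f z + phi z * (z + - z))) by ring.
  assumption.
Qed.

Lemma hol_at_const (c z : C) : hol_at (fun _ => c) z.
Proof.
  apply caratheodory. exists (fun _ => 0). split; [intros; ring|apply C_cont_const].
Qed.

Lemma hol_at_id (z : C) : hol_at (fun w => w) z.
Proof.
  apply caratheodory. exists (fun _ => 1). split; [intros; ring|apply C_cont_const].
Qed.

Lemma hol_at_plus (f g : C -> C) (z : C) :
  hol_at f z -> hol_at g z -> hol_at (fun w => f w + g w) z.
Proof.
  rewrite !caratheodory. intros [p [Hp Hpc]] [q [Hq Hqc]].
  exists (fun w => p w + q w). split; [|now apply C_cont_plus].
  intros w. rewrite (Hp w), (Hq w). ring.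
Qed.

Lemma hol_at_mult (f g : C -> C) (z : C) :
  hol_at f z -> hol_at g z -> hol_at (fun w => f w * g w) z.
Proof.
  intros Hf Hg. pose proof (hol_at_cont _ _ Hg) as Hgc.
  revert Hf Hg. rewrite !caratheodory. intros [p [Hp Hpc]] [q [Hq Hqc]].
  exists (fun w => p w * g w + f z * q w). split.
  - intros w. rewrite (Hp w), (Hq w). ring.
  - apply C_cont_plus; [now apply C_cont_mult|].
    apply C_cont_mult; [apply C_cont_const|assumption].
Qed.

Lemma hol_at_minus (f g : C -> C) (z : C) :
  hol_at f z -> hol_at g z -> hol_at (fun w => f w - g w) z.
Proof.
  rewrite !caratheodory. intros [p [Hp Hpc]] [q [Hq Hqc]].
  exists (fun w => p w + (-(1)) * q w). split.
  - intros w. rewrite (Hp w), (Hq w). ring.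
  - apply C_cont_plus; [assumption|].
    apply C_cont_mult; [apply C_cont_const|assumption].
Qed.

Lemma hol_at_comp (f g : C -> C) (z : C) :
  hol_at f (g z) -> hol_at g z -> hol_at (fun w => f (g w)) z.
Proof.
  intros Hf Hg. pose proof (hol_at_cont _ _ Hg) as Hgc.
  revert Hf Hg. rewrite !caratheodory. intros [p [Hp Hpc]] [q [Hq Hqc]].
  exists (fun w => p (g w) * q w). split.
  - intros w. rewrite (Hp (g w)), (Hq w). ring.
  - apply C_cont_mult; [now apply (C_cont_comp p g)|assumption].
Qed.

Lemma hol_at_inv (z : C) : z <> 0 -> hol_at Cinv z.
Proof.
  intros Hz. exists (- / (z * z)). intros eps Heps.
  apply Cmod_gt_0 in Hz as Hm. set (m := Cmod z) in *.
  exists (Rmin (m / 2) (eps * (m * m * m) / 2)).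
  assert (Hm3 : (0 < m * m * m)%R) by (repeat apply Rmult_lt_0_compat; lra).
  split.
  { apply Rmin_pos; [lra|]. assert (0 < eps * (m * m * m))%R
      by now apply Rmult_lt_0_compat. lra. }
  intros w Hw.
  pose proof (Rlt_le_trans _ _ _ Hw (Rmin_l _ _)) as Hw1.
  pose proof (Rlt_le_trans _ _ _ Hw (Rmin_r _ _)) as Hw2. clear Hw.
  pose proof (Cmod_triangle_inv z w) as T. rewrite Cmod_minus_sym in T.
  fold m in T.
  assert (Hw0 : w <> 0) by (apply Cmod_gt_0; lra).
  replace (/ w - / z - - / (z * z) * (w - z))
    with ((w - z) * (w - z) * (/ w * / z * / z)) by (field; tauto).
  rewrite !Cmod_mult, !Cmod_inv by assumption. fold m.
  replace (Cmod (w - z) * Cmod (w - z) * (/ Cmod w * / m * / m))%R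
    with (Cmod (w - z) * (/ Cmod w * / m * / m) * Cmod (w - z))%R by ring.
  apply Rmult_le_compat_r; [apply Cmod_ge_0|].
  apply Rmult_le_reg_r with (Cmod w * m * m)%R.
  { repeat apply Rmult_lt_0_compat; lra. }
  replace (Cmod (w - z) * (/ Cmod w * / m * / m) * (Cmod w * m * m))%R
    with (Cmod (w - z)) by (field; lra).
  apply Rle_trans with (eps * (m * m * m) / 2)%R; [lra|].
  assert (eps * (m * m) * (m / 2) <= eps * (m * m) * Cmod w)%R.
  { apply Rmult_le_compat_l; [|lra].
    apply Rmult_le_pos; [lra|]. apply Rmult_le_pos; lra. }
  lra.
Qed.

Lemma hol_at_div (f g : C -> C) (z : C) :
  hol_at f z -> hol_at g z -> g z <> 0 -> hol_at (fun w => f w / g w) z.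
Proof.
  intros Hf Hg Hz. apply hol_at_mult; [assumption|].
  apply (hol_at_comp Cinv g); [now apply hol_at_inv|assumption].
Qed.

Lemma hol_at_pow (f : C -> C) (n : nat) (z : C) :
  hol_at f z -> hol_at (fun w => f w ^ n) z.
Proof.
  intros Hf. induction n as [|n IH]; simpl; [apply hol_at_const|].
  now apply hol_at_mult.
Qed.

Lemma hol_at_ext_loc (f g : C -> C) (z : C) (r : R) :
  (0 < r)%R -> (forall w, (Cmod (w - z) < r)%R -> f w = g w) ->
  hol_at f z -> hol_at g z.
Proof.
  intros Hr E [d Hd]. exists d. intros eps Heps.
  destruct (Hd eps Heps) as [delta [Hdelta H]].
  exists (Rmin delta r). split; [now apply Rmin_pos|]. intros w Hw.
  rewrite <- !E.
  - apply H. eapply Rlt_le_trans; [exact Hw|apply Rmin_l].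
  - replace (z - z) with (RtoC 0) by ring. now rewrite Cmod_0.
  - eapply Rlt_le_trans; [exact Hw|apply Rmin_r].
Qed.

(** * Goursat's theorem on rectangles *)

Definition plane_diff (u : R -> R -> R) (x y ux uy : R) : Prop :=
  forall eps, (0 < eps)%R -> exists delta, (0 < delta)%R /\
    forall x' y', (Rabs (x' - x) < delta)%R -> (Rabs (y' - y) < delta)%R ->
      (Rabs (u x' y' - u x y - ux * (x' - x) - uy * (y' - y))
        <= eps * (Rabs (x' - x) + Rabs (y' - y)))%R.

Lemma plane_diff_swap (u : R -> R -> R) (x y ux uy : R) :
  plane_diff u x y ux uy -> plane_diff (fun s t => u t s) y x uy ux.
Proof.
  intros H eps Heps. destruct (H eps Heps) as [d [Hd H1]].
  exists d. split; [assumption|]. intros x' y' Hx Hy.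
  specialize (H1 y' x' Hy Hx).
  replace (u y' x' - u x y - uy * (x' - y) - ux * (y' - x))%R
    with (u y' x' - u x y - ux * (y' - x) - uy * (x' - y))%R by ring.
  now rewrite (Rplus_comm (Rabs (x' - y))).
Qed.

Lemma plane_diff_continuous (u : R -> R -> R) (x y ux uy : R) :
  plane_diff u x y ux uy -> continuous (u x) y.
Proof.
  intros H. apply filterlim_locally. intros eps.
  destruct (H 1%R Rlt_0_1) as [d [Hd H1]].
  set (K := (Rabs uy + 1)%R). assert (HK : (0 < K)%R)
    by (unfold K; pose proof (Rabs_pos uy); lra).
  assert (Hm : (0 < Rmin d (eps / K))%R).
  { apply Rmin_pos; [assumption|]. apply Rdiv_lt_0_compat; [apply cond_pos|assumption]. }
  exists (mkposreal _ Hm). intros y' Hy'. 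
  change (Rabs (y' - y) < Rmin d (eps / K))%R in Hy'.
  change (Rabs (u x y' - u x y) < eps)%R.
  pose proof (Rlt_le_trans _ _ _ Hy' (Rmin_l _ _)) as Hy1.
  pose proof (Rlt_le_trans _ _ _ Hy' (Rmin_r _ _)) as Hy2.
  specialize (H1 x y'). replace (x - x)%R with 0%R in H1 by ring.
  rewrite Rabs_R0 in H1. specialize (H1 Hd Hy1).
  apply Rle_lt_trans with (Rabs (y' - y) * K)%R.
  - replace (u x y' - u x y)%R
      with ((u x y' - u x y - ux * 0 - uy * (y' - y)) + uy * (y' - y))%R by ring.
    eapply Rle_trans; [apply Rabs_triang|]. rewrite Rabs_mult. unfold K. lra.
  - apply Rmult_lt_compat_r with (r := K) in Hy2; [|assumption].
    replace (eps / K * K)%R with (pos eps) in Hy2 by (field; lra). assumption.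
Qed.

Definition in_rect (a b c d x y : R) : Prop :=
  (a <= x <= b)%R /\ (c <= y <= d)%R.

(** The integral of the form [v dx + u dy] along the boundary of the rectangle
    with corner [(x, y)] and sides [w], [h]. *)
Definition circulation (u v : R -> R -> R) (x w y h : R) : R :=
  ((RInt (u (x + w)) y (y + h) - RInt (u x) y (y + h))
   - (RInt (fun s => v s (y + h)) x (x + w) - RInt (fun s => v s y) x (x + w)))%R.

(** The common value [p] of the [x]-derivative of [u] and the [y]-derivative of
    [v] expresses that the form [v dx + u dy] is closed. *)
Definition closed_form_on (u v : R -> R -> R) (a b c d : R) : Prop :=
  forall x y, in_rect a b c d x y ->
    exists p uy vx, plane_diff u x y p uy /\ plane_diff v x y vx p.

Lemma closed_form_ex_RInt_u (u v : R -> R -> R) (a b c d x y1 y2 : R) :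
  closed_form_on u v a b c d -> (a <= x <= b)%R -> (c <= y1)%R ->
  (y1 <= y2)%R -> (y2 <= d)%R -> ex_RInt (u x) y1 y2.
Proof.
  intros H Hx H1 H12 H2. apply (ex_RInt_continuous (V := R_CompleteNormedModule)).
  intros y Hy. rewrite Rmin_left, Rmax_right in Hy by assumption.
  destruct (H x y) as (p & uy & vx & Hu & _); [split; lra|].
  exact (plane_diff_continuous _ _ _ _ _ Hu).
Qed.

Lemma closed_form_ex_RInt_v (u v : R -> R -> R) (a b c d y x1 x2 : R) :
  closed_form_on u v a b c d -> (c <= y <= d)%R -> (a <= x1)%R ->
  (x1 <= x2)%R -> (x2 <= b)%R -> ex_RInt (fun s => v s y) x1 x2.
Proof.
  intros H Hy H1 H12 H2. apply (ex_RInt_continuous (V := R_CompleteNormedModule)).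
  intros x Hx. rewrite Rmin_left, Rmax_right in Hx by assumption.
  destruct (H x y) as (p & uy & vx & _ & Hv); [split; lra|].
  exact (plane_diff_continuous _ _ _ _ _ (plane_diff_swap _ _ _ _ _ Hv)).
Qed.

Lemma RInt_split (f : R -> R) (a b c : R) :
  ex_RInt f a b -> ex_RInt f b c -> RInt f a c = (RInt f a b + RInt f b c)%R.
Proof. intros H1 H2. symmetry. exact (RInt_Chasles f a b c H1 H2). Qed.

(** The inner sides of the four quarters cancel. *)
Lemma circulation_quarter (u v : R -> R -> R) (a b c d x w y h : R) :
  closed_form_on u v a b c d -> (0 <= w)%R -> (0 <= h)%R ->
  (a <= x)%R -> (x + 2 * w <= b)%R -> (c <= y)%R -> (y + 2 * h <= d)%R ->
  circulation u v x (2 * w) y (2 * h) =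
    (circulation u v x w y h + circulation u v (x + w) w y h
     + circulation u v x w (y + h) h + circulation u v (x + w) w (y + h) h)%R.
Proof.
  intros H Hw Hh Hx1 Hx2 Hy1 Hy2. unfold circulation.
  replace (x + w + w)%R with (x + 2 * w)%R by ring.
  replace (y + h + h)%R with (y + 2 * h)%R by ring.
  rewrite (RInt_split (u (x + 2 * w)%R) y (y + h) (y + 2 * h));
    try (eapply closed_form_ex_RInt_u; [exact H|lra..]).
  rewrite (RInt_split (u x) y (y + h) (y + 2 * h));
    try (eapply closed_form_ex_RInt_u; [exact H|lra..]).
  rewrite (RInt_split (fun s => v s (y + 2 * h)%R) x (x + w) (x + 2 * w));
    try (eapply closed_form_ex_RInt_v; [exact H|lra..]).
  rewrite (RInt_split (fun s => v s y) x (x + w) (x + 2 * w));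
    try (eapply closed_form_ex_RInt_v; [exact H|lra..]).
  lra.
Qed.

Lemma RInt_diff_near_const (f g : R -> R) (a h k e : R) :
  (0 <= h)%R -> ex_RInt f a (a + h) -> ex_RInt g a (a + h) ->
  (forall t, (a <= t <= a + h)%R -> (Rabs (f t - g t - k) <= e)%R) ->
  (Rabs (RInt f a (a + h) - RInt g a (a + h) - k * h) <= h * e)%R.
Proof.
  intros Hh Hf Hg He.
  pose proof (is_RInt_minus _ _ _ _ _ _ (RInt_correct f _ _ Hf) (RInt_correct g _ _ Hg)) as I1.
  pose proof (is_RInt_minus _ _ _ _ _ _ I1 (is_RInt_const a (a + h) k)) as I2.
  pose proof (is_RInt_unique _ _ _ _ I2) as E.
  match type of E with _ = ?r => 
    assert (Er : r = (RInt f a (a + h) - RInt g a (a + h) - k * h)%R) end.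
  { unfold minus, plus, opp, scal; simpl. unfold mult; simpl. ring. }
  rewrite <- Er, <- E.
  eapply Rle_trans; [apply abs_RInt_le_const with (M := e)|right; ring].
  - lra.
  - eexists; exact I2.
  - exact He.
Qed.

(** A closed form with affine coefficients has circulation [0], so only the
    remainder of the first-order expansion at [(x0, y0)] contributes. *)
Lemma circulation_small (u v : R -> R -> R) (a b c d x0 y0 p uy vx eps delta x w y h : R) :
  closed_form_on u v a b c d ->
  (0 <= w)%R -> (0 <= h)%R -> (0 < eps)%R ->
  (a <= x)%R -> (x + w <= b)%R -> (c <= y)%R -> (y + h <= d)%R ->
  in_rect x (x + w) y (y + h) x0 y0 -> (w < delta)%R -> (h < delta)%R ->
  (forall x' y', (Rabs (x' - x0) < delta)%R -> (Rabs (y' - y0) < delta)%R ->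
      (Rabs (u x' y' - u x0 y0 - p * (x' - x0) - uy * (y' - y0))
        <= eps * (Rabs (x' - x0) + Rabs (y' - y0)))%R) ->
  (forall x' y', (Rabs (x' - x0) < delta)%R -> (Rabs (y' - y0) < delta)%R ->
      (Rabs (v x' y' - v x0 y0 - vx * (x' - x0) - p * (y' - y0))
        <= eps * (Rabs (x' - x0) + Rabs (y' - y0)))%R) ->
  (Rabs (circulation u v x w y h) <= 2 * eps * ((w + h) * (w + h)))%R.
Proof.
  intros H Hw Hh Heps Hx1 Hx2 Hy1 Hy2 [Hx0 Hy0] Hwd Hhd Hu Hv.
  assert (Near : forall s t, (x <= s <= x + w)%R -> (y <= t <= y + h)%R ->
    (Rabs (s - x0) <= w)%R /\ (Rabs (t - y0) <= h)%R).
  { intros s t Hs Ht. split; apply Rabs_le; lra. }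
  assert (Hu' : forall s t, (x <= s <= x + w)%R -> (y <= t <= y + h)%R ->
    (Rabs (u s t - u x0 y0 - p * (s - x0) - uy * (t - y0)) <= eps * (w + h))%R).
  { intros s t Hs Ht. destruct (Near s t Hs Ht).
    eapply Rle_trans; [apply Hu; lra|]. apply Rmult_le_compat_l; lra. }
  assert (Hv' : forall s t, (x <= s <= x + w)%R -> (y <= t <= y + h)%R ->
    (Rabs (v s t - v x0 y0 - vx * (s - x0) - p * (t - y0)) <= eps * (w + h))%R).
  { intros s t Hs Ht. destruct (Near s t Hs Ht).
    eapply Rle_trans; [apply Hv; lra|]. apply Rmult_le_compat_l; lra. }
  pose proof (RInt_diff_near_const (u (x + w)%R) (u x) y h (p * w) (2 * eps * (w + h)) Hh) as A.
  pose proof (RInt_diff_near_const (fun s => v s (y + h)%R) (fun s => v s y) x w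
    (p * h) (2 * eps * (w + h)) Hw) as B.
  unfold circulation.
  match type of A with _ -> _ -> _ -> (Rabs ?q <= _)%R => set (qa := q) in * end.
  match type of B with _ -> _ -> _ -> (Rabs ?q <= _)%R => set (qb := q) in * end.
  match goal with |- (Rabs ?q <= _)%R => replace q with (qa - qb)%R
    by (unfold qa, qb; ring) end.
  assert (A' : (Rabs qa <= h * (2 * eps * (w + h)))%R).
  { apply A; try (eapply closed_form_ex_RInt_u; [exact H|lra..]).
    intros t Ht. pose proof (Hu' (x + w)%R t) as U1. pose proof (Hu' x t) as U2.
    match goal with |- (Rabs ?q <= _)%R => replace q with
      ((u (x + w)%R t - u x0 y0 - p * (x + w - x0) - uy * (t - y0)) -
       (u x t - u x0 y0 - p * (x - x0) - uy * (t - y0)))%R by ring end.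
    unfold Rminus at 1. eapply Rle_trans; [apply Rabs_triang|]. rewrite Rabs_Ropp.
    assert (U1' := U1 ltac:(lra) Ht). assert (U2' := U2 ltac:(lra) Ht). lra. }
  assert (B' : (Rabs qb <= w * (2 * eps * (w + h)))%R).
  { apply B; try (eapply closed_form_ex_RInt_v; [exact H|lra..]).
    intros t Ht. pose proof (Hv' t (y + h)%R) as U1. pose proof (Hv' t y) as U2.
    match goal with |- (Rabs ?q <= _)%R => replace q with
      ((v t (y + h)%R - v x0 y0 - vx * (t - x0) - p * (y + h - y0)) -
       (v t y - v x0 y0 - vx * (t - x0) - p * (y - y0)))%R by ring end.
    unfold Rminus at 1. eapply Rle_trans; [apply Rabs_triang|]. rewrite Rabs_Ropp.
    assert (U1' := U1 Ht ltac:(lra)). assert (U2' := U2 Ht ltac:(lra)). lra. }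
  unfold Rminus. eapply Rle_trans; [apply Rabs_triang|]. rewrite Rabs_Ropp.
  lra.
Qed.

Lemma dependent_iteration {T : Type} (P : nat -> T -> Prop) (S : nat -> T -> T -> Prop) (t0 : T) :
  P 0%nat t0 -> (forall n t, P n t -> exists t', P (Datatypes.S n) t' /\ S n t t') ->
  exists s : nat -> T, s 0%nat = t0 /\ forall n, P n (s n) /\ S n (s n) (s (Datatypes.S n)).
Proof.
  intros H0 Hs.
  set (Q n := {t : T | P n t}).
  assert (step : forall n (t : Q n), {t' : Q (Datatypes.S n) | S n (proj1_sig t) (proj1_sig t')}).
  { intros n [t Ht]. destruct (constructive_indefinite_description _ (Hs n t Ht)) as [t' [H1 H2]].
    exists (exist _ t' H1). exact H2. }
  set (q := nat_rect Q (exist _ t0 H0) (fun n t => proj1_sig (step n t))).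
  exists (fun n => proj1_sig (q n)). split; [reflexivity|].
  intros n. split; [apply (proj2_sig (q n))|].
  exact (proj2_sig (step n (q n))).
Qed.

Lemma nested_halving (s : nat -> R) (w : R) :
  (0 <= w)%R ->
  (forall n, (s n <= s (S n) <= s n + w / 2 ^ S n)%R) ->
  exists l, forall n, (s n <= l <= s n + w / 2 ^ n)%R.
Proof.
  intros Hw Hs.
  assert (Hp : forall n, (0 < 2 ^ n)%R) by (intros; apply pow_lt; lra).
  assert (Hincr : forall n k, (s n <= s (n + k)%nat)%R).
  { intros n k. induction k as [|k IH]; [rewrite Nat.add_0_r; lra|].
    rewrite Nat.add_succ_r. specialize (Hs (n + k)%nat). lra. }
  assert (Hdecr : forall n k, (s (n + k)%nat + w / 2 ^ (n + k) <= s n + w / 2 ^ n)%R).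
  { intros n k. induction k as [|k IH]; [rewrite Nat.add_0_r; lra|].
    rewrite Nat.add_succ_r. specialize (Hs (n + k)%nat).
    assert (w / 2 ^ (n + k) = 2 * (w / 2 ^ S (n + k)))%R.
    { simpl. specialize (Hp (n + k)%nat). field. lra. }
    lra. }
  assert (Hw' : forall n, (0 <= w / 2 ^ n)%R).
  { intros. apply Rmult_le_pos; [assumption|]. left. apply Rinv_0_lt_compat, Hp. }
  assert (Hle : forall n m, (s m <= s n + w / 2 ^ n)%R).
  { intros n m. pose proof (Hincr m n). pose proof (Hdecr n m).
    rewrite (Nat.add_comm m n) in H. specialize (Hw' (n + m)%nat). lra. }
  destruct (completeness (fun x => exists n, x = s n)) as [l [Hub Hlub]].
  - exists (s 0%nat + w / 2 ^ 0)%R. intros x [n ->]. apply Hle.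
  - exists (s 0%nat), 0%nat. reflexivity.
  - exists l. intros n. split; [apply Hub; now exists n|].
    apply Hlub. intros x [m ->]. apply Hle.
Qed.

Lemma half_pow_lt (x delta : R) :
  (0 < delta)%R -> exists n, (x / 2 ^ n < delta)%R.
Proof.
  intros Hd. destruct (Rle_or_lt x 0) as [Hx|Hx].
  - exists 0%nat. simpl. lra.
  - destruct (Pow_x_infinity 2 ltac:(rewrite Rabs_pos_eq; lra) (x / delta + 1)) as [n Hn].
    exists n. specialize (Hn n (le_n n)). rewrite Rabs_pos_eq in Hn by (apply pow_le; lra).
    assert (0 < 2 ^ n)%R by (apply pow_lt; lra).
    apply Rmult_lt_reg_r with (2 ^ n)%R; [assumption|].
    replace (x / 2 ^ n * 2 ^ n)%R with (x / delta * delta)%R by (field; lra).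
    rewrite Rmult_comm. apply Rmult_lt_compat_l; lra.
Qed.

(** Goursat's bisection: only differentiability at each point is assumed, not
    continuity of the partial derivatives. *)
Lemma goursat (u v : R -> R -> R) (a w c h : R) :
  (0 <= w)%R -> (0 <= h)%R ->
  closed_form_on u v a (a + w) c (c + h) -> circulation u v a w c h = 0%R.
Proof.
  intros Hw Hh H. apply NNPP. intros Hne.
  set (J := Rabs (circulation u v a w c h)).
  assert (HJ : (0 < J)%R) by now apply Rabs_pos_lt.
  assert (Hp : forall n, (0 < 2 ^ n)%R) by (intros; apply pow_lt; lra).
  assert (Hp4 : forall n, (0 < 4 ^ n)%R) by (intros; apply pow_lt; lra).
  set (P := fun n (t : R * R) =>
    (a <= fst t)%R /\ (fst t + w / 2 ^ n <= a + w)%R /\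
    (c <= snd t)%R /\ (snd t + h / 2 ^ n <= c + h)%R /\
    (J <= 4 ^ n * Rabs (circulation u v (fst t) (w / 2 ^ n) (snd t) (h / 2 ^ n)))%R).
  set (Sub := fun n (t t' : R * R) =>
    (fst t <= fst t' <= fst t + w / 2 ^ S n)%R /\
    (snd t <= snd t' <= snd t + h / 2 ^ S n)%R).
  destruct (dependent_iteration P Sub (a, c)) as [s [_ Hs]].
  - unfold P, J; simpl. unfold Rdiv. rewrite Rinv_1, !Rmult_1_r. lra.
  - intros n [x y] (H1 & H2 & H3 & H4 & H5). unfold P, Sub; simpl in *.
    set (w' := (w / (2 * 2 ^ n))%R). set (h' := (h / (2 * 2 ^ n))%R).
    assert (Ew : (w / 2 ^ n = 2 * w')%R) by (unfold w'; specialize (Hp n); field; lra).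
    assert (Eh : (h / 2 ^ n = 2 * h')%R) by (unfold h'; specialize (Hp n); field; lra).
    assert (Hw' : (0 <= w')%R).
    { apply Rmult_le_pos; [assumption|]. left. apply Rinv_0_lt_compat.
      specialize (Hp n). lra. }
    assert (Hh' : (0 <= h')%R).
    { apply Rmult_le_pos; [assumption|]. left. apply Rinv_0_lt_compat.
      specialize (Hp n). lra. }
    rewrite Ew, Eh in *.
    rewrite (circulation_quarter u v a (a + w) c (c + h) x w' y h') in H5
      by (assumption || lra).
    set (c1 := circulation u v x w' y h') in *.
    set (c2 := circulation u v (x + w') w' y h') in *.
    set (c3 := circulation u v x w' (y + h') h') in *.
    set (c4 := circulation u v (x + w') w' (y + h') h') in *.
    pose proof (Rabs_triang (c1 + c2 + c3) c4) as T1.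
    pose proof (Rabs_triang (c1 + c2) c3) as T2.
    pose proof (Rabs_triang c1 c2) as T3.
    assert (H6 : (J <= 4 ^ n * (Rabs c1 + Rabs c2 + Rabs c3 + Rabs c4))%R).
    { eapply Rle_trans; [exact H5|]. apply Rmult_le_compat_l; [|lra].
      left; apply Hp4. }
    (* One of the quarters keeps at least a fourth of the circulation. *)
    assert (Big : (J <= 4 * 4 ^ n * Rabs c1)%R \/ (J <= 4 * 4 ^ n * Rabs c2)%R \/
      (J <= 4 * 4 ^ n * Rabs c3)%R \/ (J <= 4 * 4 ^ n * Rabs c4)%R).
    { apply NNPP. intros N. apply not_or_and in N. destruct N as [N1 N].
      apply not_or_and in N. destruct N as [N2 N].
      apply not_or_and in N. destruct N as [N3 N4].
      lra. }
    destruct Big as [B|[B|[B|B]]].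
    + exists (x, y). simpl. fold w' h' c1. repeat split; lra.
    + exists (x + w', y)%R. simpl. fold w' h' c2. repeat split; lra.
    + exists (x, y + h')%R. simpl. fold w' h' c3. repeat split; lra.
    + exists (x + w', y + h')%R. simpl. fold w' h' c4. repeat split; lra.
  - destruct (nested_halving (fun n => fst (s n)) w Hw) as [x0 Hx0].
    { intros n. apply (Hs n). }
    destruct (nested_halving (fun n => snd (s n)) h Hh) as [y0 Hy0].
    { intros n. apply (Hs n). }
    assert (Hin : in_rect a (a + w) c (c + h) x0 y0).
    { pose proof (Hs 0%nat) as [(H1 & H2 & H3 & H4 & _) _].
      specialize (Hx0 0%nat). specialize (Hy0 0%nat). split; lra. }
    destruct (H x0 y0 Hin) as (p & uy & vx & Hu & Hv).
    set (L := ((w + h) * (w + h) + 1)%R).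
    assert (HL : (0 < L)%R) by (unfold L; pose proof (Rle_0_sqr (w + h)) as Q; unfold Rsqr in Q; lra).
    set (eps := (J / (4 * L))%R).
    assert (Heps : (0 < eps)%R) by (apply Rdiv_lt_0_compat; lra).
    destruct (Hu eps Heps) as [d1 [Hd1 Hu']]. destruct (Hv eps Heps) as [d2 [Hd2 Hv']].
    set (delta := Rmin d1 d2). assert (Hdelta : (0 < delta)%R) by now apply Rmin_pos.
    assert (Hl1 : (delta <= d1)%R) by apply Rmin_l.
    assert (Hl2 : (delta <= d2)%R) by apply Rmin_r.
    (* At stage [n] the circulation is at least [J / 4 ^ n], while the estimate
       near [(x0, y0)] is quadratic in the size, hence below half of that. *)
    destruct (half_pow_lt (w + h) delta Hdelta) as [n Hn].
    destruct (Hs n) as [(H1 & H2 & H3 & H4 & H5) _].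
    assert (Hwn : (0 <= w / 2 ^ n)%R).
    { apply Rmult_le_pos; [assumption|]. left; apply Rinv_0_lt_compat, Hp. }
    assert (Hhn : (0 <= h / 2 ^ n)%R).
    { apply Rmult_le_pos; [assumption|]. left; apply Rinv_0_lt_compat, Hp. }
    assert (Esum : ((w + h) / 2 ^ n = w / 2 ^ n + h / 2 ^ n)%R)
      by (unfold Rdiv; ring).
    pose proof (circulation_small u v a (a + w) c (c + h) x0 y0 p uy vx eps delta
      (fst (s n)) (w / 2 ^ n) (snd (s n)) (h / 2 ^ n) H Hwn Hhn Heps H1 H2 H3 H4) as B.
    assert (B' := B ltac:(split; [apply Hx0|apply Hy0]) ltac:(lra) ltac:(lra)
      ltac:(intros; apply Hu'; lra) ltac:(intros; apply Hv'; lra)).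
    rewrite <- Esum in B'.
    assert (E4 : (4 ^ n = 2 ^ n * 2 ^ n)%R).
    { rewrite <- Rpow_mult_distr. replace (2 * 2)%R with 4%R by ring. reflexivity. }
    assert (B2 : (4 ^ n * (2 * eps * ((w + h) / 2 ^ n * ((w + h) / 2 ^ n)))
       = 2 * eps * ((w + h) * (w + h)))%R).
    { rewrite E4. specialize (Hp n). field. lra. }
    assert (B3 : (4 ^ n * Rabs (circulation u v (fst (s n)) (w / 2 ^ n) (snd (s n)) (h / 2 ^ n))
        <= 2 * eps * ((w + h) * (w + h)))%R).
    { rewrite <- B2. apply Rmult_le_compat_l; [left; apply Hp4|assumption]. }
    assert (2 * eps * ((w + h) * (w + h)) <= 2 * eps * L)%R
      by (apply Rmult_le_compat_l; unfold L; lra).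
    assert (2 * eps * L = J / 2)%R by (unfold eps; field; lra).
    lra.
Qed.

(** * The maximum principle on circles *)

Definition Cexp (z : C) : C := (exp (Re z) * cos (Im z), exp (Re z) * sin (Im z))%R.

Lemma Cexp_plus (z w : C) : Cexp (z + w) = Cexp z * Cexp w.
Proof.
  destruct z as [x y], w as [x' y']. unfold Cexp, Cmult, Cplus; simpl.
  rewrite exp_plus, cos_plus, sin_plus. f_equal; ring.
Qed.

Lemma Cmod_Cexp (z : C) : Cmod (Cexp z) = exp (Re z).
Proof.
  rewrite <- (Rabs_pos_eq (exp (Re z))) by (left; apply exp_pos).
  rewrite <- (Rabs_pos_eq (Cmod (Cexp z))) by apply Cmod_ge_0.
  apply Rsqr_eq_abs_0. unfold Rsqr.
  replace (Cmod (Cexp z) * Cmod (Cexp z))%R with (Cmod (Cexp z) ^ 2)%R by ring.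
  rewrite Cmod2_alt. unfold Cexp; simpl.
  pose proof (sin2_cos2 (Im z)) as H. unfold Rsqr in H.
  replace (exp (Re z) * exp (Re z))%R with (exp (Re z) * exp (Re z) *
    (sin (Im z) * sin (Im z) + cos (Im z) * cos (Im z)))%R by (rewrite H; ring).
  ring.
Qed.

Lemma derivable_pt_lim_remainder (f : R -> R) (x l eps : R) :
  derivable_pt_lim f x l -> (0 < eps)%R -> exists delta, (0 < delta)%R /\
    forall h, (Rabs h < delta)%R -> (Rabs (f (x + h)%R - f x - l * h) <= eps * Rabs h)%R.
Proof.
  intros H Heps. destruct (H eps Heps) as [d Hd]. exists d. split; [apply cond_pos|].
  intros h Hh. destruct (Req_dec h 0) as [->|Hne].
  - rewrite Rplus_0_r, Rabs_R0. replace (f x - f x - l * 0)%R with 0%R by ring.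
    rewrite Rabs_R0. lra.
  - specialize (Hd h Hne Hh).
    replace (f (x + h)%R - f x - l * h)%R
      with (((f (x + h)%R - f x) / h - l) * h)%R by (field; assumption).
    rewrite Rabs_mult. apply Rmult_le_compat_r; [apply Rabs_pos|lra].
Qed.

Lemma Cmod_le_Re_Im (z : C) : (Cmod z <= Rabs (Re z) + Rabs (Im z))%R.
Proof.
  replace z with (RtoC (Re z) + Ci * RtoC (Im z)) at 1.
  - eapply Rle_trans; [apply Cmod_triangle|].
    rewrite Cmod_mult, Cmod_Ci, !Cmod_R. lra.
  - destruct z as [x y]. unfold Cplus, Cmult, Ci, RtoC; simpl. f_equal; ring.
Qed.

Lemma im_le_Cmod (z : C) : (Rabs (Im z) <= Cmod z)%R.
Proof. eapply Rle_trans; [apply Rmax_r|apply Rmax_Cmod]. Qed.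

Lemma Cexp_has_deriv_0 : C_has_deriv Cexp 0 1.
Proof.
  intros eps Heps. set (e := Rmin (1 / 2) (eps / 8)).
  assert (He : (0 < e)%R) by (apply Rmin_pos; lra).
  assert (He1 : (e <= 1 / 2)%R) by apply Rmin_l.
  assert (He2 : (e <= eps / 8)%R) by apply Rmin_r.
  destruct (derivable_pt_lim_remainder exp 0 (exp 0) e (derivable_pt_lim_exp 0) He)
    as [d1 [Hd1 H1]].
  destruct (derivable_pt_lim_remainder cos 0 _ e (derivable_pt_lim_cos 0) He)
    as [d2 [Hd2 H2]].
  destruct (derivable_pt_lim_remainder sin 0 _ e (derivable_pt_lim_sin 0) He)
    as [d3 [Hd3 H3]].
  exists (Rmin (Rmin d1 d2) (Rmin d3 e)). split; [apply Rmin_pos; apply Rmin_pos; assumption|].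
  intros w Hw. replace (w - 0) with w in * by ring.
  assert (Hx := re_le_Cmod w). assert (Hy := im_le_Cmod w).
  pose proof (Rmin_l (Rmin d1 d2) (Rmin d3 e)). pose proof (Rmin_r (Rmin d1 d2) (Rmin d3 e)).
  pose proof (Rmin_l d1 d2). pose proof (Rmin_r d1 d2).
  pose proof (Rmin_l d3 e). pose proof (Rmin_r d3 e).
  destruct w as [x y]. simpl in Hx, Hy.
  specialize (H1 x ltac:(lra)). specialize (H2 y ltac:(lra)). specialize (H3 y ltac:(lra)).
  rewrite exp_0, Rplus_0_l in H1. rewrite cos_0, sin_0, Rplus_0_l in H2.
  rewrite sin_0, cos_0, Rplus_0_l in H3.
  assert (Hx1 : (Rabs x < e)%R) by lra.
  set (A := (exp x - 1 - 1 * x)%R) in *. set (B := (cos y - 1 - - 0 * y)%R) in *.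
  set (D := (sin y - 0 - 1 * y)%R) in *.
  assert (Hex : (exp x <= 2)%R).
  { replace (exp x) with (A + x + 1)%R by (unfold A; ring).
    pose proof (Rle_abs A). pose proof (Rle_abs x).
    assert (e * Rabs x <= 1 / 2 * Rabs x)%R by (apply Rmult_le_compat_r; [apply Rabs_pos|assumption]).
    lra. }
  assert (Hex1 : (Rabs (exp x - 1) <= 2 * Rabs x)%R).
  { replace (exp x - 1)%R with (A + x)%R by (unfold A; ring).
    eapply Rle_trans; [apply Rabs_triang|].
    assert (e * Rabs x <= 1 / 2 * Rabs x)%R by (apply Rmult_le_compat_r; [apply Rabs_pos|assumption]).
    pose proof (Rabs_pos x). lra. }
  assert (Hsin : (Rabs (sin y) <= 2 * Rabs y)%R).
  { replace (sin y) with (D + y)%R by (unfold D; ring).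
    eapply Rle_trans; [apply Rabs_triang|].
    assert (e * Rabs y <= 1 / 2 * Rabs y)%R by (apply Rmult_le_compat_r; [apply Rabs_pos|assumption]).
    pose proof (Rabs_pos y). lra. }
  eapply Rle_trans; [apply Cmod_le_Re_Im|].
  unfold Cexp, Cminus, Cplus, Copp, Cmult, RtoC; simpl.
  rewrite exp_0, cos_0, sin_0.
  match goal with |- (Rabs ?p + Rabs ?q <= _)%R =>
    replace p with (A + exp x * B)%R by (unfold A, B; ring);
    replace q with ((exp x - 1) * sin y + D)%R by (unfold D; ring) end.
  pose proof (Rabs_triang A (exp x * B)). pose proof (Rabs_triang ((exp x - 1) * sin y) D).
  rewrite !Rabs_mult in *. rewrite (Rabs_pos_eq (exp x)) in * by (left; apply exp_pos).
  pose proof (Rabs_pos B). pose proof (Rabs_pos x). pose proof (Rabs_pos y).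
  assert (exp x * Rabs B <= 2 * (e * Rabs y))%R.
  { apply Rmult_le_compat; try assumption. left; apply exp_pos. }
  assert (Rabs (exp x - 1) * Rabs (sin y) <= (2 * e) * (2 * Rabs y))%R.
  { apply Rmult_le_compat; try apply Rabs_pos; lra. }
  assert (e * Rabs x <= eps / 8 * Cmod (x, y))%R by (apply Rmult_le_compat; lra).
  assert (e * Rabs y <= eps / 8 * Cmod (x, y))%R by (apply Rmult_le_compat; lra).
  lra.
Qed.

Lemma hol_at_Cexp (z : C) : hol_at Cexp z.
Proof.
  assert (H : hol_at (fun w => Cexp z * Cexp (w + - z)) z).
  { apply hol_at_mult; [apply hol_at_const|].
    apply (hol_at_comp Cexp (fun w => w + - z)).
    - replace (z + - z) with (RtoC 0) by ring. exists 1. exact Cexp_has_deriv_0.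
    - apply hol_at_plus; [apply hol_at_id|apply hol_at_const]. }
  apply (hol_at_ext_loc _ Cexp z 1) in H; [assumption|lra|].
  intros w _. rewrite <- Cexp_plus. f_equal. ring.
Qed.

Lemma hol_at_plane_diff (F : C -> C) (x y : R) :
  hol_at F (x, y) -> exists p q,
    plane_diff (fun s t => Re (F (s, t))) x y p (- q) /\
    plane_diff (fun s t => Im (F (s, t))) x y q p.
Proof.
  intros [[p q] Hd]. exists p, q.
  assert (key : forall eps, (0 < eps)%R -> exists delta, (0 < delta)%R /\
    forall x' y', (Rabs (x' - x) < delta)%R -> (Rabs (y' - y) < delta)%R ->
      (Cmod (F (x', y') - F (x, y) - (p, q) * ((x', y') - (x, y)))
        <= eps * (Rabs (x' - x) + Rabs (y' - y)))%R).
  { intros eps Heps. destruct (Hd eps Heps) as [d [Hd0 H]].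
    exists (d / 2)%R. split; [lra|]. intros x' y' Hx Hy.
    pose proof (Cmod_le_Re_Im ((x', y') - (x, y))) as Hle. simpl in Hle.
    change (x' + - x)%R with (x' - x)%R in Hle. change (y' + - y)%R with (y' - y)%R in Hle.
    eapply Rle_trans; [apply H; lra|]. apply Rmult_le_compat_l; lra. }
  split; intros eps Heps; destruct (key eps Heps) as [d [Hd0 H]]; exists d;
    (split; [assumption|]); intros x' y' Hx Hy; specialize (H x' y' Hx Hy).
  - eapply Rle_trans; [|exact H]. eapply Rle_trans; [|apply re_le_Cmod].
    right. f_equal. unfold Re; simpl. ring.
  - eapply Rle_trans; [|exact H]. eapply Rle_trans; [|apply im_le_Cmod].
    right. f_equal. unfold Im; simpl. ring.
Qed.

(** In the coordinates [z = exp (s + i t)] a circle becomes a side of a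
    rectangle, and the sides [t = 0] and [t = 2 PI] cancel: the mean of [Re G]
    over a circle does not depend on the radius, and tends to [Re (G 0)]. *)
Lemma circle_bound_Re (G : C -> C) (r M : R) :
  (0 < r)%R -> (forall z, (Cmod z <= r)%R -> hol_at G z) ->
  (forall z, Cmod z = r -> (Re (G z) <= M)%R) -> (Re (G 0) <= M)%R.
Proof.
  intros Hr HG HM. apply Rnot_lt_le. intros Hlt.
  set (e := ((Re (G 0) - M) / 2)%R). assert (He : (0 < e)%R) by (unfold e; lra).
  assert (H00 : (Cmod 0 <= r)%R) by (rewrite Cmod_0; lra).
  destruct (hol_at_cont _ _ (HG 0 H00) e He) as [d [Hd Hc]].
  set (r1 := (Rmin d r / 2)%R).
  assert (Hm : (0 < Rmin d r)%R) by now apply Rmin_pos.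
  pose proof (Rmin_l d r). pose proof (Rmin_r d r).
  assert (Hr1 : (0 < r1)%R) by (unfold r1; lra).
  assert (Hr1r : (r1 < r)%R) by (unfold r1; lra).
  assert (Hr1d : (r1 < d)%R) by (unfold r1; lra).
  (* [r1] is so small that [Re G >= M + e] on the circle of radius [r1]. *)
  set (s1 := ln r1). set (s2 := ln r).
  assert (Hs : (s1 < s2)%R) by (apply ln_increasing; assumption).
  set (F := fun z => G (Cexp z)).
  set (u := fun s t => Re (F (s, t))). set (v := fun s t => Im (F (s, t))).
  assert (Hcl : closed_form_on u v s1 (s1 + (s2 - s1)) 0 (0 + 2 * PI)).
  { intros x y [Hx _].
    assert (HF : hol_at F (x, y)).
    { apply (hol_at_comp G Cexp); [|apply hol_at_Cexp].
      apply HG. rewrite Cmod_Cexp. simpl. rewrite <- (exp_ln r Hr).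
      assert (x <= ln r)%R by (unfold s2 in Hx; lra).
      destruct (Rle_lt_or_eq_dec x (ln r)) as [Hlt'|Heq]; [assumption| |].
      - left. now apply exp_increasing.
      - rewrite Heq. lra. }
    destruct (hol_at_plane_diff F x y HF) as (p & q & Hu & Hv).
    exists p, (- q)%R, q. now split. }
  pose proof PI_RGT_0 as Hpi.
  pose proof (goursat u v s1 (s2 - s1) 0 (2 * PI) ltac:(lra) ltac:(lra) Hcl) as E.
  unfold circulation in E.
  assert (Eper : RInt (fun s => v s (0 + 2 * PI)%R) s1 (s1 + (s2 - s1))
     = RInt (fun s => v s 0%R) s1 (s1 + (s2 - s1))).
  { apply RInt_ext. intros s _. unfold v, F, Cexp; simpl.
    rewrite Rplus_0_l, cos_2PI, sin_2PI, cos_0, sin_0. reflexivity. }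
  rewrite Eper in E. replace (s1 + (s2 - s1))%R with s2 in * by ring.
  assert (Hex : forall s, (s1 <= s <= s2)%R -> ex_RInt (u s) 0 (0 + 2 * PI)).
  { intros s Hs'. eapply closed_form_ex_RInt_u; [exact Hcl|lra..]. }
  assert (I2 : (RInt (u s2) 0 (0 + 2 * PI) <= RInt (fun _ => M) 0 (0 + 2 * PI))%R).
  { apply RInt_le; [lra|apply Hex; lra|apply ex_RInt_const|].
    intros t _. apply HM. rewrite Cmod_Cexp. simpl. now apply exp_ln. }
  assert (I1 : (RInt (fun _ => M + e)%R 0 (0 + 2 * PI) <= RInt (u s1) 0 (0 + 2 * PI))%R).
  { apply RInt_le; [lra|apply ex_RInt_const|apply Hex; lra|].
    intros t _. unfold u, F.
    assert (Hz : (Cmod (Cexp (s1, t) - 0) < d)%R).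
    { replace (Cexp (s1, t) - 0) with (Cexp (s1, t)) by ring.
      rewrite Cmod_Cexp. simpl. unfold s1. rewrite exp_ln; assumption. }
    specialize (Hc _ Hz).
    pose proof (re_le_Cmod (G (Cexp (s1, t)) - G 0)) as Hre.
    unfold Cminus in Hre at 1. simpl in Hre.
    change (fst (G (Cexp (s1, t)))) with (Re (G (Cexp (s1, t)))) in Hre.
    change (fst (G 0)) with (Re (G 0)) in Hre.
    assert (Ha := Rabs_def2 _ _ (Rle_lt_trans _ _ _ Hre Hc)). unfold e in *. lra. }
  rewrite !RInt_const in *. unfold scal in *; simpl in *; unfold mult in *; simpl in *.
  assert (0 < 2 * PI * e)%R by (apply Rmult_lt_0_compat; lra).
  lra.
Qed.

(** A rotation makes [G 0] real and nonnegative. *)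
Lemma circle_bound (G : C -> C) (r M : R) :
  (0 < r)%R -> (forall z, (Cmod z <= r)%R -> hol_at G z) ->
  (forall z, Cmod z = r -> (Cmod (G z) <= M)%R) -> (Cmod (G 0) <= M)%R.
Proof.
  intros Hr HG HM. destruct (Ceq_dec (G 0) 0) as [E|Hne].
  - rewrite E, Cmod_0. eapply Rle_trans; [apply Cmod_ge_0|].
    apply (HM r). rewrite Cmod_R. apply Rabs_pos_eq. lra.
  - set (lam := Cconj (G 0) / Cmod (G 0)).
    assert (Hm : (0 < Cmod (G 0))%R) by now apply Cmod_gt_0.
    assert (Hm0 : RtoC (Cmod (G 0)) <> 0).
    { intros H. apply RtoC_inj in H. lra. }
    assert (Hlam : Cmod lam = 1%R).
    { unfold lam. rewrite Cmod_div by assumption.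
      rewrite Cmod_conj, Cmod_R, Rabs_pos_eq by lra. field. lra. }
    assert (E : lam * G 0 = Cmod (G 0)).
    { unfold lam. replace (Cconj (G 0) / Cmod (G 0) * G 0)
        with ((G 0 * Cconj (G 0)) / Cmod (G 0)) by (field; assumption).
      rewrite <- Cmod2_conj. rewrite RtoC_pow. simpl. field. assumption. }
    assert (H : (Re (lam * G 0) <= M)%R); [|rewrite E in H; exact H].
    apply (circle_bound_Re (fun z => lam * G z) r M Hr).
    + intros z Hz. apply hol_at_mult; [apply hol_at_const|now apply HG].
    + intros z Hz. eapply Rle_trans; [apply Rle_abs|].
      eapply Rle_trans; [apply re_le_Cmod|]. rewrite Cmod_mult, Hlam, Rmult_1_l.
      now apply HM.
Qed.

(** * Disc automorphisms and the maximum principle on the disc *)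

(** The involution exchanging [a] and [0]; [Cmod (mobius a z)] is the
    pseudo-hyperbolic distance of [a] and [z]. *)
Definition mobius (a z : C) : C := (a - z) / (1 - Cconj a * z).

Lemma mobius_sq_identity (a z : C) :
  (Cmod (a - z) ^ 2 + (1 - Cmod a ^ 2) * (1 - Cmod z ^ 2)
    = Cmod (1 - Cconj a * z) ^ 2)%R.
Proof.
  rewrite !Cmod2_alt. destruct a as [a1 a2], z as [z1 z2].
  unfold Re, Im; simpl. ring.
Qed.

Lemma mobius_den_bound (a z : C) :
  (1 - Cmod a * Cmod z <= Cmod (1 - Cconj a * z))%R.
Proof.
  pose proof (Cmod_triangle_inv 1 (Cconj a * z)) as H.
  rewrite Cmod_1, Cmod_mult, Cmod_conj in H. exact H.
Qed.

Lemma Cmod_den_sym (a z : C) :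
  Cmod (1 - Cconj a * z) = Cmod (1 - Cconj z * a).
Proof.
  rewrite <- Cmod_conj. f_equal.
  rewrite Cminus_conj, Cmult_conj, Cconj_conj.
  replace (Cconj 1) with (RtoC 1) by (unfold Cconj, RtoC; simpl; f_equal; ring).
  ring.
Qed.

Lemma prod_lt_1 (x y : R) : (0 <= x < 1)%R -> (0 <= y <= 1)%R -> (x * y < 1)%R.
Proof.
  intros Hx Hy. apply Rle_lt_trans with (x * 1)%R; [|lra].
  apply Rmult_le_compat_l; lra.
Qed.

Lemma mobius_den_pos (a z : C) :
  unit_disc a -> (Cmod z <= 1)%R -> (0 < Cmod (1 - Cconj a * z))%R.
Proof.
  unfold unit_disc. intros Ha Hz. eapply Rlt_le_trans; [|apply mobius_den_bound].
  pose proof (prod_lt_1 (Cmod a) (Cmod z)).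
  pose proof (Cmod_ge_0 a). pose proof (Cmod_ge_0 z). lra.
Qed.

Lemma mobius_den (a z : C) :
  unit_disc a -> (Cmod z <= 1)%R -> 1 - Cconj a * z <> 0.
Proof. intros Ha Hz. apply Cmod_gt_0. now apply mobius_den_pos. Qed.

Lemma Cmod_mobius (a z : C) :
  unit_disc a -> (Cmod z <= 1)%R ->
  Cmod (mobius a z) = (Cmod (a - z) / Cmod (1 - Cconj a * z))%R.
Proof. intros Ha Hz. apply Cmod_div. now apply mobius_den. Qed.

(** Turns distances to the unit circle into estimates for the pseudo-hyperbolic
    distance, and back. *)
Lemma mobius_defect (a z : C) :
  unit_disc a -> (Cmod z <= 1)%R ->
  ((1 - Cmod (mobius a z) ^ 2) * Cmod (1 - Cconj a * z) ^ 2
    = (1 - Cmod a ^ 2) * (1 - Cmod z ^ 2))%R.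
Proof.
  intros Ha Hz. rewrite Cmod_mobius by assumption.
  pose proof (mobius_sq_identity a z). pose proof (mobius_den_pos a z Ha Hz).
  replace ((1 - (Cmod (a - z) / Cmod (1 - Cconj a * z)) ^ 2) *
    Cmod (1 - Cconj a * z) ^ 2)%R
    with (Cmod (1 - Cconj a * z) ^ 2 - Cmod (a - z) ^ 2)%R by (field; lra).
  lra.
Qed.

Lemma one_minus_sq_pos (x : R) : (0 <= x < 1)%R -> (0 < 1 - x ^ 2)%R.
Proof. intros H. assert (x * x < 1)%R by (apply prod_lt_1; lra). simpl. lra. Qed.

Lemma lt_1_of_defect (x : R) : (0 < 1 - x ^ 2)%R -> (x < 1)%R.
Proof.
  intros H. apply Rnot_le_lt. intros Hx.
  assert (1 * 1 <= x * x)%R by (apply Rmult_le_compat; lra). simpl in H. lra.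
Qed.

Lemma mobius_disc (a z : C) : unit_disc a -> unit_disc z -> unit_disc (mobius a z).
Proof.
  intros Ha Hz. unfold unit_disc in *.
  pose proof (mobius_defect a z Ha ltac:(lra)) as E.
  pose proof (mobius_den_pos a z Ha ltac:(lra)) as Hd.
  pose proof (one_minus_sq_pos (Cmod a) ltac:(pose proof (Cmod_ge_0 a); lra)).
  pose proof (one_minus_sq_pos (Cmod z) ltac:(pose proof (Cmod_ge_0 z); lra)).
  apply lt_1_of_defect. apply Rmult_lt_reg_r with (Cmod (1 - Cconj a * z) ^ 2)%R.
  - now apply pow_lt.
  - rewrite E, Rmult_0_l. now apply Rmult_lt_0_compat.
Qed.

Lemma mobius_sym (a z : C) :
  unit_disc a -> unit_disc z -> Cmod (mobius a z) = Cmod (mobius z a).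
Proof.
  intros Ha Hz. unfold unit_disc in *. rewrite !Cmod_mobius by (assumption || lra).
  now rewrite Cmod_minus_sym, Cmod_den_sym.
Qed.

Lemma mobius_self (a : C) : mobius a a = 0.
Proof. unfold mobius. replace (a - a) with (RtoC 0) by ring. unfold Cdiv. ring. Qed.

Lemma Cminus_neq (z w : C) : z <> w -> z - w <> 0.
Proof. intros H E. apply H. replace z with (z - w + w) by ring. rewrite E. ring. Qed.

Lemma mobius_eq_0 (a z : C) :
  unit_disc a -> unit_disc z -> mobius a z = 0 -> a = z.
Proof.
  intros Ha Hz E. apply NNPP. intros Hne.
  assert (H : (0 < Cmod (mobius a z))%R).
  { rewrite Cmod_mobius by (unfold unit_disc in *; assumption || lra).
    apply Rdiv_lt_0_compat; [now apply Cmod_gt_0, Cminus_neq|].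
    apply mobius_den_pos; unfold unit_disc in *; [assumption|lra]. }
  rewrite E, Cmod_0 in H. lra.
Qed.

Lemma mobius_neq_0 (a z : C) :
  unit_disc a -> unit_disc z -> a <> z -> mobius a z <> 0.
Proof. intros Ha Hz Hne E. apply Hne. now apply mobius_eq_0. Qed.

Lemma mobius_0_r (a : C) : mobius a 0 = a.
Proof. unfold mobius. now field. Qed.

Lemma mobius_0_l (z : C) : mobius 0 z = - z.
Proof.
  unfold mobius. replace (Cconj 0) with (RtoC 0)
    by (unfold Cconj, RtoC; simpl; f_equal; ring).
  now field.
Qed.

Lemma mobius_involutive (a z : C) :
  unit_disc a -> unit_disc z -> mobius a (mobius a z) = z.
Proof.
  intros Ha Hz. unfold unit_disc in *.
  pose proof (mobius_den a z Ha ltac:(lra)) as H1.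
  pose proof (mobius_den a a Ha ltac:(lra)) as H2.
  unfold mobius.
  assert (E1 : a - (a - z) / (1 - Cconj a * z)
    = (1 - Cconj a * a) * z / (1 - Cconj a * z)) by (field; assumption).
  assert (E2 : 1 - Cconj a * ((a - z) / (1 - Cconj a * z))
    = (1 - Cconj a * a) / (1 - Cconj a * z)) by (field; assumption).
  rewrite E1, E2. field. now split.
Qed.

Lemma hol_at_mobius (a z : C) :
  unit_disc a -> (Cmod z <= 1)%R -> hol_at (mobius a) z.
Proof.
  intros Ha Hz.
  apply (hol_at_div (fun z => a - z) (fun z => 1 - Cconj a * z)).
  - apply hol_at_minus; [apply hol_at_const|apply hol_at_id].
  - apply hol_at_minus; [apply hol_at_const|].
    apply hol_at_mult; [apply hol_at_const|apply hol_at_id].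
  - now apply mobius_den.
Qed.

Lemma Cmod_mobius_le (a z : C) :
  unit_disc a -> unit_disc z -> (Cmod (mobius a z) <= Cmod (z - a) / (1 - Cmod a))%R.
Proof.
  intros Ha Hz. unfold unit_disc in *.
  rewrite Cmod_mobius by (assumption || lra). rewrite (Cmod_minus_sym z a).
  apply Rmult_le_compat_l; [apply Cmod_ge_0|].
  apply Rinv_le_contravar; [lra|].
  eapply Rle_trans; [|apply mobius_den_bound].
  assert (Cmod a * Cmod z <= Cmod a * 1)%R
    by (apply Rmult_le_compat_l; [apply Cmod_ge_0|lra]). lra.
Qed.

Lemma Cmod_mobius_ge (a z : C) :
  unit_disc a -> unit_disc z -> (Cmod (z - a) / 2 <= Cmod (mobius a z))%R.
Proof.
  intros Ha Hz. unfold unit_disc in *.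
  rewrite Cmod_mobius by (assumption || lra). rewrite (Cmod_minus_sym z a).
  apply Rmult_le_compat_l; [apply Cmod_ge_0|].
  apply Rinv_le_contravar; [apply mobius_den_pos; [assumption|lra]|].
  eapply Rle_trans; [apply Cmod_minus_le|].
  rewrite Cmod_1, Cmod_mult, Cmod_conj.
  pose proof (prod_lt_1 (Cmod a) (Cmod z)).
  pose proof (Cmod_ge_0 a). pose proof (Cmod_ge_0 z). lra.
Qed.

Lemma mobius_boundary (p : C) (r : R) :
  unit_disc p -> (0 <= r < 1)%R ->
  exists r', (0 <= r' < 1)%R /\
    forall z, (r' < Cmod z < 1)%R -> (r < Cmod (mobius p z))%R.
Proof.
  intros Hp Hr. unfold unit_disc in Hp.
  pose proof (Cmod_ge_0 p) as Hp0.
  pose proof (one_minus_sq_pos r Hr) as Hr2.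
  set (k := ((1 - r ^ 2) * (1 - Cmod p) ^ 2 / 2)%R).
  assert (Hk : (0 < k)%R).
  { apply Rdiv_lt_0_compat; [|lra]. apply Rmult_lt_0_compat; [assumption|].
    apply pow_lt. lra. }
  exists (Rmax 0 (1 - k)). split.
  { split; [apply Rmax_l|]. apply Rmax_lub_lt; lra. }
  intros z [Hz1 Hz2].
  pose proof (Rmax_l 0 (1 - k)). pose proof (Rmax_r 0 (1 - k)).
  pose proof (mobius_defect p z Hp ltac:(lra)) as E.
  pose proof (mobius_den_bound p z) as Hd.
  pose proof (Cmod_ge_0 (mobius p z)) as Hm.
  assert (Hd' : (1 - Cmod p <= Cmod (1 - Cconj p * z))%R).
  { eapply Rle_trans; [|exact Hd].
    assert (Cmod p * Cmod z <= Cmod p * 1)%R by (apply Rmult_le_compat_l; lra). lra. }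
  apply Rnot_le_lt. intros Hle.
  assert (Hle2 : (Cmod (mobius p z) ^ 2 <= r ^ 2)%R) by (apply pow_incr; lra).
  assert (Hd2 : ((1 - Cmod p) ^ 2 <= Cmod (1 - Cconj p * z) ^ 2)%R)
    by (apply pow_incr; lra).
  assert (L : ((1 - r ^ 2) * (1 - Cmod p) ^ 2 <= (1 - Cmod p ^ 2) * (1 - Cmod z ^ 2))%R).
  { rewrite <- E. apply Rmult_le_compat; try lra. apply pow_le; lra. }
  assert (U : ((1 - Cmod p ^ 2) * (1 - Cmod z ^ 2) <= 1 * (2 * (1 - Cmod z)))%R).
  { pose proof (pow2_ge_0 (Cmod p)).
    pose proof (one_minus_sq_pos (Cmod p) ltac:(lra)).
    pose proof (one_minus_sq_pos (Cmod z) ltac:(lra)).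
    apply Rmult_le_compat; try lra.
    replace (1 - Cmod z ^ 2)%R with ((1 + Cmod z) * (1 - Cmod z))%R by ring.
    apply Rmult_le_compat_r; lra. }
  unfold k in *. lra.
Qed.

(** Every point of the disc becomes the centre after an automorphism, which
    turns the bound on circles into the maximum principle. *)
Lemma disc_max_principle (G : C -> C) (r M : R) :
  (0 <= r < 1)%R -> (forall z, unit_disc z -> hol_at G z) ->
  (forall z, (r < Cmod z < 1)%R -> (Cmod (G z) <= M)%R) ->
  forall p, unit_disc p -> (Cmod (G p) <= M)%R.
Proof.
  intros Hr HG HM p Hp.
  destruct (mobius_boundary p r Hp Hr) as [r' [Hr' H]].
  set (s := ((r' + 1) / 2)%R).
  rewrite <- (mobius_0_r p).
  apply (circle_bound (fun z => G (mobius p z)) s M); [unfold s; lra| |].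
  - intros z Hz. assert (unit_disc z) by (unfold unit_disc, s in *; lra).
    apply (hol_at_comp G (mobius p)).
    + apply HG. now apply mobius_disc.
    + apply hol_at_mobius; [assumption|]. unfold s in Hz; lra.
  - intros z Hz. apply HM. split.
    + apply H. unfold s in Hz; lra.
    + apply mobius_disc; [assumption|]. unfold unit_disc, s in *; lra.
Qed.

(** The finite Blaschke product with zeros [X], without normalizing constants. *)
Definition mobius_prod (X : list C) (z : C) : C :=
  fold_right (fun a p => mobius a z * p) (RtoC 1) X.

Lemma mobius_prod_app (X Y : list C) (z : C) :
  mobius_prod (X ++ Y) z = mobius_prod X z * mobius_prod Y z.
Proof.
  induction X as [|a X IH]; simpl; [ring|]. rewrite IH. ring.
Qed.

Lemma mobius_prod_zero (X : list C) (z : C) : In z X -> mobius_prod X z = 0.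
Proof.
  induction X as [|a X IH]; simpl; [tauto|].
  intros [->|H]; [rewrite mobius_self|rewrite IH by assumption]; ring.
Qed.

Lemma mobius_prod_neq_0 (X : list C) (z : C) :
  Forall unit_disc X -> unit_disc z -> ~ In z X -> mobius_prod X z <> 0.
Proof.
  intros HX Hz. induction HX as [|a X Ha HX IH]; simpl; intros Hn.
  - intros E. apply RtoC_inj in E. lra.
  - apply Cmult_neq_0; [|apply IH; tauto]. apply mobius_neq_0; tauto.
Qed.

Lemma mobius_prod_le_1 (X : list C) (z : C) :
  Forall unit_disc X -> unit_disc z -> (Cmod (mobius_prod X z) <= 1)%R.
Proof.
  intros HX Hz. induction HX as [|a X Ha HX IH]; simpl.
  - rewrite Cmod_1. lra.
  - rewrite Cmod_mult. pose proof (mobius_disc a z Ha Hz) as H. unfold unit_disc in H.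
    rewrite <- (Rmult_1_r 1). apply Rmult_le_compat; try apply Cmod_ge_0; lra.
Qed.

Lemma mobius_prod_le_factor (X : list C) (a z : C) :
  Forall unit_disc X -> In a X -> unit_disc z ->
  (Cmod (mobius_prod X z) <= Cmod (mobius a z))%R.
Proof.
  intros HX Hin Hz. induction HX as [|b X Hb HX IH]; simpl in *; [tauto|].
  rewrite Cmod_mult. pose proof (mobius_disc b z Hb Hz) as H. unfold unit_disc in H.
  pose proof (mobius_prod_le_1 X z HX Hz).
  pose proof (Cmod_ge_0 (mobius_prod X z)). pose proof (Cmod_ge_0 (mobius b z)).
  destruct Hin as [->|Hin].
  - rewrite <- (Rmult_1_r (Cmod (mobius a z))) at 2. now apply Rmult_le_compat_l.
  - rewrite <- (Rmult_1_l (Cmod (mobius a z))). apply Rmult_le_compat; try lra.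
    now apply IH.
Qed.

Lemma hol_at_mobius_prod (X : list C) (z : C) :
  Forall unit_disc X -> (Cmod z <= 1)%R -> hol_at (mobius_prod X) z.
Proof.
  intros HX Hz. induction HX as [|a X Ha HX IH].
  - apply (hol_at_const 1).
  - apply (hol_at_mult (mobius a) (mobius_prod X)); [now apply hol_at_mobius|assumption].
Qed.

Lemma pow_bounded_le_1 (q c : R) :
  (0 <= q)%R -> (0 < c)%R -> (forall n, (q ^ n * c <= 1)%R) -> (q <= 1)%R.
Proof.
  intros Hq Hc H. apply Rnot_lt_le. intros Hlt.
  destruct (Pow_x_infinity q ltac:(rewrite Rabs_pos_eq; lra) (/ c + 1)) as [n Hn].
  specialize (Hn n (le_n n)). specialize (H n).
  rewrite Rabs_pos_eq in Hn by (now apply pow_le).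
  assert ((/ c + 1) * c <= q ^ n * c)%R by (apply Rmult_le_compat_r; lra).
  replace ((/ c + 1) * c)%R with (1 + c)%R in H0 by (field; lra). lra.
Qed.

(** Finitely many singularities near which [g] stays bounded do not affect the
    maximum principle: [g ^ N] times the square of the Blaschke product of the
    singularities is differentiable everywhere, and the effect of this fixed
    factor disappears under [N]-th roots. *)
Lemma punctured_max_principle (g : C -> C) (X : list C) (r M : R) :
  Forall unit_disc X -> (0 <= r < 1)%R -> (0 < M)%R ->
  (forall z, unit_disc z -> ~ In z X -> hol_at g z) ->
  (forall x, In x X -> exists K delta, (0 < delta)%R /\
     forall z, unit_disc z -> ~ In z X -> (Cmod (z - x) < delta)%R -> (Cmod (g z) <= K)%R) ->
  (forall z, (r < Cmod z < 1)%R -> ~ In z X -> (Cmod (g z) <= M)%R) ->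
  forall p, unit_disc p -> ~ In p X -> (Cmod (g p) <= M)%R.
Proof.
  intros HX Hr HM Hg Hloc Hbd p Hp HpX.
  set (Q := mobius_prod X).
  assert (Hstep : forall N, (Cmod (g p ^ N * (Q p * Q p)) <= M ^ N)%R).
  { intros N.
    apply (disc_max_principle (fun z => g z ^ N * (Q z * Q z)) r (M ^ N)); try assumption.
    - intros z Hz. destruct (classic (In z X)) as [Hin|Hin].
      + exists 0. intros eps Heps.
        destruct (Hloc z Hin) as [K [delta [Hdelta HK]]].
        set (K' := (Rabs K + 1)%R).
        assert (HK' : (0 < K')%R) by (unfold K'; pose proof (Rabs_pos K); lra).
        assert (HKn : (0 < K' ^ N)%R) by now apply pow_lt.
        assert (Hz' : (0 < 1 - Cmod z)%R) by (unfold unit_disc in Hz; lra).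
        set (c := (K' ^ N / (1 - Cmod z) ^ 2)%R).
        assert (Hc : (0 < c)%R)
          by (apply Rdiv_lt_0_compat; [assumption|now apply pow_lt]).
        exists (Rmin (Rmin delta (1 - Cmod z)) (eps / c)).
        split; [apply Rmin_pos; [now apply Rmin_pos|now apply Rdiv_lt_0_compat]|].
        intros w Hw.
        pose proof (Rlt_le_trans _ _ _ Hw (Rmin_l _ _)) as Hw1.
        pose proof (Rlt_le_trans _ _ _ Hw (Rmin_r _ _)) as Hw2.
        pose proof (Rlt_le_trans _ _ _ Hw1 (Rmin_l _ _)) as Hw3.
        pose proof (Rlt_le_trans _ _ _ Hw1 (Rmin_r _ _)) as Hw4.
        assert (HwD : unit_disc w).
        { unfold unit_disc. pose proof (Cmod_triangle (w - z) z) as T.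
          replace (w - z + z) with w in T by ring. lra. }
        replace (g w ^ N * (Q w * Q w) - g z ^ N * (Q z * Q z) - 0 * (w - z))
          with (g w ^ N * (Q w * Q w))
          by (unfold Q; rewrite (mobius_prod_zero X z Hin); ring).
        destruct (classic (In w X)) as [Hwin|Hwin].
        { unfold Q. rewrite (mobius_prod_zero X w Hwin).
          replace (g w ^ N * (0 * 0)) with (RtoC 0) by ring. rewrite Cmod_0.
          apply Rmult_le_pos; [lra|apply Cmod_ge_0]. }
        rewrite !Cmod_mult, Cmod_pow.
        assert (B1 : (Cmod (g w) ^ N <= K' ^ N)%R).
        { apply pow_incr. split; [apply Cmod_ge_0|].
          pose proof (HK w HwD Hwin Hw3). pose proof (Rle_abs K). unfold K'. lra. }
        assert (B2 : (Cmod (Q w) <= Cmod (w - z) / (1 - Cmod z))%R).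
        { eapply Rle_trans; [apply mobius_prod_le_factor; eassumption|].
          apply Cmod_mobius_le; assumption. }
        apply Rle_trans with (K' ^ N * ((Cmod (w - z) / (1 - Cmod z)) *
          (Cmod (w - z) / (1 - Cmod z))))%R.
        { apply Rmult_le_compat; try assumption.
          - apply pow_le, Cmod_ge_0.
          - apply Rmult_le_pos; apply Cmod_ge_0.
          - apply Rmult_le_compat; try assumption; apply Cmod_ge_0. }
        replace (K' ^ N * (Cmod (w - z) / (1 - Cmod z) * (Cmod (w - z) / (1 - Cmod z))))%R
          with (c * Cmod (w - z) * Cmod (w - z))%R by (unfold c; field; lra).
        apply Rmult_le_compat_r; [apply Cmod_ge_0|].
        replace eps with (c * (eps / c))%R by (field; lra).
        apply Rmult_le_compat_l; lra.
      + apply hol_at_mult; [now apply hol_at_pow, Hg|].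
        assert (hol_at Q z)
          by (apply hol_at_mobius_prod; [assumption|unfold unit_disc in Hz; lra]).
        now apply hol_at_mult.
    - intros z Hz. assert (HzD : unit_disc z) by apply Hz.
      destruct (classic (In z X)) as [Hin|Hin].
      + unfold Q. rewrite (mobius_prod_zero X z Hin).
        replace (g z ^ N * (0 * 0)) with (RtoC 0) by ring. rewrite Cmod_0.
        apply pow_le. lra.
      + rewrite !Cmod_mult, Cmod_pow.
        pose proof (mobius_prod_le_1 X z HX HzD). fold Q in H.
        pose proof (Cmod_ge_0 (Q z)).
        rewrite <- (Rmult_1_r (M ^ N)). apply Rmult_le_compat.
        * apply pow_le, Cmod_ge_0.
        * now apply Rmult_le_pos.
        * apply pow_incr. split; [apply Cmod_ge_0|now apply Hbd].
        * rewrite <- (Rmult_1_r 1). now apply Rmult_le_compat. }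
  assert (HQ : (0 < Cmod (Q p))%R) by (apply Cmod_gt_0; now apply mobius_prod_neq_0).
  assert (Hq : (Cmod (g p) / M <= 1)%R).
  { apply pow_bounded_le_1 with (Cmod (Q p) * Cmod (Q p))%R.
    - apply Rmult_le_pos; [apply Cmod_ge_0|]. left. now apply Rinv_0_lt_compat.
    - now apply Rmult_lt_0_compat.
    - intros n. specialize (Hstep n). rewrite !Cmod_mult, Cmod_pow in Hstep.
      unfold Rdiv. rewrite Rpow_mult_distr, pow_inv.
      assert (0 < M ^ n)%R by now apply pow_lt.
      apply Rmult_le_reg_r with (M ^ n)%R; [assumption|].
      replace (Cmod (g p) ^ n * / M ^ n * (Cmod (Q p) * Cmod (Q p)) * M ^ n)%R
        with (Cmod (g p) ^ n * (Cmod (Q p) * Cmod (Q p)))%R by (field; lra).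
      lra. }
  apply Rmult_le_reg_r with (/ M)%R; [now apply Rinv_0_lt_compat|].
  rewrite Rinv_r by lra. exact Hq.
Qed.

(** * The Schwarz-Pick inequality and removable singularities *)

Definition C_cluster (u : nat -> C) (l : C) : Prop :=
  forall eps N, (0 < eps)%R -> exists n, (N <= n)%nat /\ (Cmod (u n - l) < eps)%R.

Lemma R_bounded_cluster (u : nat -> R) (K : R) :
  (forall n, (Rabs (u n) <= K)%R) ->
  exists l, forall eps N, (0 < eps)%R -> exists n, (N <= n)%nat /\ (Rabs (u n - l) < eps)%R.
Proof.
  intros H.
  destruct (Bolzano_Weierstrass u (fun c => (- K <= c <= K)%R)) as [l Hl].
  - apply compact_P3.
  - intros n. apply Rabs_le_between, H.
  - exists l. intros eps N Heps.
    destruct (Hl (disc l (mkposreal eps Heps)) N) as [n [Hn1 Hn2]].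
    + exists (mkposreal eps Heps). intros x Hx. exact Hx.
    + now exists n.
Qed.

Lemma C_bounded_cluster (u : nat -> C) (K : R) :
  (forall n, (Cmod (u n) <= K)%R) -> exists l, C_cluster u l.
Proof.
  intros H.
  destruct (R_bounded_cluster (fun n => Re (u n)) K) as [x Hx].
  { intros n. eapply Rle_trans; [apply re_le_Cmod|apply H]. }
  destruct (choice (fun k n => (k <= n)%nat /\ (Rabs (Re (u n) - x) < / (INR k + 1))%R))
    as [s Hs].
  { intros k. apply Hx. apply Rinv_0_lt_compat. pose proof (pos_INR k). lra. }
  destruct (R_bounded_cluster (fun k => Im (u (s k))) K) as [y Hy].
  { intros n. eapply Rle_trans; [apply im_le_Cmod|apply H]. }
  exists (x, y). intros eps N Heps.
  destruct (INR_unbounded (2 / eps)) as [N' HN'].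
  destruct (Hy (eps / 2)%R (max N N') ltac:(lra)) as [k [Hk1 Hk2]].
  destruct (Hs k) as [Hs1 Hs2].
  exists (s k). split; [lia|].
  eapply Rle_lt_trans; [apply Cmod_le_Re_Im|].
  replace (Re (u (s k) - (x, y))) with (Re (u (s k)) - x)%R
    by (unfold Re; simpl; ring).
  replace (Im (u (s k) - (x, y))) with (Im (u (s k)) - y)%R
    by (unfold Im; simpl; ring).
  assert (/ (INR k + 1) <= eps / 2)%R.
  { assert (INR N' <= INR k)%R by (apply le_INR; lia).
    replace (eps / 2)%R with (/ (2 / eps))%R by (field; lra).
    apply Rinv_le_contravar; [apply Rdiv_lt_0_compat; lra|lra]. }
  lra.
Qed.

Lemma hol_at_lipschitz (m : C -> C) (w : C) :
  hol_at m w -> exists K delta, (0 < K)%R /\ (0 < delta)%R /\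
    forall z, (Cmod (z - w) < delta)%R -> (Cmod (m z - m w) <= K * Cmod (z - w))%R.
Proof.
  intros [d Hd]. destruct (Hd 1%R Rlt_0_1) as [delta [Hdelta H]].
  exists (Cmod d + 1)%R, delta. pose proof (Cmod_ge_0 d). repeat split; try lra.
  intros z Hz. specialize (H z Hz).
  replace (m z - m w) with ((m z - m w - d * (z - w)) + d * (z - w)) by ring.
  eapply Rle_trans; [apply Cmod_triangle|]. rewrite Cmod_mult. lra.
Qed.

Lemma le_of_forall_gt (x M : R) : (forall M', (M < M')%R -> (x <= M')%R) -> (x <= M)%R.
Proof.
  intros H. apply Rnot_lt_le. intros Hlt. specialize (H ((x + M) / 2)%R ltac:(lra)). lra.
Qed.

(** The maximum principle for the quotient of [mobius (g w) o g] by [mobius w]: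
    it stays bounded at [w], where the numerator vanishes, and the denominator
    has modulus close to [1] near the circle. *)
Lemma schwarz_pick_strict (g : C -> C) (X : list C) (k : R) (z w : C) :
  Forall unit_disc X -> (k < 1)%R ->
  (forall x, unit_disc x -> ~ In x X -> hol_at g x) ->
  (forall x, unit_disc x -> ~ In x X -> (Cmod (g x) <= k)%R) ->
  unit_disc z -> unit_disc w -> ~ In z X -> ~ In w X ->
  (Cmod (mobius (g w) (g z)) <= Cmod (mobius w z))%R.
Proof.
  intros HX Hk Hhol Hbd Hz Hw HzX HwX.
  assert (Hgd : forall x, unit_disc x -> ~ In x X -> unit_disc (g x)).
  { intros x Hx HxX. specialize (Hbd x Hx HxX). unfold unit_disc. lra. }
  destruct (Ceq_dec w z) as [->|Hne].
  { rewrite !mobius_self. lra. }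
  set (m := fun x => mobius (g w) (g x)).
  assert (Hm : forall x, unit_disc x -> ~ In x X -> hol_at m x).
  { intros x Hx HxX. apply (hol_at_comp (mobius (g w)) g); [|now apply Hhol].
    apply hol_at_mobius; [now apply Hgd|]. pose proof (Hgd x Hx HxX) as H.
    unfold unit_disc in H. lra. }
  assert (Hm1 : forall x, unit_disc x -> ~ In x X -> (Cmod (m x) <= 1)%R).
  { intros x Hx HxX. left. apply mobius_disc; now apply Hgd. }
  assert (Hq : (Cmod (m z / mobius w z) <= 1)%R).
  { apply le_of_forall_gt. intros M HM.
    destruct (mobius_boundary w (/ M) Hw) as [r [Hr Hbdry]].
    { split; [left; apply Rinv_0_lt_compat; lra|].
      rewrite <- Rinv_1. apply Rinv_lt_contravar; lra. }
    apply (punctured_max_principle (fun x => m x / mobius w x) (w :: X) r M);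
      try assumption.
    - now constructor.
    - lra.
    - intros x Hx HxX. apply hol_at_div.
      + apply Hm; [assumption|]. intros H; apply HxX; now right.
      + apply hol_at_mobius; [assumption|]. unfold unit_disc in Hx; lra.
      + apply mobius_neq_0; try assumption. intros E. apply HxX. now left.
    - intros x [<-|HxX].
      + destruct (hol_at_lipschitz m w (Hm w Hw HwX)) as (K & delta & HK & Hdelta & HL).
        exists (2 * K)%R, delta. split; [assumption|]. intros y Hy HyX Hyw.
        assert (Hyw0 : w <> y) by (intros E; apply HyX; now left).
        assert (Hmy : mobius w y <> 0) by now apply mobius_neq_0.
        rewrite Cmod_div by assumption. apply Cmod_gt_0 in Hmy.
        apply Rmult_le_reg_r with (Cmod (mobius w y)); [assumption|].
        unfold Rdiv. rewrite Rmult_assoc, Rinv_l, Rmult_1_r by lra.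
        specialize (HL y Hyw).
        assert (Em : m w = 0) by apply mobius_self.
        rewrite Em in HL. replace (m y - 0) with (m y) in HL by ring.
        pose proof (Cmod_mobius_ge w y Hw Hy).
        assert (K * (Cmod (y - w) / 2) <= K * Cmod (mobius w y))%R
          by (apply Rmult_le_compat_l; lra).
        lra.
      + assert (Hxw : x <> w) by (intros ->; contradiction).
        assert (Hpos : (0 < Cmod (x - w))%R) by now apply Cmod_gt_0, Cminus_neq.
        exists (4 / Cmod (x - w))%R, (Cmod (x - w) / 2)%R.
        split; [lra|]. intros y Hy HyX Hyx.
        assert (Hyw0 : w <> y) by (intros E; apply HyX; now left).
        assert (Hmy : mobius w y <> 0) by now apply mobius_neq_0.
        assert (Hmy1 : (Cmod (m y) <= 1)%R)
          by (apply Hm1; [assumption|intros H; apply HyX; now right]).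
        rewrite Cmod_div by assumption. apply Cmod_gt_0 in Hmy.
        pose proof (Cmod_mobius_ge w y Hw Hy).
        pose proof (Cmod_triangle_via y x w) as T. rewrite (Cmod_minus_sym x y) in T.
        assert (Hlow : (Cmod (x - w) / 4 <= Cmod (mobius w y))%R) by lra.
        replace (4 / Cmod (x - w))%R with (1 * / (Cmod (x - w) / 4))%R by (field; lra).
        apply Rmult_le_compat; try lra.
        * apply Cmod_ge_0.
        * left. now apply Rinv_0_lt_compat.
        * apply Rinv_le_contravar; lra.
    - intros x Hx HxX. assert (HxD : unit_disc x) by apply Hx.
      assert (Hwx : w <> x) by (intros E; apply HxX; now left).
      assert (Hmx : mobius w x <> 0) by now apply mobius_neq_0.
      rewrite Cmod_div by assumption. specialize (Hbdry x Hx).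
      assert (Cmod (m x) <= 1)%R
          by (apply Hm1; [assumption|intros H; apply HxX; now right]).
      rewrite <- (Rmult_1_l M). apply Rmult_le_compat; try lra.
      + apply Cmod_ge_0.
      + left. apply Rinv_0_lt_compat. now apply Cmod_gt_0.
      + rewrite <- (Rinv_inv M). apply Rinv_le_contravar; [|lra].
        apply Rinv_0_lt_compat. lra.
    - intros [E|E]; contradiction. }
  assert (Hmz : mobius w z <> 0) by now apply mobius_neq_0.
  rewrite Cmod_div in Hq by assumption. apply Cmod_gt_0 in Hmz.
  apply Rmult_le_reg_r with (/ Cmod (mobius w z))%R; [now apply Rinv_0_lt_compat|].
  rewrite Rinv_r by lra. exact Hq.
Qed.

(** The Schwarz-Pick inequality, multiplied out so that it remains meaningful
    for unimodular values; it is the limit of [schwarz_pick_strict] for [k * g]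
    as [k] tends to [1]. *)
Lemma schwarz_pick_punctured (g : C -> C) (X : list C) (z w : C) :
  Forall unit_disc X ->
  (forall x, unit_disc x -> ~ In x X -> hol_at g x) ->
  (forall x, unit_disc x -> ~ In x X -> (Cmod (g x) <= 1)%R) ->
  unit_disc z -> unit_disc w -> ~ In z X -> ~ In w X ->
  (Cmod (g w - g z) <= Cmod (mobius w z) * Cmod (1 - Cconj (g w) * g z))%R.
Proof.
  intros HX Hhol Hbd Hz Hw HzX HwX.
  set (t := Cmod (mobius w z)). set (a := Cmod (g w - g z)).
  set (c := Cmod (1 - Cconj (g w) * g z)).
  pose proof (Hbd z Hz HzX) as Bz. pose proof (Hbd w Hw HwX) as Bw.
  pose proof (Cmod_ge_0 (g z)) as Pz. pose proof (Cmod_ge_0 (g w)) as Pw.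
  assert (Ht : (0 <= t < 1)%R) by (split; [apply Cmod_ge_0|now apply mobius_disc]).
  assert (Ha : (a <= 2)%R).
  { eapply Rle_trans; [apply Cmod_minus_le|]. lra. }
  assert (Hscale : forall e, (0 < e < 1)%R -> ((1 - e) * a <= t * (c + 2 * e))%R).
  { intros e He. set (k := (1 - e)%R).
    assert (Hsp : (Cmod (mobius (k * g w) (k * g z)) <= t)%R).
    { apply (schwarz_pick_strict (fun x => k * g x) X k z w); try assumption.
      - unfold k; lra.
      - intros x Hx HxX. apply hol_at_mult; [apply hol_at_const|now apply Hhol].
      - intros x Hx HxX. rewrite Cmod_mult, Cmod_R, Rabs_pos_eq by (unfold k; lra).
        specialize (Hbd x Hx HxX). pose proof (Cmod_ge_0 (g x)).
        rewrite <- (Rmult_1_r k) at 2. apply Rmult_le_compat_l; unfold k; lra. }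
    assert (Hkw : unit_disc (k * g w)).
    { unfold unit_disc. rewrite Cmod_mult, Cmod_R, Rabs_pos_eq by (unfold k; lra).
      apply prod_lt_1; unfold k; lra. }
    assert (Hkz : (Cmod (k * g z) <= 1)%R).
    { left. rewrite Cmod_mult, Cmod_R, Rabs_pos_eq by (unfold k; lra).
      apply prod_lt_1; unfold k; lra. }
    pose proof (mobius_den_pos _ _ Hkw Hkz) as Hden.
    rewrite Cmod_mobius in Hsp by assumption.
    apply Rmult_le_compat_r with (r := Cmod (1 - Cconj (k * g w) * (k * g z))) in Hsp; [|lra].
    unfold Rdiv in Hsp. rewrite Rmult_assoc, Rinv_l, Rmult_1_r in Hsp by lra.
    replace (k * g w - k * g z) with (k * (g w - g z)) in Hsp by ring.
    rewrite Cmod_mult, Cmod_R, Rabs_pos_eq in Hsp by (unfold k; lra).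
    fold a in Hsp. eapply Rle_trans; [exact Hsp|].
    apply Rmult_le_compat_l; [lra|].
    rewrite Cmult_conj. replace (Cconj k) with (RtoC k)
      by (unfold Cconj, RtoC; simpl; f_equal; ring).
    replace (1 - k * Cconj (g w) * (k * g z))
      with ((1 - Cconj (g w) * g z) + RtoC (1 - k * k) * (Cconj (g w) * g z))
      by (rewrite RtoC_minus, RtoC_mult; ring).
    eapply Rle_trans; [apply Cmod_triangle|]. fold c.
    assert (Hkk : (1 - k * k = e * (2 - e))%R) by (unfold k; ring).
    assert (Hkk1 : (0 <= e * (2 - e) <= 2 * e)%R).
    { split; [apply Rmult_le_pos; lra|].
      rewrite (Rmult_comm 2). apply Rmult_le_compat_l; lra. }
    rewrite Cmod_mult, Cmod_R, Rabs_pos_eq, Cmod_mult, Cmod_conj by lra.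
    assert (Cmod (g w) * Cmod (g z) <= 1 * 1)%R by (apply Rmult_le_compat; lra).
    assert ((1 - k * k) * (Cmod (g w) * Cmod (g z)) <= (2 * e) * 1)%R.
    { apply Rmult_le_compat; try lra. now apply Rmult_le_pos. }
    lra. }
  apply Rnot_lt_le. intros Hlt.
  set (d := (a - t * c)%R). assert (Hd : (0 < d)%R) by (unfold d; lra).
  set (e := Rmin (1 / 2) (d / 8)).
  assert (He : (0 < e)%R) by (apply Rmin_pos; lra).
  assert (He1 : (e <= 1 / 2)%R) by apply Rmin_l.
  assert (He2 : (e <= d / 8)%R) by apply Rmin_r.
  specialize (Hscale e ltac:(lra)).
  assert (e * a <= e * 2)%R by (apply Rmult_le_compat_l; lra).
  assert (t * e <= 1 * e)%R by (apply Rmult_le_compat_r; lra).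
  unfold d in *. lra.
Qed.

(** The holomorphic self-maps of the disc together with the unimodular
    constants. *)
Definition schur (f : C -> C) : Prop :=
  (forall z, unit_disc z -> hol_at f z) /\
  (forall z, unit_disc z -> (Cmod (f z) <= 1)%R).

Lemma schwarz_pick (f : C -> C) (z w : C) :
  schur f -> unit_disc z -> unit_disc w ->
  (Cmod (f w - f z) <= Cmod (mobius w z) * Cmod (1 - Cconj (f w) * f z))%R.
Proof.
  intros [Hh Hb] Hz Hw. apply (schwarz_pick_punctured f nil); auto.
Qed.

Lemma mobius_le_iff (a z : C) (t : R) :
  unit_disc a -> (Cmod z <= 1)%R ->
  (Cmod (a - z) <= t * Cmod (1 - Cconj a * z))%R <-> (Cmod (mobius a z) <= t)%R.
Proof.
  intros Ha Hz. pose proof (mobius_den_pos a z Ha Hz) as Hd.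
  rewrite Cmod_mobius by assumption. split; intros H.
  - apply Rmult_le_reg_r with (Cmod (1 - Cconj a * z)); [assumption|].
    unfold Rdiv. rewrite Rmult_assoc, Rinv_l; lra.
  - apply Rmult_le_compat_r with (r := Cmod (1 - Cconj a * z)) in H; [|lra].
    unfold Rdiv in H. rewrite Rmult_assoc, Rinv_l in H; lra.
Qed.

Lemma schwarz_pick_mobius (f : C -> C) (z w : C) :
  schur f -> unit_disc z -> unit_disc w -> unit_disc (f w) ->
  (Cmod (mobius (f w) (f z)) <= Cmod (mobius w z))%R.
Proof.
  intros Hf Hz Hw Hfw. apply mobius_le_iff; [assumption|now apply Hf|].
  now apply schwarz_pick.
Qed.

(** By Schwarz-Pick, [g] is Lipschitz near the puncture, so that any cluster
    point of its values along a sequence tending to [a] is a limit. *)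
Lemma punctured_limit (g : C -> C) (a : C) (K : R) :
  unit_disc a -> (0 < K)%R ->
  (forall z, unit_disc z -> z <> a -> hol_at g z) ->
  (forall z, unit_disc z -> z <> a -> (Cmod (g z) <= K)%R) ->
  exists l B delta, (0 < delta)%R /\ (0 < B)%R /\ (Cmod l <= K)%R /\
    forall z, unit_disc z -> z <> a -> (Cmod (z - a) < delta)%R ->
      (Cmod (g z - l) <= B * Cmod (z - a))%R.
Proof.
  intros Ha HK Hhol Hbd.
  set (delta := ((1 - Cmod a) / 2)%R).
  assert (Hdelta : (0 < delta)%R) by (unfold unit_disc, delta in *; lra).
  set (B := (2 * K / delta)%R).
  assert (HB : (0 < B)%R) by (apply Rdiv_lt_0_compat; lra).
  assert (HKC : RtoC K <> 0) by (intros E; apply RtoC_inj in E; lra).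
  assert (Hin : forall z, ~ In z (a :: nil) <-> z <> a).
  { intros z; simpl; split; [intros H E; apply H; now left|].
    intros H [E|[]]. now apply H. }
  assert (Hlip : forall z w, unit_disc z -> unit_disc w -> z <> a -> w <> a ->
    (Cmod (w - a) < delta)%R -> (Cmod (g z - g w) <= B * Cmod (z - w))%R).
  { intros z w Hz Hw Hza Hwa Hwd.
    assert (Hsp : (Cmod (g w / K - g z / K) <=
      Cmod (mobius w z) * Cmod (1 - Cconj (g w / K) * (g z / K)))%R).
    { apply (schwarz_pick_punctured (fun x => g x / K) (a :: nil)); try assumption.
      - repeat constructor. assumption.
      - intros x Hx Hxa. apply Hin in Hxa. apply hol_at_mult; [now apply Hhol|].
        apply hol_at_const.
      - intros x Hx Hxa. apply Hin in Hxa.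
        rewrite Cmod_div, Cmod_R, Rabs_pos_eq by (assumption || lra).
        apply Rmult_le_reg_r with K; [assumption|].
        unfold Rdiv. rewrite Rmult_assoc, Rinv_l, Rmult_1_r, Rmult_1_l by lra.
        now apply Hbd.
      - now apply Hin.
      - now apply Hin. }
    assert (Hgk : forall x, unit_disc x -> x <> a -> (Cmod (g x / K) <= 1)%R).
    { intros x Hx Hxa.
      rewrite Cmod_div, Cmod_R, Rabs_pos_eq by (assumption || lra).
      apply Rmult_le_reg_r with K; [assumption|].
      unfold Rdiv. rewrite Rmult_assoc, Rinv_l, Rmult_1_r, Rmult_1_l by lra.
      now apply Hbd. }
    assert (Hc : (Cmod (1 - Cconj (g w / K) * (g z / K)) <= 2)%R).
    { eapply Rle_trans; [apply Cmod_minus_le|]. rewrite Cmod_1, Cmod_mult, Cmod_conj.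
      pose proof (Hgk z Hz Hza). pose proof (Hgk w Hw Hwa).
      assert (Cmod (g w / K) * Cmod (g z / K) <= 1 * 1)%R
        by (apply Rmult_le_compat; try apply Cmod_ge_0; assumption). lra. }
    assert (Hrho : (Cmod (mobius w z) <= Cmod (z - w) / delta)%R).
    { eapply Rle_trans; [now apply Cmod_mobius_le|].
      apply Rmult_le_compat_l; [apply Cmod_ge_0|].
      apply Rinv_le_contravar; [assumption|].
      pose proof (Cmod_triangle (w - a) a) as T. replace (w - a + a) with w in T by ring.
      unfold delta in *. lra. }
    replace (g w / K - g z / K) with (- ((g z - g w) / K)) in Hsp by (field; assumption).
    rewrite Cmod_opp, Cmod_div, Cmod_R, Rabs_pos_eq in Hsp by (assumption || lra).
    assert (Hsp2 : (Cmod (g z - g w) / K <= Cmod (z - w) / delta * 2)%R).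
    { eapply Rle_trans; [exact Hsp|]. apply Rmult_le_compat; try apply Cmod_ge_0; assumption. }
    apply Rmult_le_reg_r with (/ K)%R; [now apply Rinv_0_lt_compat|].
    replace (B * Cmod (z - w) * / K)%R with (Cmod (z - w) / delta * 2)%R
      by (unfold B; field; lra).
    exact Hsp2. }
  set (zn := fun n => a + RtoC (delta / (INR n + 2))).
  assert (Hzn : forall n, (0 < delta / (INR n + 2) < delta)%R).
  { intros n. pose proof (pos_INR n). split; [apply Rdiv_lt_0_compat; lra|].
    apply Rmult_lt_reg_r with (INR n + 2)%R; [lra|].
    unfold Rdiv. rewrite Rmult_assoc, Rinv_l, Rmult_1_r by lra.
    assert (0 <= delta * INR n)%R by (apply Rmult_le_pos; lra). lra. }
  assert (Hzna : forall n, Cmod (zn n - a) = (delta / (INR n + 2))%R).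
  { intros n. unfold zn. replace (a + RtoC (delta / (INR n + 2)) - a)
      with (RtoC (delta / (INR n + 2))) by ring.
    rewrite Cmod_R. apply Rabs_pos_eq. specialize (Hzn n). lra. }
  assert (Hzne : forall n, zn n <> a).
  { intros n E. specialize (Hzna n). rewrite E in Hzna.
    replace (a - a) with (RtoC 0) in Hzna by ring. rewrite Cmod_0 in Hzna.
    specialize (Hzn n). lra. }
  assert (HznD : forall n, unit_disc (zn n)).
  { intros n. unfold unit_disc.
    pose proof (Cmod_triangle (zn n - a) a) as T. replace (zn n - a + a) with (zn n) in T by ring.
    specialize (Hzna n). specialize (Hzn n). unfold delta in *. lra. }
  destruct (C_bounded_cluster (fun n => g (zn n)) K) as [l Hl].
  { intros n. now apply Hbd. }
  exists l, B, delta. repeat split; try assumption.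
  - apply le_of_forall_gt. intros M HM.
    destruct (Hl (M - K)%R 0%nat ltac:(lra)) as [n [_ Hn]].
    pose proof (Cmod_triangle_inv l (g (zn n))) as T. rewrite Cmod_minus_sym in T.
    pose proof (Hbd (zn n) (HznD n) (Hzne n)). lra.
  - intros z Hz Hza Hzd. apply le_of_forall_gt. intros M HM.
    set (e := (M - B * Cmod (z - a))%R). assert (He : (0 < e)%R) by (unfold e; lra).
    destruct (INR_unbounded (2 * B * delta / e)) as [N HN].
    destruct (Hl (e / 2)%R N ltac:(lra)) as [n [HnN Hn]].
    pose proof (Cmod_triangle_via (g (zn n)) (g z) l) as T1.
    pose proof (Hlip z (zn n) Hz (HznD n) Hza (Hzne n)) as T2.
    rewrite Hzna in T2. specialize (T2 (proj2 (Hzn n))).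
    pose proof (Cmod_triangle_via a z (zn n)) as T3.
    rewrite (Cmod_minus_sym a (zn n)), Hzna in T3.
    assert (B * Cmod (z - zn n) <= B * (Cmod (z - a) + delta / (INR n + 2)))%R
      by (apply Rmult_le_compat_l; lra).
    assert (B * (delta / (INR n + 2)) <= e / 2)%R.
    { assert (INR N <= INR n)%R by (apply le_INR; lia).
      pose proof (pos_INR n).
      apply Rmult_le_reg_r with (INR n + 2)%R; [lra|].
      replace (B * (delta / (INR n + 2)) * (INR n + 2))%R with (B * delta)%R by (field; lra).
      replace (B * delta)%R with (e / 2 * (2 * B * delta / e))%R by (field; lra).
      apply Rmult_le_compat_l; lra. }
    unfold e in *. lra.
Qed.

(** A bounded function has a limit [l] at the puncture and is Lipschitz there;
    its difference quotient [(g z - l) / (z - a)] is then bounded as well, and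
    the limit of that quotient is the missing derivative. *)
Lemma removable_singularity (g : C -> C) (a : C) :
  unit_disc a -> (forall z, unit_disc z -> z <> a -> hol_at g z) ->
  (forall z, unit_disc z -> z <> a -> (Cmod (g z) <= 1)%R) ->
  exists h, schur h /\ forall z, unit_disc z -> z <> a -> h z = g z.
Proof.
  intros Ha Hhol Hbd.
  destruct (punctured_limit g a 1 Ha Rlt_0_1 Hhol Hbd) as (l & B & d & Hd & HB & Hl & HL).
  set (h := fun z => if Ceq_dec z a then l else g z).
  assert (Eh : forall z, z <> a -> h z = g z).
  { intros z Hz. unfold h. destruct (Ceq_dec z a); [contradiction|reflexivity]. }
  assert (Eha : h a = l).
  { unfold h. destruct (Ceq_dec a a); [reflexivity|contradiction]. }
  exists h. split; [|intros; now apply Eh]. split.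
  2:{ intros z Hz. destruct (Ceq_dec z a) as [->|Hza]; [now rewrite Eha|].
      rewrite Eh by assumption. now apply Hbd. }
  intros z Hz. destruct (Ceq_dec z a) as [->|Hza].
  2:{ apply (hol_at_ext_loc g h z (Cmod (z - a))); [now apply Cmod_gt_0, Cminus_neq| |now apply Hhol].
      intros w Hw. symmetry. apply Eh. intros ->. rewrite Cmod_minus_sym in Hw. lra. }
  set (K := (B + 2 / d)%R).
  assert (Hd2 : (0 < 2 / d)%R) by (apply Rdiv_lt_0_compat; lra).
  assert (HK : (0 < K)%R) by (unfold K; lra).
  destruct (punctured_limit (fun z => (g z - l) / (z - a)) a K Ha HK)
    as (q & B2 & d2 & Hd2' & HB2 & _ & HL2).
  - intros w Hw Hwa. apply hol_at_div.
    + apply hol_at_minus; [now apply Hhol|apply hol_at_const].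
    + apply hol_at_minus; [apply hol_at_id|apply hol_at_const].
    + now apply Cminus_neq.
  - intros w Hw Hwa. pose proof (Cminus_neq _ _ Hwa) as Hn.
    rewrite Cmod_div by assumption. apply Cmod_gt_0 in Hn.
    apply Rmult_le_reg_r with (Cmod (w - a)); [assumption|].
    unfold Rdiv. rewrite Rmult_assoc, Rinv_l, Rmult_1_r by lra.
    destruct (Rlt_or_le (Cmod (w - a)) d) as [Hlt|Hge].
    + eapply Rle_trans; [now apply HL|]. apply Rmult_le_compat_r; unfold K; lra.
    + eapply Rle_trans; [apply Cmod_minus_le|]. specialize (Hbd w Hw Hwa).
      apply Rle_trans with (2 / d * d)%R; [replace (2 / d * d)%R with 2%R by (field; lra); lra|].
      apply Rmult_le_compat; unfold K; lra.
  - exists q. intros eps Heps. rewrite Eha.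
    unfold unit_disc in Ha.
    exists (Rmin (Rmin d2 (eps / B2)) (1 - Cmod a)).
    split; [apply Rmin_pos; [apply Rmin_pos; [assumption|now apply Rdiv_lt_0_compat]|lra]|].
    intros w Hw.
    pose proof (Rlt_le_trans _ _ _ Hw (Rmin_l _ _)) as Hw1.
    pose proof (Rlt_le_trans _ _ _ Hw (Rmin_r _ _)) as Hw2.
    pose proof (Rlt_le_trans _ _ _ Hw1 (Rmin_l _ _)) as Hw3.
    pose proof (Rlt_le_trans _ _ _ Hw1 (Rmin_r _ _)) as Hw4.
    destruct (Ceq_dec w a) as [->|Hwa].
    { rewrite Eha. replace (l - l - q * (a - a)) with (RtoC 0) by ring.
      rewrite Cmod_0. apply Rmult_le_pos; [lra|apply Cmod_ge_0]. }
    rewrite Eh by assumption.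
    assert (HwD : unit_disc w).
    { unfold unit_disc. pose proof (Cmod_triangle (w - a) a) as T.
      replace (w - a + a) with w in T by ring. lra. }
    pose proof (Cminus_neq _ _ Hwa) as Hn.
    replace (g w - l - q * (w - a)) with (((g w - l) / (w - a) - q) * (w - a))
      by (field; assumption).
    rewrite Cmod_mult. apply Rmult_le_compat_r; [apply Cmod_ge_0|].
    eapply Rle_trans; [now apply HL2|].
    replace eps with (B2 * (eps / B2))%R by (field; lra).
    apply Rmult_le_compat_l; lra.
Qed.

(** Schwarz-Pick bounds the quotient by [1], so its singularity at [a] is
    removable. *)
Lemma schur_division (f : C -> C) (a : C) :
  schur f -> unit_disc a -> f a = 0 ->
  exists g, schur g /\ forall z, unit_disc z -> f z = mobius a z * g z.
Proof.
  intros [Hhol Hbd] Ha Hfa.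
  destruct (removable_singularity (fun z => f z / mobius a z) a Ha) as [h [Hh Eh]].
  - intros z Hz Hza. apply hol_at_div; [now apply Hhol| |].
    + apply hol_at_mobius; [assumption|]. unfold unit_disc in Hz; lra.
    + apply mobius_neq_0; auto.
  - intros z Hz Hza. assert (Hm : mobius a z <> 0) by (apply mobius_neq_0; auto).
    rewrite Cmod_div by assumption. apply Cmod_gt_0 in Hm.
    apply Rmult_le_reg_r with (Cmod (mobius a z)); [assumption|].
    unfold Rdiv. rewrite Rmult_assoc, Rinv_l, Rmult_1_r, Rmult_1_l by lra.
    pose proof (schwarz_pick f z a (conj Hhol Hbd) Hz Ha) as H.
    rewrite Hfa in H. replace (Cconj 0) with (RtoC 0) in H
      by (unfold Cconj, RtoC; simpl; f_equal; ring).
    replace (0 - f z) with (- f z) in H by ring.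
    replace (1 - 0 * f z) with (RtoC 1) in H by ring.
    rewrite Cmod_opp, Cmod_1 in H. lra.
  - exists h. split; [assumption|]. intros z Hz. destruct (Ceq_dec z a) as [->|Hza].
    + rewrite mobius_self, Hfa. ring.
    + rewrite Eh by assumption. field. apply mobius_neq_0; auto.
Qed.

(** * Factorization in the Schur class *)

Definition disc_self_map (f : C -> C) : Prop :=
  (forall z, unit_disc z -> hol_at f z) /\
  (forall z, unit_disc z -> unit_disc (f z)).

Lemma disc_self_map_schur (f : C -> C) : disc_self_map f -> schur f.
Proof. intros [H1 H2]. split; [assumption|]. intros z Hz. left. now apply H2. Qed.

Lemma schur_comp (f b : C -> C) :
  schur f -> disc_self_map b -> schur (fun z => f (b z)).
Proof.
  intros [F1 F2] [B1 B2]. split; intros z Hz.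
  - apply (hol_at_comp f b); auto.
  - auto.
Qed.

Lemma disc_self_map_comp (f b : C -> C) :
  disc_self_map f -> disc_self_map b -> disc_self_map (fun z => f (b z)).
Proof.
  intros [F1 F2] [B1 B2]. split; intros z Hz.
  - apply (hol_at_comp f b); auto.
  - auto.
Qed.

Lemma disc_self_map_mobius (a : C) : unit_disc a -> disc_self_map (mobius a).
Proof.
  intros Ha. split; intros z Hz; [|now apply mobius_disc].
  apply hol_at_mobius; [assumption|]. unfold unit_disc in Hz; lra.
Qed.

Lemma disc_point_near (a : C) (d : R) :
  unit_disc a -> (0 < d)%R -> exists z, unit_disc z /\ z <> a /\ (Cmod (z - a) < d)%R.
Proof.
  intros Ha Hd. set (e := (Rmin d (1 - Cmod a) / 2)%R). unfold unit_disc in *.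
  assert (Hm : (0 < Rmin d (1 - Cmod a))%R) by (apply Rmin_pos; lra).
  pose proof (Rmin_l d (1 - Cmod a)). pose proof (Rmin_r d (1 - Cmod a)).
  assert (E : Cmod (a + RtoC e - a) = e).
  { replace (a + RtoC e - a) with (RtoC e) by ring. rewrite Cmod_R.
    apply Rabs_pos_eq. unfold e; lra. }
  exists (a + RtoC e). split; [|split].
  - pose proof (Cmod_triangle (a + RtoC e - a) a) as T.
    replace (a + RtoC e - a + a) with (a + RtoC e) in T by ring. unfold e in *; lra.
  - intros Ea. rewrite Ea in E. replace (a - a) with (RtoC 0) in E by ring.
    rewrite Cmod_0 in E. unfold e in E; lra.
  - rewrite E. unfold e; lra.
Qed.

Lemma Cmod_le_extend (u v : C -> C) (a : C) :
  unit_disc a -> hol_at u a -> hol_at v a ->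
  (forall z, unit_disc z -> z <> a -> (Cmod (u z) <= Cmod (v z))%R) ->
  (Cmod (u a) <= Cmod (v a))%R.
Proof.
  intros Ha Hu Hv H. apply Rnot_lt_le. intros Hlt.
  set (e := ((Cmod (u a) - Cmod (v a)) / 2)%R). assert (He : (0 < e)%R) by (unfold e; lra).
  destruct (hol_at_cont _ _ Hu e He) as [d1 [Hd1 H1]].
  destruct (hol_at_cont _ _ Hv e He) as [d2 [Hd2 H2]].
  destruct (disc_point_near a (Rmin d1 d2) Ha ltac:(now apply Rmin_pos)) as (z & Hz & Hza & Hd).
  specialize (H1 z (Rlt_le_trans _ _ _ Hd (Rmin_l _ _))).
  specialize (H2 z (Rlt_le_trans _ _ _ Hd (Rmin_r _ _))).
  specialize (H z Hz Hza).
  pose proof (Cmod_triangle_inv (u a) (u z)) as T1. rewrite Cmod_minus_sym in T1.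
  pose proof (Cmod_triangle_inv (v z) (v a)) as T2.
  unfold e in *. lra.
Qed.

Lemma Cmod_cancel_mobius (u v : C -> C) (a : C) :
  unit_disc a -> hol_at u a -> hol_at v a ->
  (forall z, unit_disc z -> (Cmod (mobius a z * u z) <= Cmod (mobius a z * v z))%R) ->
  forall z, unit_disc z -> (Cmod (u z) <= Cmod (v z))%R.
Proof.
  intros Ha Hu Hv H.
  assert (Hoff : forall z, unit_disc z -> z <> a -> (Cmod (u z) <= Cmod (v z))%R).
  { intros z Hz Hza. specialize (H z Hz). rewrite !Cmod_mult in H.
    apply Rmult_le_reg_l with (Cmod (mobius a z)); [|assumption].
    apply Cmod_gt_0, mobius_neq_0; auto. }
  intros z Hz. destruct (Ceq_dec z a) as [->|Hza]; [|now apply Hoff].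
  now apply Cmod_le_extend.
Qed.

Lemma schur_list_division (A : list C) (f : C -> C) :
  Forall unit_disc A -> schur f ->
  (forall z, unit_disc z -> (Cmod (f z) <= Cmod (mobius_prod A z))%R) ->
  exists g, schur g /\ forall z, unit_disc z -> f z = mobius_prod A z * g z.
Proof.
  intros HA. revert f. induction HA as [|a A Ha HA IH]; intros f Hf Hle.
  - exists f. split; [assumption|]. intros z _. simpl. ring.
  - assert (Hfa : f a = 0).
    { apply Cmod_eq_0. specialize (Hle a Ha). rewrite mobius_prod_zero in Hle by now left.
      rewrite Cmod_0 in Hle. pose proof (Cmod_ge_0 (f a)). lra. }
    destruct (schur_division f a Hf Ha Hfa) as [g [Hg Eg]].
    destruct (IH g Hg) as [h [Hh Eh]].
    + apply (Cmod_cancel_mobius _ _ a Ha); [now apply Hg| |].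
      * apply hol_at_mobius_prod; [assumption|]. unfold unit_disc in Ha; lra.
      * intros z Hz. rewrite <- Eg by assumption. now apply Hle.
    + exists h. split; [assumption|]. intros z Hz. simpl.
      rewrite Eg, Eh by assumption. ring.
Qed.

(** Every zero of the product is a zero of one factor, and can be divided out
    of that factor. *)
Lemma split_zeros (A : list C) (u v : C -> C) :
  Forall unit_disc A -> schur u -> schur v ->
  (forall z, unit_disc z -> (Cmod (u z * v z) <= Cmod (mobius_prod A z))%R) ->
  exists A1 A2, Forall unit_disc A1 /\ Forall unit_disc A2 /\
    (length A2 <= length A)%nat /\
    (forall z, mobius_prod A z = mobius_prod A1 z * mobius_prod A2 z) /\
    (forall z, unit_disc z -> (Cmod (u z) <= Cmod (mobius_prod A1 z))%R) /\
    (forall z, unit_disc z -> (Cmod (v z) <= Cmod (mobius_prod A2 z))%R).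
Proof.
  intros HA. revert u v. induction HA as [|a A Ha HA IH]; intros u v Hu Hv Hle.
  - exists nil, nil. repeat split; simpl; auto.
    + intros z. ring.
    + intros z Hz. rewrite Cmod_1. now apply Hu.
    + intros z Hz. rewrite Cmod_1. now apply Hv.
  - assert (Ha1 : (Cmod a <= 1)%R) by (unfold unit_disc in Ha; lra).
    assert (Huv : u a * v a = 0).
    { apply Cmod_eq_0. specialize (Hle a Ha). rewrite (mobius_prod_zero (a :: A)) in Hle by now left.
      rewrite Cmod_0 in Hle. pose proof (Cmod_ge_0 (u a * v a)). lra. }
    assert (H0 : u a = 0 \/ v a = 0).
    { apply NNPP. intros N. apply not_or_and in N. destruct N as [N1 N2].
      now apply (Cmult_neq_0 _ _ N1 N2). }
    destruct H0 as [Hua|Hva].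
    + destruct (schur_division u a Hu Ha Hua) as [g [Hg Eg]].
      destruct (IH g v Hg Hv) as (A1 & A2 & H1 & H2 & H3 & H4 & H5 & H6).
      * apply (Cmod_cancel_mobius (fun z => g z * v z) (mobius_prod A) a Ha).
        -- apply hol_at_mult; [now apply Hg|now apply Hv].
        -- now apply hol_at_mobius_prod.
        -- intros z Hz. rewrite Cmult_assoc, <- Eg by assumption. now apply Hle.
      * exists (a :: A1), A2. repeat split; auto.
        -- simpl; lia.
        -- intros z. simpl. rewrite H4. ring.
        -- intros z Hz. simpl. rewrite Eg, !Cmod_mult by assumption.
           apply Rmult_le_compat_l; [apply Cmod_ge_0|auto].
    + destruct (schur_division v a Hv Ha Hva) as [g [Hg Eg]].
      destruct (IH u g Hu Hg) as (A1 & A2 & H1 & H2 & H3 & H4 & H5 & H6).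
      * apply (Cmod_cancel_mobius (fun z => u z * g z) (mobius_prod A) a Ha).
        -- apply hol_at_mult; [now apply Hu|now apply Hg].
        -- now apply hol_at_mobius_prod.
        -- intros z Hz. replace (mobius a z * (u z * g z)) with (u z * (mobius a z * g z)) by ring.
           rewrite <- Eg by assumption. now apply Hle.
      * exists A1, (a :: A2). repeat split; auto.
        -- simpl; lia.
        -- intros z. simpl. rewrite H4. ring.
        -- intros z Hz. simpl. rewrite Eg, !Cmod_mult by assumption.
           apply Rmult_le_compat_l; [apply Cmod_ge_0|auto].
Qed.

Lemma mobius_prod_repeat (a : C) (n : nat) (z : C) :
  mobius_prod (repeat a n) z = mobius a z ^ n.
Proof. induction n as [|n IH]; simpl; [reflexivity|now rewrite IH]. Qed.

Lemma Forall_repeat_disc (a : C) (n : nat) :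
  unit_disc a -> Forall unit_disc (repeat a n).
Proof. intros Ha. induction n; simpl; auto. Qed.

(** Dividing out zeros at [a] must stop, since [mobius a z1 ^ n] tends to [0]. *)
Lemma zero_order (u : C -> C) (a z1 : C) :
  schur u -> unit_disc a -> unit_disc z1 -> u z1 <> 0 ->
  exists n u0, schur u0 /\ u0 a <> 0 /\
    forall z, unit_disc z -> u z = mobius a z ^ n * u0 z.
Proof.
  intros Hu Ha Hz1 Hne. apply NNPP. intros Hno.
  assert (Hall : forall n, exists g, schur g /\
    forall z, unit_disc z -> u z = mobius a z ^ n * g z).
  { intros n. induction n as [|n [g [Hg Eg]]].
    - exists u. split; [assumption|]. intros z _. simpl. ring.
    - assert (Hga : g a = 0).
      { apply NNPP. intros Hga. apply Hno. now exists n, g. }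
      destruct (schur_division g a Hg Ha Hga) as [h [Hh Eh]].
      exists h. split; [assumption|]. intros z Hz. simpl.
      rewrite Eg, Eh by assumption. ring. }
  pose proof (mobius_disc a z1 Ha Hz1) as Hm. unfold unit_disc in Hm.
  apply Cmod_gt_0 in Hne as Hpos.
  destruct (pow_lt_1_zero (Cmod (mobius a z1)) ltac:(rewrite Rabs_pos_eq; [lra|apply Cmod_ge_0])
    (Cmod (u z1)) Hpos) as [N HN].
  specialize (HN N (le_n N)). rewrite Rabs_pos_eq in HN by (apply pow_le, Cmod_ge_0).
  destruct (Hall N) as [g [Hg Eg]].
  rewrite (Eg z1 Hz1), Cmod_mult, Cmod_pow in HN.
  assert (Cmod (mobius a z1) ^ N * Cmod (g z1) <= Cmod (mobius a z1) ^ N * 1)%R.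
  { apply Rmult_le_compat_l; [apply pow_le, Cmod_ge_0|now apply Hg]. }
  rewrite (Eg z1 Hz1), Cmod_mult, Cmod_pow in Hpos. lra.
Qed.

Lemma cont_neq_0_near (f : C -> C) (a : C) :
  hol_at f a -> f a <> 0 ->
  exists d, (0 < d)%R /\ forall z, (Cmod (z - a) < d)%R -> f z <> 0.
Proof.
  intros Hf Hne. apply Cmod_gt_0 in Hne.
  destruct (hol_at_cont _ _ Hf _ Hne) as [d [Hd H]].
  exists d. split; [assumption|]. intros z Hz E. specialize (H z Hz).
  rewrite E in H. replace (0 - f a) with (- f a) in H by ring. rewrite Cmod_opp in H. lra.
Qed.

(** The quotient is glued from local ones: near a zero [a] of [u], both
    functions are divisible by the same power of [mobius a]. *)
Lemma schur_quotient (k u : C -> C) (z1 : C) :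
  schur k -> schur u -> unit_disc z1 -> u z1 <> 0 ->
  (forall z, unit_disc z -> (Cmod (k z) <= Cmod (u z))%R) ->
  exists v, schur v /\ forall z, unit_disc z -> k z = u z * v z.
Proof.
  intros Hk Hu Hz1 Hne Hle.
  set (R z y := exists n k0 u0, schur k0 /\ schur u0 /\ u0 z <> 0 /\ y = k0 z / u0 z /\
    (Cmod y <= 1)%R /\
    forall x, unit_disc x -> u x = mobius z x ^ n * u0 x /\ k x = mobius z x ^ n * k0 x).
  assert (Hex : forall z, exists y, unit_disc z -> R z y).
  { intros z. destruct (classic (unit_disc z)) as [Hz|Hz]; [|exists 0; tauto].
    destruct (zero_order u z z1 Hu Hz Hz1 Hne) as (n & u0 & Hu0 & Hu0z & Eu).
    destruct (schur_list_division (repeat z n) k) as [k0 [Hk0 Ek]].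
    - now apply Forall_repeat_disc.
    - assumption.
    - (* [k] inherits from [u] the divisibility by [mobius z ^ n]. *)
      intros x Hx. eapply Rle_trans; [now apply Hle|].
      rewrite (Eu x Hx), mobius_prod_repeat, Cmod_mult.
      rewrite <- (Rmult_1_r (Cmod (mobius z x ^ n))) at 2.
      apply Rmult_le_compat_l; [apply Cmod_ge_0|now apply Hu0].
    - exists (k0 z / u0 z). intros _. exists n, k0, u0. repeat split; try assumption.
      + apply Hk0.
      + apply Hk0.
      + apply Hu0.
      + apply Hu0.
      + rewrite Cmod_div by assumption. apply Cmod_gt_0 in Hu0z.
        apply Rmult_le_reg_r with (Cmod (u0 z)); [assumption|].
        unfold Rdiv. rewrite Rmult_assoc, Rinv_l, Rmult_1_r, Rmult_1_l by lra.
        apply (Cmod_le_extend k0 u0 z Hz); [now apply Hk0|now apply Hu0|].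
        intros x Hx Hxz. specialize (Hle x Hx).
        rewrite (Eu x Hx), (Ek x Hx), mobius_prod_repeat, !Cmod_mult in Hle.
        apply Rmult_le_reg_l with (Cmod (mobius z x ^ n)); [|assumption].
        apply Cmod_gt_0, Cpow_nz, mobius_neq_0; auto.
      + now apply Eu.
      + rewrite (Ek x) by assumption. now rewrite mobius_prod_repeat. }
  destruct (choice _ Hex) as [v Hv].
  assert (Hquot : forall z, unit_disc z -> u z <> 0 -> v z = k z / u z).
  { intros z Hz Huz. destruct (Hv z Hz) as (n & k0 & u0 & _ & _ & Hu0 & -> & _ & E).
    destruct (E z Hz) as [E1 E2]. rewrite E1, E2. rewrite E1 in Huz. field.
    split; [assumption|]. intros H0. apply Huz. rewrite H0. ring. }
  exists v. split; [split|].
  - intros a Ha. destruct (Hv a Ha) as (n & k0 & u0 & Hk0 & Hu0 & Hu0a & Eva & _ & E).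
    destruct (cont_neq_0_near u0 a) as [d [Hd Hnz]]; [now apply Hu0|assumption|].
    assert (Hr : (0 < Rmin d (1 - Cmod a))%R)
      by (apply Rmin_pos; unfold unit_disc in Ha; lra).
    apply (hol_at_ext_loc (fun z => k0 z / u0 z) v a _ Hr).
    + intros w Hw. destruct (Ceq_dec w a) as [->|Hwa]; [now rewrite Eva|].
      pose proof (Rlt_le_trans _ _ _ Hw (Rmin_l _ _)) as Hw1.
      pose proof (Rlt_le_trans _ _ _ Hw (Rmin_r _ _)) as Hw2.
      assert (HwD : unit_disc w).
      { unfold unit_disc. pose proof (Cmod_triangle (w - a) a) as T.
        replace (w - a + a) with w in T by ring. lra. }
      assert (Hp : mobius a w ^ n <> 0) by (apply Cpow_nz, mobius_neq_0; auto).
      specialize (Hnz w Hw1). destruct (E w HwD) as [E1 E2].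
      rewrite Hquot, E1, E2; [field; now split|assumption|].
      rewrite E1. now apply Cmult_neq_0.
    + apply hol_at_div; [now apply Hk0|now apply Hu0|assumption].
  - intros z Hz. now destruct (Hv z Hz) as (n & k0 & u0 & _ & _ & _ & _ & H & _).
  - intros z Hz. destruct (classic (u z = 0)) as [E0|Hnz].
    + rewrite E0. specialize (Hle z Hz). rewrite E0, Cmod_0 in Hle.
      replace (0 * v z) with (RtoC 0) by ring. apply Cmod_eq_0.
      pose proof (Cmod_ge_0 (k z)). lra.
    + rewrite Hquot by assumption. field. assumption.
Qed.

(** Each zero [a] of [u o b] comes from the zero [b a] of [u]. Dividing [u] by
    [mobius (b a)] removes from [u o b] all those zeros in [A] that belong to
    [mobius (b a) o b], in particular [a]; so the list gets shorter. *)
Lemma push_zeros (b : C -> C) (A : list C) (u : C -> C) :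
  disc_self_map b -> Forall unit_disc A -> schur u ->
  (forall z, unit_disc z -> (Cmod (u (b z)) <= Cmod (mobius_prod A z))%R) ->
  exists X, Forall unit_disc X /\
    (forall z, unit_disc z -> (Cmod (u z) <= Cmod (mobius_prod X z))%R) /\
    (forall z, unit_disc z ->
      (Cmod (mobius_prod X (b z)) <= Cmod (mobius_prod A z))%R).
Proof.
  intros Hb. remember (length A) as n eqn:En.
  assert (Hn : (length A <= n)%nat) by lia. clear En. revert A u Hn.
  induction n as [|n IH]; intros A u Hn HA Hu Hle.
  - destruct A as [|a A]; [|simpl in Hn; lia].
    exists nil. repeat split; auto.
    + intros z Hz. simpl. rewrite Cmod_1. now apply Hu.
    + intros z _. simpl. lra.
  - destruct A as [|a A].
    { exists nil. repeat split; auto.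
      + intros z Hz. simpl. rewrite Cmod_1. now apply Hu.
      + intros z _. simpl. lra. }
    inversion_clear HA as [|? ? Ha HA'].
    assert (Ha1 : (Cmod a <= 1)%R) by (unfold unit_disc in Ha; lra).
    set (x := b a). assert (Hx : unit_disc x) by now apply Hb.
    assert (Hux : u x = 0).
    { apply Cmod_eq_0. specialize (Hle a Ha). rewrite (mobius_prod_zero (a :: A)) in Hle by now left.
      rewrite Cmod_0 in Hle. pose proof (Cmod_ge_0 (u (b a))). unfold x. lra. }
    destruct (schur_division u x Hu Hx Hux) as [h [Hh Eh]].
    assert (Hxb : schur (fun z => mobius x (b z))).
    { apply schur_comp; [|assumption]. now apply disc_self_map_schur, disc_self_map_mobius. }
    destruct (schur_division _ a Hxb Ha (mobius_self x)) as [g [Hg Eg]].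
    assert (Hhb : schur (fun z => h (b z))) by now apply schur_comp.
    destruct (split_zeros A g (fun z => h (b z)) HA' Hg Hhb)
      as (A1 & A2 & H1 & H2 & H3 & H4 & H5 & H6).
    { apply (Cmod_cancel_mobius (fun z => g z * h (b z)) (mobius_prod A) a Ha).
      - apply hol_at_mult; [now apply Hg|now apply Hhb].
      - now apply hol_at_mobius_prod.
      - intros z Hz. rewrite Cmult_assoc, <- Eg, <- Eh by (try assumption; now apply Hb).
        now apply Hle. }
    destruct (IH A2 h) as (X & HX & HX1 & HX2); try assumption.
    { simpl in Hn. lia. }
    exists (x :: X). repeat split.
    + now constructor.
    + intros z Hz. simpl. rewrite Eh, !Cmod_mult by assumption.
      apply Rmult_le_compat_l; [apply Cmod_ge_0|auto].
    + intros z Hz. simpl. rewrite Eg, H4, !Cmod_mult, Rmult_assoc by assumption.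
      apply Rmult_le_compat_l; [apply Cmod_ge_0|].
      apply Rmult_le_compat; try apply Cmod_ge_0; auto.
Qed.

(** * Blaschke products are the functions exhausted by their zeros *)

Lemma C_seq_lim_iff (u : nat -> C) (l : C) :
  C_seq_lim u l <-> forall eps, (0 < eps)%R -> exists N, forall n, (N <= n)%nat ->
    (Cmod (u n - l) < eps)%R.
Proof.
  unfold C_seq_lim. split.
  - intros H eps Heps.
    assert (He : (0 < eps / sqrt 2)%R)
      by (apply Rdiv_lt_0_compat; [assumption|apply Rlt_sqrt2_0]).
    assert (H' := proj1 (filterlim_locally u l) H (mkposreal _ He)).
    destruct H' as [N HN].
    exists N. intros n Hn. specialize (HN n Hn).
    apply C_NormedModule_mixin_compat2 in HN.
    change (Cmod (u n - l) < sqrt 2 * (eps / sqrt 2))%R in HN.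
    replace (sqrt 2 * (eps / sqrt 2))%R with eps in HN; [assumption|].
    field. pose proof Rlt_sqrt2_0. lra.
  - intros H. apply filterlim_locally. intros eps.
    destruct (H eps (cond_pos eps)) as [N HN]. exists N. intros n Hn.
    apply C_NormedModule_mixin_compat1. exact (HN n Hn).
Qed.

(** The modulus of [f] at [z0] is completely accounted for by the zeros of [f]:
    finite Blaschke products that divide [f] come arbitrarily close to it. No
    limit of products occurs, which makes this form of being a Blaschke product
    stable under composition, factorization and limits; it carries information
    when [f z0] is not [0]. *)
Definition zeros_exhaust (f : C -> C) (z0 : C) : Prop :=
  forall eps, (0 < eps)%R -> exists A, Forall unit_disc A /\
    (forall z, unit_disc z -> (Cmod (f z) <= Cmod (mobius_prod A z))%R) /\
    (Cmod (mobius_prod A z0) <= Cmod (f z0) + eps)%R.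

Lemma Cmod_unimodular_factor (a : C) : Cmod (unimodular_factor a) = 1%R.
Proof.
  unfold unimodular_factor. destruct (Ceq_dec a 0) as [E|Hne]; [apply Cmod_1|].
  rewrite Cmod_div by assumption. rewrite Cmod_R, Rabs_pos_eq by apply Cmod_ge_0.
  apply Cmod_gt_0 in Hne. field. lra.
Qed.

Definition first_zeros (a : nat -> C) (n : nat) : list C := map a (seq 1 n).

Lemma first_zeros_S (a : nat -> C) (n : nat) :
  first_zeros a (S n) = first_zeros a n ++ a (S n) :: nil.
Proof. unfold first_zeros. rewrite seq_S, map_app. reflexivity. Qed.

Lemma Forall_first_zeros (a : nat -> C) (N : nat) :
  (forall n, (1 <= n <= N)%nat -> unit_disc (a n)) -> Forall unit_disc (first_zeros a N).
Proof.
  intros H. apply Forall_forall. intros x Hx. apply in_map_iff in Hx.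
  destruct Hx as (n & <- & Hn). apply in_seq in Hn. apply H. lia.
Qed.

Lemma C_prod_blaschke (a : nat -> C) (z : C) (n : nat) :
  C_prod (fun k => blaschke_factor (a k) z) n =
    C_prod (fun k => unimodular_factor (a k)) n * mobius_prod (first_zeros a n) z.
Proof.
  induction n as [|n IH]; [simpl; ring|].
  rewrite first_zeros_S, mobius_prod_app. cbn [C_prod mobius_prod fold_right].
  rewrite IH. unfold blaschke_factor. fold (mobius (a (S n)) z). ring.
Qed.

Lemma Cmod_C_prod_unimodular (a : nat -> C) (n : nat) :
  Cmod (C_prod (fun k => unimodular_factor (a k)) n) = 1%R.
Proof.
  induction n as [|n IH]; cbn [C_prod]; [apply Cmod_1|].
  rewrite Cmod_mult, IH, Cmod_unimodular_factor. ring.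
Qed.

Lemma Cmod_C_prod_blaschke (a : nat -> C) (z : C) (n : nat) :
  Cmod (C_prod (fun k => blaschke_factor (a k) z) n)
    = Cmod (mobius_prod (first_zeros a n) z).
Proof. rewrite C_prod_blaschke, Cmod_mult, Cmod_C_prod_unimodular. ring. Qed.

Lemma first_zeros_decr (a : nat -> C) (z : C) (n m : nat) :
  (forall n, (1 <= n)%nat -> unit_disc (a n)) -> unit_disc z -> (n <= m)%nat ->
  (Cmod (mobius_prod (first_zeros a m) z) <= Cmod (mobius_prod (first_zeros a n) z))%R.
Proof.
  intros Ha Hz Hnm. induction Hnm as [|m Hnm IH]; [lra|].
  eapply Rle_trans; [|exact IH].
  rewrite first_zeros_S, mobius_prod_app, Cmod_mult.
  rewrite <- (Rmult_1_r (Cmod (mobius_prod (first_zeros a m) z))) at 2.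
  apply Rmult_le_compat_l; [apply Cmod_ge_0|].
  apply mobius_prod_le_1; [|assumption]. constructor; [apply Ha; lia|constructor].
Qed.

(** The partial products are divisors, and decrease in modulus to [f]. *)
Lemma blaschke_zeros_exhaust (f : C -> C) (z0 : C) :
  blaschke_product f -> unit_disc z0 -> zeros_exhaust f z0.
Proof.
  intros [H|H] Hz0 eps Heps.
  - destruct H as (eta & N & a & Heta & HN & Ha & E).
    exists (first_zeros a N).
    assert (E' : forall z, unit_disc z -> Cmod (f z) = Cmod (mobius_prod (first_zeros a N) z)).
    { intros z Hz. rewrite E, Cmod_mult, Heta, Cmod_C_prod_blaschke by assumption. ring. }
    repeat split.
    + now apply Forall_first_zeros.
    + intros z Hz. rewrite E' by assumption. lra.
    + rewrite E' by assumption. lra.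
  - destruct H as (eta & a & Heta & Ha & _ & E).
    assert (E' : forall z, unit_disc z -> exists p, Cmod (f z) = Cmod p /\
      forall e, (0 < e)%R -> exists N, forall n, (N <= n)%nat ->
        (Rabs (Cmod (mobius_prod (first_zeros a n) z) - Cmod p) < e)%R).
    { intros z Hz. destruct (E z Hz) as (p & Hp & Efz). exists p. split.
      - rewrite Efz, Cmod_mult, Heta. ring.
      - intros e He. destruct (proj1 (C_seq_lim_iff _ _) Hp e He) as [N HN].
        exists N. intros n Hn. specialize (HN n Hn).
        rewrite <- Cmod_C_prod_blaschke.
        pose proof (Cmod_triangle_inv (C_prod (fun k => blaschke_factor (a k) z) n) p) as T1.
        pose proof (Cmod_triangle_inv p (C_prod (fun k => blaschke_factor (a k) z) n)) as T2.
        rewrite (Cmod_minus_sym p) in T2. apply Rabs_def1; lra. }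
    destruct (E' z0 Hz0) as (p & Ep & Hlim). destruct (Hlim eps Heps) as [N HN].
    specialize (HN N (le_n N)). apply Rabs_def2 in HN.
    exists (first_zeros a N). repeat split.
    + apply Forall_first_zeros. intros; apply Ha; lia.
    + intros z Hz. destruct (E' z Hz) as (q & Eq & Hq). rewrite Eq.
      apply le_of_forall_gt. intros M HM.
      destruct (Hq (M - Cmod (mobius_prod (first_zeros a N) z))%R ltac:(lra)) as [n Hn].
      specialize (Hn (max N n) ltac:(lia)). apply Rabs_def2 in Hn.
      pose proof (first_zeros_decr a z N (max N n) Ha Hz ltac:(lia)). lra.
    + rewrite Ep. lra.
Qed.

(** Schwarz-Pick solved for the difference of the values: a function bounded by
    [1] that nearly reaches this bound at one point is nearly constant. *)
Lemma schur_oscillation (h : C -> C) (z z0 : C) :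
  schur h -> unit_disc z -> unit_disc z0 ->
  (Cmod (h z0 - h z) <=
    Cmod (mobius z0 z) / (1 - Cmod (mobius z0 z)) * (1 - Cmod (h z0) ^ 2))%R.
Proof.
  intros Hh Hz Hz0. pose proof (schwarz_pick h z z0 Hh Hz Hz0) as H.
  pose proof (mobius_disc z0 z Hz0 Hz) as Ht. unfold unit_disc in Ht.
  set (t := Cmod (mobius z0 z)) in *. pose proof (Cmod_ge_0 (mobius z0 z)) as Ht0. fold t in Ht0.
  replace (1 - Cconj (h z0) * h z)
    with ((1 - h z0 * Cconj (h z0)) + Cconj (h z0) * (h z0 - h z)) in H by ring.
  rewrite <- Cmod2_conj in H.
  pose proof (Cmod_triangle (1 - RtoC (Cmod (h z0) ^ 2)) (Cconj (h z0) * (h z0 - h z))) as T.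
  pose proof (proj2 Hh z0 Hz0) as H1. pose proof (Cmod_ge_0 (h z0)) as H0.
  assert (Hsq : (0 <= 1 - Cmod (h z0) ^ 2)%R).
  { assert (Cmod (h z0) * Cmod (h z0) <= 1 * 1)%R by (apply Rmult_le_compat; lra).
    simpl; lra. }
  replace (1 - RtoC (Cmod (h z0) ^ 2)) with (RtoC (1 - Cmod (h z0) ^ 2)) in *
    by (rewrite RtoC_minus; reflexivity).
  rewrite Cmod_R, Rabs_pos_eq, Cmod_mult, Cmod_conj in T by assumption.
  set (d := Cmod (h z0 - h z)) in *. pose proof (Cmod_ge_0 (h z0 - h z)) as Hd. fold d in Hd.
  assert (Hdd : (Cmod (h z0) * d <= 1 * d)%R) by (apply Rmult_le_compat_r; lra).
  assert (H2 : (d <= t * ((1 - Cmod (h z0) ^ 2) + d))%R).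
  { eapply Rle_trans; [exact H|]. apply Rmult_le_compat_l; lra. }
  apply Rmult_le_reg_r with (1 - t)%R; [lra|].
  replace (t / (1 - t) * (1 - Cmod (h z0) ^ 2) * (1 - t))%R
    with (t * (1 - Cmod (h z0) ^ 2))%R by (field; lra).
  lra.
Qed.


(** If [f = mobius_prod X * h], the zeros in a good list for [f] that are not
    accounted for by [X] are zeros of [h]. *)
Lemma zeros_exhaust_extend (f : C -> C) (z0 : C) (X : list C) (eps : R) :
  schur f -> unit_disc z0 -> zeros_exhaust f z0 -> Forall unit_disc X -> (0 < eps)%R ->
  (forall z, unit_disc z -> (Cmod (f z) <= Cmod (mobius_prod X z))%R) ->
  exists Y, Forall unit_disc Y /\
    (forall z, unit_disc z -> (Cmod (f z) <= Cmod (mobius_prod (X ++ Y) z))%R) /\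
    (Cmod (mobius_prod (X ++ Y) z0) <= Cmod (f z0) + eps)%R.
Proof.
  intros Hf Hz0 Hex HX Heps HfX.
  destruct (schur_list_division X f HX Hf HfX) as [h [Hh Eh]].
  destruct (Hex eps Heps) as (A & HA & HfA & HAe).
  destruct (split_zeros A (mobius_prod X) h HA) as (A1 & Y & H1 & H2 & _ & H4 & H5 & H6).
  - split; intros z Hz; [|now apply mobius_prod_le_1].
    apply hol_at_mobius_prod; [assumption|]. unfold unit_disc in Hz; lra.
  - assumption.
  - intros z Hz. rewrite <- Eh by assumption. now apply HfA.
  - exists Y. split; [assumption|]. split.
    + intros z Hz. rewrite mobius_prod_app, Eh, !Cmod_mult by assumption.
      apply Rmult_le_compat_l; [apply Cmod_ge_0|now apply H6].
    + eapply Rle_trans; [|exact HAe]. rewrite mobius_prod_app, H4, !Cmod_mult.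
      apply Rmult_le_compat_r; [apply Cmod_ge_0|now apply H5].
Qed.

Lemma Cmod_den_le_2 (a z : C) :
  unit_disc a -> unit_disc z -> (Cmod (1 - Cconj a * z) <= 2)%R.
Proof.
  unfold unit_disc. intros Ha Hz. eapply Rle_trans; [apply Cmod_minus_le|].
  rewrite Cmod_1, Cmod_mult, Cmod_conj.
  pose proof (prod_lt_1 (Cmod a) (Cmod z)).
  pose proof (Cmod_ge_0 a). pose proof (Cmod_ge_0 z). lra.
Qed.

Lemma mobius_gap (a z0 : C) :
  unit_disc a -> unit_disc z0 ->
  (Cmod (mobius a z0) <= 1 - (1 - Cmod z0 ^ 2) / 8 * (1 - Cmod a))%R.
Proof.
  intros Ha Hz0.
  pose proof (mobius_defect a z0 Ha ltac:(unfold unit_disc in Hz0; lra)) as E.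
  pose proof (mobius_disc a z0 Ha Hz0) as Hr.
  pose proof (Cmod_den_le_2 a z0 Ha Hz0) as Hd. unfold unit_disc in *.
  pose proof (Cmod_ge_0 a) as Ha0. pose proof (Cmod_ge_0 z0) as Hz00.
  pose proof (Cmod_ge_0 (mobius a z0)) as Hr0.
  pose proof (Cmod_ge_0 (1 - Cconj a * z0)) as Hd0.
  set (r := Cmod (mobius a z0)) in *. set (d := Cmod (1 - Cconj a * z0)) in *.
  pose proof (one_minus_sq_pos (Cmod z0) ltac:(lra)) as Hz.
  assert (Hr2 : (0 <= 1 - r ^ 2 <= 2 * (1 - r))%R).
  { split; [left; apply one_minus_sq_pos; lra|].
    replace (1 - r ^ 2)%R with ((1 + r) * (1 - r))%R by ring.
    apply Rmult_le_compat_r; lra. }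
  assert (Hd2 : (d ^ 2 <= 4)%R).
  { replace 4%R with (2 ^ 2)%R by ring. apply pow_incr. lra. }
  assert (Hl : ((1 - r ^ 2) * d ^ 2 <= 2 * (1 - r) * 4)%R).
  { apply Rmult_le_compat; try lra. apply pow_le; lra. }
  assert (Ha2 : ((1 - Cmod a) * (1 - Cmod z0 ^ 2) <= (1 - Cmod a ^ 2) * (1 - Cmod z0 ^ 2))%R).
  { apply Rmult_le_compat_r; [lra|].
    assert (Cmod a * Cmod a <= Cmod a * 1)%R by (apply Rmult_le_compat_l; lra). simpl; lra. }
  lra.
Qed.

Lemma blaschke_factor_gap (a z : C) :
  unit_disc a -> unit_disc z ->
  (Cmod (blaschke_factor a z - 1) <= 2 / (1 - Cmod z) * (1 - Cmod a))%R.
Proof.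
  intros Ha Hz. unfold unit_disc in *.
  assert (H2 : (2 <= 2 / (1 - Cmod z))%R).
  { pose proof (Cmod_ge_0 z). apply Rmult_le_reg_r with (1 - Cmod z)%R; [lra|].
    unfold Rdiv. rewrite Rmult_assoc, Rinv_l; lra. }
  unfold blaschke_factor, unimodular_factor. fold (mobius a z).
  destruct (Ceq_dec a 0) as [->|Hne].
  - rewrite mobius_0_l, Cmod_0. replace (1 * - z - 1) with (- (1 + z)) by ring.
    rewrite Cmod_opp. pose proof (Cmod_triangle 1 z) as T. rewrite Cmod_1 in T. lra.
  - pose proof (mobius_den a z Ha ltac:(lra)) as Hden.
    assert (E : RtoC (Cmod a) / a * mobius a z - 1 =
      - (RtoC (1 - Cmod a) * (a + RtoC (Cmod a) * z) / (a * (1 - Cconj a * z)))).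
    { unfold mobius. rewrite RtoC_minus.
      assert (Ea : RtoC (Cmod a) * RtoC (Cmod a) = a * Cconj a).
      { rewrite <- Cmod2_conj, <- RtoC_mult. f_equal. ring. }
      replace (RtoC (Cmod a) / a * ((a - z) / (1 - Cconj a * z)) - 1)
        with ((RtoC (Cmod a) * (a - z) - a + (a * Cconj a) * z) / (a * (1 - Cconj a * z)))
        by (field; now split).
      rewrite <- Ea. field. now split. }
    rewrite E, Cmod_opp, Cmod_div by now apply Cmult_neq_0.
    rewrite !Cmod_mult, Cmod_R, Rabs_pos_eq by lra.
    apply Cmod_gt_0 in Hne as Hpos.
    pose proof (mobius_den_bound a z) as Hb.
    assert (Hden2 : (1 - Cmod z <= Cmod (1 - Cconj a * z))%R).
    { assert (Cmod a * Cmod z <= 1 * Cmod z)%R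
        by (apply Rmult_le_compat_r; [apply Cmod_ge_0|lra]). lra. }
    assert (Hnum : (Cmod (a + RtoC (Cmod a) * z) <= 2 * Cmod a)%R).
    { eapply Rle_trans; [apply Cmod_triangle|].
      rewrite Cmod_mult, Cmod_R, Rabs_pos_eq by apply Cmod_ge_0.
      assert (Cmod a * Cmod z <= Cmod a * 1)%R by (apply Rmult_le_compat_l; lra). lra. }
    apply Rle_trans with ((1 - Cmod a) * (2 * Cmod a) / (Cmod a * (1 - Cmod z)))%R.
    + apply Rmult_le_compat.
      * apply Rmult_le_pos; [lra|apply Cmod_ge_0].
      * left. apply Rinv_0_lt_compat, Rmult_lt_0_compat; lra.
      * apply Rmult_le_compat_l; lra.
      * apply Rinv_le_contravar; [apply Rmult_lt_0_compat; lra|].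
        apply Rmult_le_compat_l; lra.
    + right. field. split; lra.
Qed.

(** The inequality [P (1 + S) <= 1] between a product and the sum of the
    defects of its factors replaces the passage to logarithms. *)
Lemma defects_summable (a : nat -> C) (z0 : C) (delta : R) :
  (forall n, (1 <= n)%nat -> unit_disc (a n)) -> unit_disc z0 -> (0 < delta)%R ->
  (forall n, (delta <= Cmod (mobius_prod (first_zeros a n) z0))%R) ->
  @ex_series R_AbsRing R_NormedModule (fun n => (1 - Cmod (a (S n)))%R).
Proof.
  intros Ha Hz0 Hdelta Hlow.
  set (g := fun n => (1 - Cmod (a (S n)))%R).
  assert (Hg : forall n, (0 < g n)%R).
  { intros n. specialize (Ha (S n) ltac:(lia)). unfold g, unit_disc in *. lra. }
  set (k := ((1 - Cmod z0 ^ 2) / 8)%R).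
  assert (Hk : (0 < k)%R).
  { pose proof (one_minus_sq_pos (Cmod z0)). pose proof (Cmod_ge_0 z0).
    unfold unit_disc, k in *. lra. }
  assert (Hfac : forall n, (0 <= Cmod (mobius (a (S n)) z0) <= 1 - k * g n)%R).
  { intros n. split; [apply Cmod_ge_0|]. apply mobius_gap; [apply Ha; lia|assumption]. }
  assert (Hstep : forall P S0 y rho, (0 <= P)%R -> (0 <= S0)%R -> (0 <= y)%R ->
    (P * (1 + S0) <= 1)%R -> (0 <= rho <= 1 - y)%R -> (P * rho * (1 + S0 + y) <= 1)%R).
  { intros P S0 y rho HP HS Hy H Hrho. eapply Rle_trans; [|exact H].
    rewrite Rmult_assoc. apply Rmult_le_compat_l; [assumption|].
    apply Rle_trans with ((1 - y) * (1 + S0 + y))%R; [apply Rmult_le_compat_r; lra|].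
    assert (0 <= y * y)%R by now apply Rmult_le_pos.
    assert (0 <= y * S0)%R by now apply Rmult_le_pos. lra. }
  assert (Hsum : forall n, (0 <= sum_n g n)%R /\
    (Cmod (mobius_prod (first_zeros a (S n)) z0) * (1 + k * sum_n g n) <= 1)%R).
  { intros n. induction n as [|n [IH1 IH2]].
    - rewrite sum_O. split; [left; apply Hg|].
      rewrite first_zeros_S, mobius_prod_app, Cmod_mult.
      replace (1 + k * g 0%nat)%R with (1 + 0 + k * g 0%nat)%R by ring.
      pose proof (Hfac 0%nat). specialize (Hg 0%nat).
      assert (0 <= k * g 0%nat)%R by (apply Rmult_le_pos; lra).
      apply Hstep; try lra; [apply Cmod_ge_0| |].
      + simpl. rewrite Cmod_1. lra.
      + simpl. rewrite Cmod_mult, Cmod_1, Rmult_1_r. assumption.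
    - rewrite sum_Sn. change (plus (sum_n g n) (g (S n))) with (sum_n g n + g (S n))%R.
      pose proof (Hg (S n)) as HgS. split; [lra|].
      rewrite first_zeros_S, mobius_prod_app, Cmod_mult.
      replace (1 + k * (sum_n g n + g (S n)))%R
        with (1 + k * sum_n g n + k * g (S n))%R by ring.
      assert (0 <= k * g (S n))%R by (apply Rmult_le_pos; lra).
      assert (0 <= k * sum_n g n)%R by (apply Rmult_le_pos; lra).
      apply Hstep; try assumption; [apply Cmod_ge_0|].
      simpl. rewrite Cmod_mult, Cmod_1, Rmult_1_r. apply Hfac. }
  destruct (ex_finite_lim_seq_incr (sum_n g) (/ (k * delta))) as [l Hl].
  - intros n. rewrite sum_Sn. change (plus (sum_n g n) (g (S n))) with (sum_n g n + g (S n))%R.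
    specialize (Hg (S n)). lra.
  - intros n. destruct (Hsum n) as [H1 H2].
    assert (H3 : (delta * (1 + k * sum_n g n) <= 1)%R).
    { eapply Rle_trans; [|exact H2]. apply Rmult_le_compat_r; [|apply Hlow].
      assert (0 <= k * sum_n g n)%R by (apply Rmult_le_pos; lra). lra. }
    assert (Hkd : (0 < k * delta)%R) by now apply Rmult_lt_0_compat.
    apply Rmult_le_reg_l with (k * delta)%R; [assumption|].
    rewrite Rinv_r by lra. lra.
  - exists l. exact Hl.
Qed.

(** Consecutive partial products differ by at most a constant multiple of
    [1 - Cmod (a n)]. *)
Lemma blaschke_converges (a : nat -> C) (z : C) :
  (forall n, (1 <= n)%nat -> unit_disc (a n)) -> unit_disc z ->
  @ex_series R_AbsRing R_NormedModule (fun n => (1 - Cmod (a (S n)))%R) ->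
  exists p, C_seq_lim (C_prod (fun n => blaschke_factor (a n) z)) p.
Proof.
  intros Ha Hz Hs.
  set (q := C_prod (fun n => blaschke_factor (a n) z)).
  assert (Hq : forall n, (Cmod (q n) <= 1)%R).
  { intros n. unfold q. rewrite Cmod_C_prod_blaschke. apply mobius_prod_le_1; [|assumption].
    apply Forall_first_zeros. intros; apply Ha; lia. }
  assert (Hd : forall n, (Cmod (q (S n) - q n) <=
    2 / (1 - Cmod z) * (1 - Cmod (a (S n))))%R).
  { intros n. unfold q. cbn [C_prod]. fold q.
    replace (q n * blaschke_factor (a (S n)) z - q n)
      with (q n * (blaschke_factor (a (S n)) z - 1)) by ring.
    rewrite Cmod_mult. rewrite <- (Rmult_1_l (2 / (1 - Cmod z) * (1 - Cmod (a (S n)))))%R.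
    apply Rmult_le_compat; try apply Cmod_ge_0; [apply Hq|].
    apply blaschke_factor_gap; [apply Ha; lia|assumption]. }
  destruct (ex_series_le (V := C_CompleteNormedModule) (fun n => q (S n) - q n)
    (fun n => 2 / (1 - Cmod z) * (1 - Cmod (a (S n))))%R Hd) as [l Hl].
  { exact (ex_series_scal (V := R_NormedModule) _ _ Hs). }
  exists (q 0%nat + l). apply C_seq_lim_iff. intros eps Heps.
  destruct (proj1 (C_seq_lim_iff _ l) Hl eps Heps) as [N HN].
  exists (S N). intros [|n] Hn; [lia|]. specialize (HN n ltac:(lia)).
  assert (E : forall n, sum_n (G := C_AbelianMonoid) (fun n => q (S n) - q n) n = q (S n) - q 0%nat).
  { intros m. induction m as [|m IH]; [apply sum_O|].
    rewrite sum_Sn, IH. unfold plus; simpl. ring. }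
  replace (q (S n) - (q 0%nat + l)) with (q (S n) - q 0%nat - l) by ring.
  rewrite <- E. exact HN.
Qed.

(** With [q n] the partial products, [f = q n * h n], where [h n] is in the
    Schur class and [Cmod (h n z0)] tends to [1]: so [h n] becomes constant. *)
Lemma zero_sequence_blaschke (f : C -> C) (z0 : C) (a : nat -> C) :
  schur f -> unit_disc z0 -> f z0 <> 0 ->
  (forall n, (1 <= n)%nat -> unit_disc (a n)) ->
  (forall n z, unit_disc z -> (Cmod (f z) <= Cmod (mobius_prod (first_zeros a n) z))%R) ->
  (forall eps, (0 < eps)%R -> exists n,
    (Cmod (mobius_prod (first_zeros a n) z0) <= Cmod (f z0) + eps)%R) ->
  infinite_blaschke_product f.
Proof.
  intros Hf Hz0 Hne Ha Hle Hlim.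
  apply Cmod_gt_0 in Hne as Hpos.
  assert (Hs : @ex_series R_AbsRing R_NormedModule (fun n => (1 - Cmod (a (S n)))%R)).
  { apply (defects_summable a z0 (Cmod (f z0))); auto. }
  assert (HX : forall n, Forall unit_disc (first_zeros a n)).
  { intros n. apply Forall_first_zeros. intros; apply Ha; lia. }
  set (q := fun z => C_prod (fun n => blaschke_factor (a n) z)).
  assert (Hex : forall z, exists p, unit_disc z -> C_seq_lim (q z) p).
  { intros z. destruct (classic (unit_disc z)) as [Hz|Hz]; [|exists 0; tauto].
    destruct (blaschke_converges a z Ha Hz Hs) as [p Hp]. now exists p. }
  destruct (choice _ Hex) as [p Hp].
  assert (Hq : forall z n, Cmod (q z n) = Cmod (mobius_prod (first_zeros a n) z))
    by (intros; apply Cmod_C_prod_blaschke).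
  assert (Hq0 : forall eps, (0 < eps)%R -> exists N, forall n, (N <= n)%nat ->
    (Cmod (f z0) <= Cmod (q z0 n) <= Cmod (f z0) + eps)%R).
  { intros eps Heps. destruct (Hlim eps Heps) as [N HN]. exists N. intros n Hn.
    rewrite Hq. split; [now apply Hle|].
    eapply Rle_trans; [now apply (first_zeros_decr a z0 N n)|assumption]. }
  assert (Hp0 : Cmod (p z0) = Cmod (f z0)).
  { apply Rle_antisym; apply le_of_forall_gt; intros M HM.
    - set (e := ((M - Cmod (f z0)) / 2)%R). assert (He : (0 < e)%R) by (unfold e; lra).
      destruct (Hq0 e He) as [N1 H1].
      destruct (proj1 (C_seq_lim_iff _ _) (Hp z0 Hz0) e He) as [N2 H2].
      specialize (H1 (max N1 N2) ltac:(lia)). specialize (H2 (max N1 N2) ltac:(lia)).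
      pose proof (Cmod_triangle_inv (p z0) (q z0 (max N1 N2))) as T.
      rewrite Cmod_minus_sym in T. unfold e in *. lra.
    - set (e := (M - Cmod (p z0))%R). assert (He : (0 < e)%R) by (unfold e; lra).
      destruct (Hq0 e He) as [N1 H1].
      destruct (proj1 (C_seq_lim_iff _ _) (Hp z0 Hz0) e He) as [N2 H2].
      specialize (H1 (max N1 N2) ltac:(lia)). specialize (H2 (max N1 N2) ltac:(lia)).
      pose proof (Cmod_triangle_inv (q z0 (max N1 N2)) (p z0)) as T. unfold e in *. lra. }
  assert (Hpne : p z0 <> 0) by (apply Cmod_gt_0; lra).
  exists (f z0 / p z0), a. split; [|split; [|split]]; try assumption.
  { rewrite Cmod_div, Hp0 by assumption. field. lra. }
  intros z Hz. exists (p z). split; [now apply Hp|].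
  (* [f z * q z0 n - f z0 * q z n] is a multiple of the oscillation of [h n]. *)
  cut (f z * p z0 - f z0 * p z = 0).
  { intros E. replace (f z) with ((f z * p z0 - f z0 * p z) / p z0 + f z0 / p z0 * p z)
      by (field; assumption).
    rewrite E. field. assumption. }
  apply Cmod_eq_0. apply Rle_antisym; [|apply Cmod_ge_0].
  apply le_of_forall_gt. intros M HM.
  pose proof (mobius_disc z0 z Hz0 Hz) as Ht. unfold unit_disc in Ht.
  set (t := Cmod (mobius z0 z)) in *. pose proof (Cmod_ge_0 (mobius z0 z)) as Ht0. fold t in Ht0.
  set (c := (t / (1 - t))%R).
  assert (Hc : (0 <= c)%R)
    by (apply Rmult_le_pos; [assumption|left; apply Rinv_0_lt_compat; lra]).
  set (e := (M / 3)%R). assert (He : (0 < e)%R) by (unfold e; lra).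
  set (e' := (e * Cmod (f z0) / (2 * (c + 1)))%R).
  assert (He' : (0 < e')%R).
  { apply Rdiv_lt_0_compat; [now apply Rmult_lt_0_compat|lra]. }
  destruct (Hq0 e' He') as [N1 H1].
  destruct (proj1 (C_seq_lim_iff _ _) (Hp z0 Hz0) e He) as [N2 H2].
  destruct (proj1 (C_seq_lim_iff _ _) (Hp z Hz) e He) as [N3 H3].
  set (n := max N1 (max N2 N3)).
  specialize (H1 n ltac:(lia)). specialize (H2 n ltac:(lia)). specialize (H3 n ltac:(lia)).
  destruct (schur_list_division _ f (HX n) Hf (Hle n)) as [h0 [Hh0 Eh0]].
  set (U := C_prod (fun k => unimodular_factor (a k)) n).
  assert (HU : Cmod U = 1%R) by apply Cmod_C_prod_unimodular.
  assert (HU0 : U <> 0) by (apply Cmod_gt_0; lra).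
  set (h := fun w => / U * h0 w).
  assert (Hh : schur h).
  { split; intros w Hw.
    - apply hol_at_mult; [apply hol_at_const|now apply Hh0].
    - unfold h. rewrite Cmod_mult, Cmod_inv, HU, Rinv_1, Rmult_1_l by assumption.
      now apply Hh0. }
  assert (Eh : forall w, unit_disc w -> f w = q w n * h w).
  { intros w Hw. rewrite Eh0 by assumption. unfold q, h. rewrite C_prod_blaschke.
    fold U. field. assumption. }
  pose proof (schur_oscillation h z z0 Hh Hz Hz0) as Hosc. fold t in Hosc. fold c in Hosc.
  assert (Hh1 : (Cmod (f z0) * (1 - Cmod (h z0)) <= e')%R).
  { pose proof (Eh z0 Hz0) as E. apply (f_equal Cmod) in E. rewrite Cmod_mult in E.
    pose proof (proj2 Hh z0 Hz0).
    assert (Cmod (f z0) * (1 - Cmod (h z0)) <= Cmod (q z0 n) * (1 - Cmod (h z0)))%R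
      by (apply Rmult_le_compat_r; lra). lra. }
  assert (Hosc2 : (Cmod (h z0 - h z) <= e)%R).
  { eapply Rle_trans; [exact Hosc|].
    pose proof (proj2 Hh z0 Hz0) as B1. pose proof (Cmod_ge_0 (h z0)) as B0.
    assert (Hh2 : (1 - Cmod (h z0) <= e / (2 * (c + 1)))%R).
    { apply Rmult_le_reg_l with (Cmod (f z0)); [assumption|].
      eapply Rle_trans; [exact Hh1|]. right. unfold e'. field. lra. }
    apply Rle_trans with ((c + 1) * (2 * (e / (2 * (c + 1)))))%R.
    - apply Rmult_le_compat; try lra.
      + replace (1 - Cmod (h z0) ^ 2)%R with ((1 + Cmod (h z0)) * (1 - Cmod (h z0)))%R by ring.
        apply Rmult_le_pos; lra.
      + replace (1 - Cmod (h z0) ^ 2)%R with ((1 + Cmod (h z0)) * (1 - Cmod (h z0)))%R by ring.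
        apply Rmult_le_compat; lra.
    - right. field. lra. }
  assert (Eid : f z * p z0 - f z0 * p z =
    f z * (p z0 - q z0 n) - f z0 * (p z - q z n) - q z n * q z0 n * (h z0 - h z)).
  { rewrite (Eh z Hz), (Eh z0 Hz0). ring. }
  rewrite Eid.
  pose proof (Cmod_minus_le (f z * (p z0 - q z0 n) - f z0 * (p z - q z n))
    (q z n * q z0 n * (h z0 - h z))) as T1.
  pose proof (Cmod_minus_le (f z * (p z0 - q z0 n)) (f z0 * (p z - q z n))) as T2.
  rewrite !Cmod_mult in T1, T2. rewrite (Cmod_minus_sym (p z0)), (Cmod_minus_sym (p z)) in T2.
  assert (Hle1 : forall x y, (0 <= x <= 1)%R -> (0 <= y <= e)%R -> (x * y <= e)%R).
  { intros x y Hx Hy. rewrite <- (Rmult_1_l e). apply Rmult_le_compat; lra. }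
  assert (Hqz : forall w, unit_disc w -> (0 <= Cmod (q w n) <= 1)%R).
  { intros w Hw. split; [apply Cmod_ge_0|]. rewrite Hq. now apply mobius_prod_le_1. }
  pose proof (Hle1 (Cmod (f z)) (Cmod (q z0 n - p z0))
    (conj (Cmod_ge_0 _) (proj2 Hf z Hz)) (conj (Cmod_ge_0 _) (Rlt_le _ _ H2))).
  pose proof (Hle1 (Cmod (f z0)) (Cmod (q z n - p z))
    (conj (Cmod_ge_0 _) (proj2 Hf z0 Hz0)) (conj (Cmod_ge_0 _) (Rlt_le _ _ H3))).
  assert (Hqq : (0 <= Cmod (q z n) * Cmod (q z0 n) <= 1)%R).
  { pose proof (Hqz z Hz). pose proof (Hqz z0 Hz0). split; [now apply Rmult_le_pos|].
    rewrite <- (Rmult_1_r 1). apply Rmult_le_compat; lra. }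
  pose proof (Hle1 _ (Cmod (h z0 - h z)) Hqq (conj (Cmod_ge_0 _) Hosc2)).
  unfold e in *. lra.
Qed.

Lemma first_zeros_nth (X : list C) (n : nat) :
  (n <= length X)%nat -> first_zeros (fun k => nth (k - 1) X 0) n = firstn n X.
Proof.
  intros Hn. apply nth_ext with (d := RtoC 0) (d' := RtoC 0).
  - unfold first_zeros. rewrite length_map, length_seq, length_firstn. lia.
  - unfold first_zeros. intros i Hi. rewrite length_map, length_seq in Hi.
    rewrite (nth_indep _ _ (nth (0 - 1) X (RtoC 0))) by now rewrite length_map, length_seq.
    rewrite (map_nth (fun k => nth (k - 1) X (RtoC 0))), seq_nth by assumption.
    rewrite nth_firstn. replace (i <? n)%nat with true by (symmetry; now apply Nat.ltb_lt).
    f_equal. lia.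
Qed.

(** The cofactor of the Blaschke product has modulus [1] at [z0], so it is
    constant. *)
Lemma zero_list_blaschke (f : C -> C) (z0 : C) (X : list C) :
  disc_self_map f -> unit_disc z0 -> f z0 <> 0 -> Forall unit_disc X ->
  (forall z, unit_disc z -> (Cmod (f z) <= Cmod (mobius_prod X z))%R) ->
  (Cmod (mobius_prod X z0) <= Cmod (f z0))%R -> finite_blaschke_product f.
Proof.
  intros Hf Hz0 Hne HX Hle Heq.
  pose proof (disc_self_map_schur f Hf) as Hs.
  destruct (schur_list_division X f HX Hs Hle) as [h [Hh Eh]].
  assert (Hfz : (0 < Cmod (f z0) < 1)%R) by (split; [now apply Cmod_gt_0|now apply Hf]).
  assert (Hh1 : Cmod (h z0) = 1%R).
  { apply Rle_antisym; [now apply Hh|].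
    pose proof (Eh z0 Hz0) as E. apply (f_equal Cmod) in E. rewrite Cmod_mult in E.
    assert (Hpos : (0 < Cmod (mobius_prod X z0))%R).
    { pose proof (Hle z0 Hz0). lra. }
    apply Rmult_le_reg_l with (Cmod (mobius_prod X z0)); [assumption|]. lra. }
  assert (Hconst : forall z, unit_disc z -> h z = h z0).
  { intros z Hz. pose proof (schur_oscillation h z z0 Hh Hz Hz0) as H.
    rewrite Hh1 in H. replace (1 - 1 ^ 2)%R with 0%R in H by ring. rewrite Rmult_0_r in H.
    pose proof (Cmod_ge_0 (h z0 - h z)).
    assert (E : h z0 - h z = 0) by (apply Cmod_eq_0; lra).
    replace (h z) with (h z0 - (h z0 - h z)) by ring. rewrite E. ring. }
  (* Sequences of zeros are indexed from [1], lists from [0]. *)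
  set (a := fun k => nth (k - 1) X (RtoC 0)). set (N := length X).
  assert (Ea : first_zeros a N = X) by (unfold a, N; rewrite first_zeros_nth, firstn_all; auto).
  set (U := C_prod (fun k => unimodular_factor (a k)) N).
  assert (HU : Cmod U = 1%R) by apply Cmod_C_prod_unimodular.
  assert (HU0 : U <> 0) by (apply Cmod_gt_0; lra).
  exists (h z0 / U), N, a. split; [|split; [|split]].
  - rewrite Cmod_div, Hh1, HU by assumption. field.
  - unfold N. destruct X as [|x X]; [|simpl; lia].
    simpl in Heq. rewrite Cmod_1 in Heq. lra.
  - intros n Hn. unfold a. apply (proj1 (Forall_forall _ _) HX). apply nth_In.
    unfold N in Hn. lia.
  - intros z Hz. rewrite C_prod_blaschke. fold U. rewrite Ea, Eh, Hconst by assumption.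
    field. assumption.
Qed.

(** Unless some finite Blaschke product is already sharp at [z0], it can always
    be prolonged; the finite lists of zeros then grow to a sequence. *)
Lemma zeros_exhaust_blaschke (f : C -> C) (z0 : C) :
  disc_self_map f -> unit_disc z0 -> f z0 <> 0 -> zeros_exhaust f z0 ->
  blaschke_product f.
Proof.
  intros Hf Hz0 Hne Hex.
  pose proof (disc_self_map_schur f Hf) as Hs.
  set (Div := fun X => Forall unit_disc X /\
    forall z, unit_disc z -> (Cmod (f z) <= Cmod (mobius_prod X z))%R).
  destruct (classic (exists X, Div X /\ (Cmod (mobius_prod X z0) <= Cmod (f z0))%R))
    as [(X & [HX HX1] & HX2)|Hno].
  { left. now apply (zero_list_blaschke f z0 X). }
  right.
  assert (Hgap : forall X, Div X -> (Cmod (f z0) < Cmod (mobius_prod X z0))%R).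
  { intros X HX. apply Rnot_le_lt. intros H. apply Hno. now exists X. }
  destruct (dependent_iteration (fun _ => Div)
    (fun n L L' => exists Y, L' = L ++ Y /\ Y <> nil /\
      (Cmod (mobius_prod L' z0) <= Cmod (f z0) + / (INR n + 1))%R) nil) as [L [HL0 HL]].
  - split; [constructor|]. intros z Hz. simpl. rewrite Cmod_1. now apply Hs.
  - intros n X [HX HfX]. pose proof (Hgap X (conj HX HfX)) as Hg.
    (* The second bound on [e] forces the extension to be nonempty. *)
    set (e := Rmin (/ (INR n + 1)) ((Cmod (mobius_prod X z0) - Cmod (f z0)) / 2)).
    assert (He : (0 < e)%R).
    { apply Rmin_pos; [|lra]. apply Rinv_0_lt_compat. pose proof (pos_INR n). lra. }
    assert (He1 : (e <= / (INR n + 1))%R) by apply Rmin_l.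
    assert (He2 : (e <= (Cmod (mobius_prod X z0) - Cmod (f z0)) / 2)%R) by apply Rmin_r.
    destruct (zeros_exhaust_extend f z0 X e Hs Hz0 Hex HX He HfX) as (Y & HY & HfY & HYe).
    exists (X ++ Y). split; [split; [now apply Forall_app|assumption]|].
    exists Y. split; [reflexivity|]. split; [|lra].
    intros ->. rewrite app_nil_r in HYe. lra.
  - assert (Hpre : forall k m, (k <= m)%nat -> exists Z, L m = L k ++ Z).
    { intros k m Hkm. induction Hkm as [|m Hkm [Z HZ]].
      - exists nil. now rewrite app_nil_r.
      - destruct (HL m) as [_ (Y & EY & _)]. exists (Z ++ Y).
        rewrite EY, HZ, app_assoc. reflexivity. }
    assert (Hlen : forall n, (n <= length (L n))%nat).
    { intros n. induction n as [|n IH]; [lia|].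
      destruct (HL n) as [_ (Y & EY & HY & _)]. rewrite EY, length_app.
      destruct Y as [|y Y]; [congruence|simpl; lia]. }
    set (a := fun n => nth (n - 1) (L n) (RtoC 0)).
    assert (Hfirst : forall n, first_zeros a n = firstn n (L n)).
    { intros n. rewrite <- first_zeros_nth by apply Hlen.
      apply map_ext_in. intros k Hk. apply in_seq in Hk.
      destruct (Hpre k n ltac:(lia)) as [Z HZ]. unfold a. rewrite HZ, app_nth1; [reflexivity|].
      specialize (Hlen k). lia. }
    assert (HLD : forall n, Div (L n)) by (intros n; apply HL).
    apply (zero_sequence_blaschke f z0 a); try assumption.
    + intros n Hn. unfold a. apply (proj1 (Forall_forall _ _) (proj1 (HLD n))).
      apply nth_In. specialize (Hlen n). lia.
    + intros n z Hz. rewrite Hfirst. eapply Rle_trans; [now apply (HLD n)|].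
      rewrite <- (firstn_skipn n (L n)) at 1. rewrite mobius_prod_app, Cmod_mult.
      rewrite <- (Rmult_1_r (Cmod (mobius_prod (firstn n (L n)) z))) at 2.
      apply Rmult_le_compat_l; [apply Cmod_ge_0|]. apply mobius_prod_le_1; [|assumption].
      pose proof (proj1 (HLD n)) as H. rewrite <- (firstn_skipn n (L n)) in H.
      now apply Forall_app in H.
    + intros eps Heps. destruct (INR_unbounded (/ eps)) as [k Hk].
      destruct (HL k) as [_ (Y & EY & _ & HYe)].
      exists (length (L (S k))). rewrite Hfirst.
      destruct (Hpre (S k) (length (L (S k))) (Hlen (S k))) as [Z HZ].
      rewrite HZ, firstn_app, firstn_all, Nat.sub_diag, firstn_O, app_nil_r.
      assert (/ (INR k + 1) <= eps)%R.
      { rewrite <- (Rinv_inv eps). apply Rinv_le_contravar; [now apply Rinv_0_lt_compat|lra]. }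
      lra.
Qed.

(** * Indestructibility *)

Lemma holomorphic_self_map_iff (f : C -> C) :
  holomorphic_self_map f <-> disc_self_map f.
Proof.
  unfold holomorphic_self_map, holomorphic_on_disc, disc_self_map.
  split; intros [H1 H2]; (split; [|assumption]); intros z Hz.
  - now apply ex_derive_hol_at, H1.
  - now apply hol_at_ex_derive, H1.
Qed.

Lemma mobius_inj (a z w : C) :
  unit_disc a -> unit_disc z -> unit_disc w -> mobius a z = mobius a w -> z = w.
Proof.
  intros Ha Hz Hw E. rewrite <- (mobius_involutive a z), <- (mobius_involutive a w) by assumption.
  now rewrite E.
Qed.

Lemma mobius_automorphism (a : C) : unit_disc a -> disc_automorphism (mobius a).
Proof.
  intros Ha. split; [|split].
  - now apply holomorphic_self_map_iff, disc_self_map_mobius.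
  - intros z w Hz Hw. now apply mobius_inj.
  - intros w Hw. exists (mobius a w). split; [now apply mobius_disc|now apply mobius_involutive].
Qed.

Lemma C_cluster_closed (u : nat -> C) (l : C) (d : R) (c : C) (N : nat) :
  C_cluster u l -> (forall n, (N <= n)%nat -> (Cmod (u n - c) <= d)%R) ->
  (Cmod (l - c) <= d)%R.
Proof.
  intros Hl H. apply le_of_forall_gt. intros M HM.
  destruct (Hl (M - d)%R N ltac:(lra)) as [n [Hn1 Hn2]]. specialize (H n Hn1).
  pose proof (Cmod_triangle_via (u n) l c) as T. rewrite (Cmod_minus_sym l (u n)) in T. lra.
Qed.


(** Compactness of the circle, by way of cluster points of a minimizing sequence. *)
Lemma circle_min (T : C -> C) (z0 : C) (r : R) :
  (0 < r)%R -> (forall z, (Cmod (z - z0) <= r)%R -> hol_at T z) ->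
  (forall z, Cmod (z - z0) = r -> T z <> 0) ->
  exists m, (0 < m)%R /\ forall z, Cmod (z - z0) = r -> (m <= Cmod (T z))%R.
Proof.
  intros Hr Hhol Hne. apply NNPP. intros Hno.
  assert (Hseq : forall n : nat, exists z, Cmod (z - z0) = r /\ (Cmod (T z) < / (INR n + 1))%R).
  { intros n. apply NNPP. intros H. apply Hno. exists (/ (INR n + 1))%R. split.
    - apply Rinv_0_lt_compat. pose proof (pos_INR n). lra.
    - intros z Hz. apply Rnot_lt_le. intros Hlt. apply H. now exists z. }
  destruct (choice _ Hseq) as [s Hs].
  destruct (C_bounded_cluster s (Cmod z0 + r)) as [l Hl].
  { intros n. destruct (Hs n) as [E _]. pose proof (Cmod_triangle (s n - z0) z0) as Tr.
    replace (s n - z0 + z0) with (s n) in Tr by ring. lra. }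
  assert (Elr : Cmod (l - z0) = r).
  { apply Rle_antisym.
    - apply (C_cluster_closed s l r z0 0 Hl). intros n _. destruct (Hs n). lra.
    - apply Rnot_lt_le. intros Hlt.
      destruct (Hl (r - Cmod (l - z0))%R 0%nat ltac:(lra)) as [n [_ Hn]].
      pose proof (Cmod_triangle_via l (s n) z0) as Tr. destruct (Hs n). lra. }
  assert (HT : (0 < Cmod (T l))%R) by (apply Cmod_gt_0; now apply Hne).
  destruct (hol_at_cont T l (Hhol l ltac:(lra)) (Cmod (T l) / 2)%R ltac:(lra)) as [d [Hd HTd]].
  destruct (INR_unbounded (2 / Cmod (T l))) as [N HN].
  destruct (Hl d N Hd) as [n [HnN Hn]]. specialize (HTd _ Hn).
  destruct (Hs n) as [_ Hsn].
  pose proof (Cmod_triangle_inv (T l) (T (s n))) as Tr. rewrite Cmod_minus_sym in Tr.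
  assert (/ (INR n + 1) <= Cmod (T l) / 2)%R.
  { assert (INR N <= INR n)%R by (apply le_INR; lia).
    replace (Cmod (T l) / 2)%R with (/ (2 / Cmod (T l)))%R by (field; lra).
    apply Rinv_le_contravar; [apply Rdiv_lt_0_compat; lra|lra]. }
  lra.
Qed.

(** If [G] had no zero in the closed disc, [1 / G] would violate the bound on
    circles. *)
Lemma zero_in_circle (G : C -> C) (r m : R) :
  (0 < r)%R -> (forall z, (Cmod z <= r)%R -> hol_at G z) ->
  (forall z, Cmod z = r -> (m <= Cmod (G z))%R) -> (Cmod (G 0) < m)%R ->
  exists z, (Cmod z <= r)%R /\ G z = 0.
Proof.
  intros Hr Hhol Hm H0. apply NNPP. intros Hno.
  assert (Hne : forall z, (Cmod z <= r)%R -> G z <> 0).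
  { intros z Hz E. apply Hno. now exists z. }
  assert (Hmpos : (0 < m)%R) by (pose proof (Cmod_ge_0 (G 0)); lra).
  assert (H00 : (Cmod 0 <= r)%R) by (rewrite Cmod_0; lra).
  pose proof (circle_bound (fun z => 1 / G z) r (/ m) Hr) as H.
  assert (H1 : (Cmod (1 / G 0) <= / m)%R).
  { apply H.
    - intros z Hz. apply hol_at_div; [apply hol_at_const|now apply Hhol|now apply Hne].
    - intros z Hz. rewrite Cmod_div, Cmod_1 by (apply Hne; lra).
      unfold Rdiv. rewrite Rmult_1_l. apply Rinv_le_contravar; [assumption|now apply Hm]. }
  rewrite Cmod_div, Cmod_1 in H1 by now apply Hne.
  unfold Rdiv in H1. rewrite Rmult_1_l in H1.
  assert (0 < Cmod (G 0))%R by now apply Cmod_gt_0, Hne.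
  apply Rinv_lt_contravar in H0; [|now apply Rmult_lt_0_compat]. lra.
Qed.

Lemma zero_in_disc (G : C -> C) (z0 : C) (r m : R) :
  (0 < r)%R -> (forall z, (Cmod (z - z0) <= r)%R -> hol_at G z) ->
  (forall z, Cmod (z - z0) = r -> (m <= Cmod (G z))%R) -> (Cmod (G z0) < m)%R ->
  exists z, (Cmod (z - z0) <= r)%R /\ G z = 0.
Proof.
  intros Hr Hhol Hm H0.
  destruct (zero_in_circle (fun z => G (z0 + z)) r m Hr) as [z [Hz E]].
  - intros z Hz. apply (hol_at_comp G (fun z => z0 + z)).
    + apply Hhol. now replace (z0 + z - z0) with z by ring.
    + apply hol_at_plus; [apply hol_at_const|apply hol_at_id].
  - intros z Hz. apply Hm. now replace (z0 + z - z0) with z by ring.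
  - now replace (z0 + 0) with z0 by ring.
  - exists (z0 + z). split; [now replace (z0 + z - z0) with z by ring|assumption].
Qed.

(** If the values of [T] at points approaching the circle accumulated at
    [T z0], they would be taken a second time near [z0], because [T] is open
    there; this contradicts injectivity. *)
Lemma automorphism_proper (T : C -> C) (r : R) :
  disc_automorphism T -> (0 <= r < 1)%R ->
  exists r', (0 <= r' < 1)%R /\ forall z, (r' < Cmod z < 1)%R -> (r < Cmod (T z))%R.
Proof.
  intros (HT & Hinj & Hsurj) Hr. apply holomorphic_self_map_iff in HT.
  apply NNPP. intros Hno.
  assert (Hseq : forall n : nat, exists z, (1 - / (INR n + 1) < Cmod z < 1)%R /\ (Cmod (T z) <= r)%R).
  { intros n. apply NNPP. intros H. apply Hno. exists (1 - / (INR n + 1))%R.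
    pose proof (pos_INR n). split.
    - assert (/ (INR n + 1) <= 1)%R by (rewrite <- Rinv_1; apply Rinv_le_contravar; lra).
      assert (0 < / (INR n + 1))%R by (apply Rinv_0_lt_compat; lra). lra.
    - intros z Hz. apply Rnot_le_lt. intros Hle. apply H. now exists z. }
  destruct (choice _ Hseq) as [s Hs].
  destruct (C_bounded_cluster (fun n => T (s n)) r) as [l Hl]; [intros n; apply (Hs n)|].
  assert (Hl1 : unit_disc l).
  { unfold unit_disc. apply Rle_lt_trans with r; [|lra].
    replace l with (l - 0) by ring. apply (C_cluster_closed _ _ r 0 0 Hl).
    intros n _. replace (T (s n) - 0) with (T (s n)) by ring. apply (Hs n). }
  destruct (Hsurj l Hl1) as [z0 [Hz0 E0]].
  set (d := ((1 - Cmod z0) / 2)%R). assert (Hd : (0 < d)%R) by (unfold unit_disc, d in *; lra).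
  assert (Hball : forall z, (Cmod (z - z0) <= d)%R -> (Cmod z <= 1 - d)%R).
  { intros z Hz. pose proof (Cmod_triangle (z - z0) z0) as Tr.
    replace (z - z0 + z0) with z in Tr by ring. unfold d in *; lra. }
  assert (HballD : forall z, (Cmod (z - z0) <= d)%R -> unit_disc z).
  { intros z Hz. pose proof (Hball z Hz). unfold unit_disc. lra. }
  destruct (circle_min (fun z => T z - l) z0 d Hd) as [m [Hm Hmin]].
  - intros z Hz. apply hol_at_minus; [now apply HT, HballD|apply hol_at_const].
  - intros z Hz E.
    assert (Ez : z = z0).
    { apply Hinj; [apply HballD; lra|assumption|].
      replace (T z) with (T z - l + l) by ring. rewrite E, E0. ring. }
    rewrite Ez in Hz. replace (z0 - z0) with (RtoC 0) in Hz by ring. rewrite Cmod_0 in Hz. lra.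
  - destruct (INR_unbounded (/ d)) as [N HN].
    destruct (Hl (m / 2)%R N ltac:(lra)) as [n [HnN Hn]].
    destruct (Hs n) as [[Hs1 Hs2] _].
    destruct (zero_in_disc (fun z => T z - T (s n)) z0 d (m / 2) Hd) as [z [Hz E]].
    + intros z Hz. apply hol_at_minus; [now apply HT, HballD|apply hol_at_const].
    + intros z Hz. specialize (Hmin z Hz).
      pose proof (Cmod_triangle_via (T (s n)) (T z) l) as Tr. lra.
    + rewrite E0, Cmod_minus_sym. assumption.
    + assert (Ez : z = s n).
      { apply Hinj; [now apply HballD|exact Hs2|].
        replace (T z) with (T z - T (s n) + T (s n)) by ring. rewrite E. ring. }
      specialize (Hball z Hz). rewrite Ez in Hball.
      assert (/ (INR n + 1) <= d)%R.
      { assert (INR N <= INR n)%R by (apply le_INR; lia).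
        rewrite <- (Rinv_inv d). apply Rinv_le_contravar; [now apply Rinv_0_lt_compat|lra]. }
      lra.
Qed.

(** Injectivity leaves in [T = mobius w ^ n * h] a factor [h] without zeros, and
    properness makes [Cmod (1 / h)] at most nearly [1] close to the circle: by
    the maximum principle [h] is unimodular. *)
Lemma automorphism_modulus (T : C -> C) :
  disc_automorphism T -> exists w n, unit_disc w /\
    forall z, unit_disc z -> Cmod (T z) = (Cmod (mobius w z) ^ n)%R.
Proof.
  intros HA. pose proof HA as (HT0 & Hinj & Hsurj).
  assert (HT := proj1 (holomorphic_self_map_iff T) HT0).
  assert (D0 : unit_disc 0) by (unfold unit_disc; rewrite Cmod_0; lra).
  destruct (Hsurj 0 D0) as [w [Hw E]].
  assert (Dh : unit_disc (/ 2)%R).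
  { unfold unit_disc. rewrite Cmod_R, Rabs_pos_eq; lra. }
  (* [T] is not identically [0]: it takes the value [1 / 2]. *)
  destruct (Hsurj _ Dh) as [z1 [Hz1 E1]].
  assert (Hne : T z1 <> 0).
  { rewrite E1. intros H. apply RtoC_inj in H. lra. }
  destruct (zero_order T w z1 (disc_self_map_schur T HT) Hw Hz1 Hne) as (n & h & Hh & Hhw & Eh).
  exists w, n. split; [assumption|].
  assert (Hhne : forall z, unit_disc z -> h z <> 0).
  { intros z Hz H. destruct (Ceq_dec z w) as [->|Hzw]; [contradiction|].
    apply Hzw. apply Hinj; try assumption. rewrite E, (Eh z Hz), H. ring. }
  assert (Hge : forall z, unit_disc z -> (Cmod (1 / h z) <= 1)%R).
  { intros z Hz. apply le_of_forall_gt. intros M HM.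
    destruct (automorphism_proper T (/ M) HA) as [r [Hr Hbd]].
    { split; [left; apply Rinv_0_lt_compat; lra|].
      rewrite <- Rinv_1. apply Rinv_lt_contravar; lra. }
    apply (disc_max_principle (fun z => 1 / h z) r M Hr); [| |assumption].
    - intros x Hx. apply hol_at_div; [apply hol_at_const|now apply Hh|now apply Hhne].
    - intros x Hx. specialize (Hbd x Hx). assert (HxD : unit_disc x) by apply Hx.
      pose proof (Hhne x HxD) as Hx0. rewrite Cmod_div, Cmod_1 by assumption.
      apply Cmod_gt_0 in Hx0. unfold Rdiv. rewrite Rmult_1_l.
      rewrite <- (Rinv_inv M). apply Rinv_le_contravar; [apply Rinv_0_lt_compat; lra|].
      apply Rle_trans with (Cmod (T x)); [lra|].
      rewrite (Eh x HxD), Cmod_mult, Cmod_pow.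
      rewrite <- (Rmult_1_l (Cmod (h x))) at 2. apply Rmult_le_compat_r; [lra|].
      rewrite <- (pow1 n). apply pow_incr. split; [apply Cmod_ge_0|].
      left. now apply mobius_disc. }
  intros z Hz. rewrite (Eh z Hz), Cmod_mult, Cmod_pow.
  assert (E2 : Cmod (h z) = 1%R); [|rewrite E2; ring].
  apply Rle_antisym; [now apply Hh|].
  pose proof (Hge z Hz) as H. pose proof (Hhne z Hz) as Hz0.
  rewrite Cmod_div, Cmod_1 in H by assumption. apply Cmod_gt_0 in Hz0.
  unfold Rdiv in H. rewrite Rmult_1_l in H.
  apply Rmult_le_compat_r with (r := Cmod (h z)) in H; [|lra].
  rewrite Rinv_l in H; lra.
Qed.

Lemma zeros_exhaust_ext (f g : C -> C) (z0 : C) :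
  unit_disc z0 -> (forall z, unit_disc z -> Cmod (f z) = Cmod (g z)) ->
  zeros_exhaust f z0 -> zeros_exhaust g z0.
Proof.
  intros Hz0 E H eps Heps. destruct (H eps Heps) as (A & HA & Hle & HAe).
  exists A. repeat split; [assumption| |].
  - intros z Hz. rewrite <- E by assumption. now apply Hle.
  - rewrite <- E by assumption. assumption.
Qed.

Lemma zeros_exhaust_one (z0 : C) : zeros_exhaust (fun _ => 1) z0.
Proof.
  intros eps Heps. exists nil. repeat split; [constructor| |].
  - intros z _. simpl. lra.
  - simpl. lra.
Qed.

Lemma approx_mult (x y x' y' e : R) :
  (0 <= x <= 1)%R -> (0 <= y' <= 1)%R -> (0 <= e)%R ->
  (x' <= x + e)%R -> (y' <= y + e)%R -> (x' * y' <= x * y + 2 * e)%R.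
Proof.
  intros Hx Hy' He H1 H2.
  apply Rle_trans with ((x + e) * y')%R; [apply Rmult_le_compat_r; lra|].
  assert (e * y' <= e * 1)%R by (apply Rmult_le_compat_l; lra).
  assert (x * y' <= x * (y + e))%R by (apply Rmult_le_compat_l; lra).
  assert (x * e <= 1 * e)%R by (apply Rmult_le_compat_r; lra).
  lra.
Qed.

Lemma zeros_exhaust_mult (f g : C -> C) (z0 : C) :
  unit_disc z0 -> zeros_exhaust f z0 -> zeros_exhaust g z0 ->
  zeros_exhaust (fun z => f z * g z) z0.
Proof.
  intros Hz0 Hf Hg eps Heps.
  destruct (Hf (eps / 2)%R ltac:(lra)) as (A & HA & HA1 & HA2).
  destruct (Hg (eps / 2)%R ltac:(lra)) as (A' & HA' & HA'1 & HA'2).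
  exists (A ++ A'). repeat split.
  - now apply Forall_app.
  - intros z Hz. rewrite mobius_prod_app, !Cmod_mult.
    apply Rmult_le_compat; try apply Cmod_ge_0; auto.
  - rewrite mobius_prod_app, !Cmod_mult.
    replace eps with (2 * (eps / 2))%R by field.
    pose proof (mobius_prod_le_1 A z0 HA Hz0). pose proof (mobius_prod_le_1 A' z0 HA' Hz0).
    pose proof (HA1 z0 Hz0).
    apply approx_mult; try lra; split; try apply Cmod_ge_0; lra.
Qed.

Lemma zeros_exhaust_pow (f : C -> C) (z0 : C) (n : nat) :
  unit_disc z0 -> zeros_exhaust f z0 -> zeros_exhaust (fun z => f z ^ n) z0.
Proof.
  intros Hz0 Hf. induction n as [|n IH]; [apply zeros_exhaust_one|].
  exact (zeros_exhaust_mult f (fun z => f z ^ n) z0 Hz0 Hf IH).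
Qed.

Lemma indestructible_zeros_exhaust (f : C -> C) (w z0 : C) :
  indestructible_blaschke f -> unit_disc w -> unit_disc z0 ->
  zeros_exhaust (fun z => mobius w (f z)) z0.
Proof.
  intros [_ H] Hw Hz0. apply blaschke_zeros_exhaust; [|assumption].
  now apply (H (mobius w)), mobius_automorphism.
Qed.

(** Up to unimodular values, [T o f] is a power of [mobius w o f], where [w] is
    the zero of [T]. *)
Lemma zeros_exhaust_indestructible (f : C -> C) :
  disc_self_map f ->
  (forall w, unit_disc w -> exists z0, unit_disc z0 /\ f z0 <> w /\
     zeros_exhaust (fun z => mobius w (f z)) z0) ->
  indestructible_blaschke f.
Proof.
  intros Hf H.
  assert (HT : forall T, disc_automorphism T -> blaschke_product (fun z => T (f z))).
  { intros T HA. destruct (automorphism_modulus T HA) as (w & n & Hw & E).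
    destruct (H w Hw) as (z0 & Hz0 & Hne & Hex).
    apply (zeros_exhaust_blaschke _ z0); [|assumption| |].
    - apply disc_self_map_comp; [|assumption]. apply holomorphic_self_map_iff, HA.
    - apply Cmod_gt_0. rewrite E by now apply Hf. apply pow_lt, Cmod_gt_0, mobius_neq_0;
        [assumption|now apply Hf|congruence].
    - apply (zeros_exhaust_ext (fun z => mobius w (f z) ^ n)); [assumption| |now apply zeros_exhaust_pow].
      intros z Hz. rewrite Cmod_pow, E; [reflexivity|now apply Hf]. }
  split; [|assumption].
  apply (HT (fun z => z)). split; [|split].
  - apply holomorphic_self_map_iff. split; intros z Hz; [apply hol_at_id|assumption].
  - auto.
  - intros w Hw. now exists w.
Qed.

(** * Composition *)

(** Each factor [mobius a o f] is replaced by a finite Blaschke product that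
    divides it and is nearly as large at [z0]. *)
Lemma pull_zeros (f : C -> C) (z0 : C) (A : list C) (eps : R) :
  disc_self_map f -> unit_disc z0 ->
  (forall c, unit_disc c -> zeros_exhaust (fun z => mobius c (f z)) z0) ->
  Forall unit_disc A -> (0 < eps)%R ->
  exists A', Forall unit_disc A' /\
    (forall z, unit_disc z -> (Cmod (mobius_prod A (f z)) <= Cmod (mobius_prod A' z))%R) /\
    (Cmod (mobius_prod A' z0) <= Cmod (mobius_prod A (f z0)) + eps)%R.
Proof.
  intros Hf Hz0 Hex HA. revert eps. induction HA as [|a A Ha HA IH]; intros eps Heps.
  - exists nil. repeat split; [constructor| |].
    + intros z _. simpl. lra.
    + simpl. lra.
  - destruct (IH (eps / 2)%R ltac:(lra)) as (A' & H1 & H2 & H3).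
    destruct (Hex a Ha (eps / 2)%R ltac:(lra)) as (X & X1 & X2 & X3).
    exists (X ++ A'). repeat split.
    + now apply Forall_app.
    + intros z Hz. simpl. rewrite mobius_prod_app, !Cmod_mult.
      apply Rmult_le_compat; try apply Cmod_ge_0; auto.
    + simpl. rewrite mobius_prod_app, !Cmod_mult.
      replace eps with (2 * (eps / 2))%R by field.
      pose proof (mobius_prod_le_1 A' z0 H1 Hz0).
      pose proof (mobius_disc a (f z0) Ha (proj2 Hf z0 Hz0)) as Hd. unfold unit_disc in Hd.
      apply approx_mult; try lra; split; try apply Cmod_ge_0; lra.
Qed.

Lemma zeros_exhaust_comp (u f : C -> C) (z0 : C) :
  disc_self_map f -> unit_disc z0 -> zeros_exhaust u (f z0) ->
  (forall c, unit_disc c -> zeros_exhaust (fun z => mobius c (f z)) z0) ->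
  zeros_exhaust (fun z => u (f z)) z0.
Proof.
  intros Hf Hz0 Hu Hex eps Heps.
  destruct (Hu (eps / 2)%R ltac:(lra)) as (A & HA & HA1 & HA2).
  destruct (pull_zeros f z0 A (eps / 2) Hf Hz0 Hex HA ltac:(lra)) as (A' & H1 & H2 & H3).
  exists A'. repeat split; [assumption| |lra].
  intros z Hz. eapply Rle_trans; [apply HA1; now apply Hf|now apply H2].
Qed.

(** * Near-isometries of the disc *)

(** A self-map that nearly preserves the pseudo-hyperbolic distance of two
    points [p], [q] is nearly an isometry on compact sets. Normalized by
    [p = F p = 0], it is [z * h z] up to sign with [Cmod (h q)] close to [1]; by
    [schur_oscillation], [Cmod h] is close to [1] on a large disc. The minimum of
    [Cmod (mobius w (F z))] on its boundary then exceeds the value at [0], which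
    forces a solution of [F c = w], and [w = c * h c] up to sign puts [c] at
    almost the same distance from [p] as [w] is from [F p]. *)
Lemma near_isometry_covers (sigma tau eps : R) :
  (0 <= sigma < 1)%R -> (0 <= tau < 1)%R -> (0 < eps < 1)%R ->
  exists delta r, (0 < delta < 1)%R /\ (0 < r < 1)%R /\
    forall F p q w, disc_self_map F -> unit_disc p -> unit_disc q -> unit_disc w ->
      (0 < Cmod (mobius p q) <= tau)%R -> (Cmod (mobius (F p) w) <= sigma)%R ->
      ((1 - delta) * Cmod (mobius p q) <= Cmod (mobius (F p) (F q)))%R ->
      exists c, unit_disc c /\ F c = w /\ (Cmod (mobius p c) <= r)%R /\
        ((1 - eps) * Cmod (mobius p c) <= Cmod (mobius (F p) w))%R.
Proof.
  intros Hsigma Htau Heps.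
  (* [m] separates the value [Cmod w <= sigma] at the centre from the values on
     the circle of radius [r]; [k] is the defect [1 - Cmod (g z) ^ 2] below which
     [Cmod (mobius w (g z))] is at least [m]. *)
  set (m := ((1 + sigma) / 2)%R).
  assert (Hm : (0 < m < 1)%R) by (unfold m; lra).
  set (k := ((1 - m ^ 2) * (1 - sigma) ^ 2)%R).
  assert (Hk : (0 < k <= 1)%R).
  { pose proof (one_minus_sq_pos m ltac:(lra)). pose proof (pow2_ge_0 m).
    assert (0 < (1 - sigma) ^ 2)%R by (apply pow_lt; lra).
    assert ((1 - sigma) ^ 2 <= 1)%R.
    { rewrite <- (pow1 2). apply pow_incr. lra. }
    unfold k. split; [now apply Rmult_lt_0_compat|].
    apply Rle_trans with (1 * 1)%R; [apply Rmult_le_compat; lra|lra]. }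
  set (r := (1 - k / 8)%R). assert (Hr : (0 < r < 1)%R) by (unfold r; lra).
  set (eta := Rmin eps (k / 8)).
  assert (Heta : (0 < eta)%R) by (apply Rmin_pos; lra).
  assert (Heta1 : (eta <= eps)%R) by apply Rmin_l.
  assert (Heta2 : (eta <= k / 8)%R) by apply Rmin_r.
  (* An upper bound for the distance of [q] to the points of modulus at most
     [r], coming from [mobius_gap]. *)
  set (S0 := (1 - (1 - r ^ 2) / 8 * (1 - tau))%R).
  assert (HS : (0 < 1 - S0 < 1)%R).
  { pose proof (one_minus_sq_pos r ltac:(lra)). pose proof (pow2_ge_0 r).
    replace (1 - S0)%R with ((1 - r ^ 2) / 8 * (1 - tau))%R by (unfold S0; ring).
    split; [apply Rmult_lt_0_compat; lra|].
    apply prod_lt_1; lra. }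
  set (delta := (eta * (1 - S0) / 3)%R).
  assert (Hdelta : (0 < delta)%R).
  { apply Rdiv_lt_0_compat; [|lra]. apply Rmult_lt_0_compat; lra. }
  assert (Hdelta1 : (delta <= eta / 3)%R).
  { unfold delta. assert (eta * (1 - S0) <= eta * 1)%R by (apply Rmult_le_compat_l; lra). lra. }
  exists delta, r. split; [lra|]. split; [assumption|].
  intros F p q w HF Hp Hq Hw Hpq Hsw Hiso.
  pose proof (proj2 HF p Hp) as HFp.
  set (g := fun z => mobius (F p) (F (mobius p z))).
  assert (Hg : disc_self_map g).
  { apply (disc_self_map_comp (mobius (F p)) (fun z => F (mobius p z))); [now apply disc_self_map_mobius|].
    apply (disc_self_map_comp F (mobius p)); [assumption|now apply disc_self_map_mobius]. }
  assert (D0 : unit_disc 0) by (unfold unit_disc; rewrite Cmod_0; lra).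
  assert (Hg0 : g 0 = 0) by (unfold g; rewrite mobius_0_r; apply mobius_self).
  destruct (schur_division g 0 (disc_self_map_schur g Hg) D0 Hg0) as [h [Hh Eh]].
  assert (Ehm : forall z, unit_disc z -> Cmod (g z) = (Cmod z * Cmod (h z))%R).
  { intros z Hz. rewrite (Eh z Hz), Cmod_mult, mobius_0_l, Cmod_opp. reflexivity. }
  set (q' := mobius p q). assert (Hq' : unit_disc q') by now apply mobius_disc.
  fold q' in Hpq, Hiso.
  assert (Hhq : (1 - delta <= Cmod (h q'))%R).
  { apply Rmult_le_reg_r with (Cmod q'); [lra|].
    replace (Cmod (h q') * Cmod q')%R with (Cmod (g q')) by (rewrite Ehm by assumption; ring).
    unfold g, q' at 2. rewrite mobius_involutive by assumption. exact Hiso. }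
  assert (Hhz : forall z, (Cmod z <= r)%R -> (1 - eta <= Cmod (h z))%R).
  { intros z Hz. assert (HzD : unit_disc z) by (unfold unit_disc; lra).
    pose proof (schur_oscillation h z q' Hh HzD Hq') as Hosc.
    pose proof (mobius_gap q' z Hq' HzD) as Hgap.
    set (t := Cmod (mobius q' z)) in *. pose proof (Cmod_ge_0 (mobius q' z)) as Ht. fold t in Ht.
    assert (HtS : (t <= S0)%R).
    { eapply Rle_trans; [exact Hgap|]. unfold S0.
      assert (Cmod z ^ 2 <= r ^ 2)%R by (apply pow_incr; pose proof (Cmod_ge_0 z); lra).
      pose proof (one_minus_sq_pos r ltac:(lra)).
      assert ((1 - r ^ 2) / 8 * (1 - tau) <= (1 - Cmod z ^ 2) / 8 * (1 - Cmod q'))%R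
        by (apply Rmult_le_compat; lra). lra. }
    pose proof (proj2 Hh q' Hq') as Hh1. pose proof (Cmod_ge_0 (h q')) as Hh0.
    assert (Hsq : (0 <= 1 - Cmod (h q') ^ 2 <= 2 * delta)%R).
    { replace (1 - Cmod (h q') ^ 2)%R with ((1 + Cmod (h q')) * (1 - Cmod (h q')))%R by ring.
      split; [apply Rmult_le_pos; lra|]. apply Rmult_le_compat; lra. }
    assert (Hfrac : (t / (1 - t) <= / (1 - S0))%R).
    { rewrite <- (Rmult_1_l (/ (1 - S0))). apply Rmult_le_compat; try lra.
      - left. apply Rinv_0_lt_compat. lra.
      - apply Rinv_le_contravar; lra. }
    assert (Hb : (Cmod (h q' - h z) <= / (1 - S0) * (2 * delta))%R).
    { eapply Rle_trans; [exact Hosc|]. apply Rmult_le_compat; try lra.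
      apply Rmult_le_pos; [assumption|]. left. apply Rinv_0_lt_compat. lra. }
    replace (/ (1 - S0) * (2 * delta))%R with (2 * eta / 3)%R in Hb
      by (unfold delta; field; lra).
    pose proof (Cmod_triangle_inv (h q') (h z)). lra. }
  set (w' := mobius (F p) w). assert (Hw' : unit_disc w') by now apply mobius_disc.
  fold w' in Hsw.
  destruct (zero_in_circle (fun z => mobius w' (g z)) r m) as [z [Hz E]].
  - lra.
  - intros z Hz. assert (HzD : unit_disc z) by (unfold unit_disc; lra).
    apply (hol_at_comp (mobius w') g); [|now apply Hg].
    apply hol_at_mobius; [assumption|]. left. now apply Hg.
  - intros z Hz. assert (HzD : unit_disc z) by (unfold unit_disc; lra).
    apply Rnot_lt_le. intros Hlt.
    pose proof (proj2 Hg z HzD) as Hgz. unfold unit_disc in Hgz.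
    pose proof (mobius_defect w' (g z) Hw' ltac:(lra)) as Ed.
    pose proof (mobius_den_bound w' (g z)) as Hden.
    pose proof (Cmod_ge_0 w') as W0. pose proof (Cmod_ge_0 (g z)) as G0.
    assert (Hden2 : (1 - sigma <= Cmod (1 - Cconj w' * g z))%R).
    { assert (Cmod w' * Cmod (g z) <= Cmod w' * 1)%R by (apply Rmult_le_compat_l; lra). lra. }
    assert (L : (k <= (1 - Cmod (mobius w' (g z)) ^ 2) * Cmod (1 - Cconj w' * g z) ^ 2)%R).
    { pose proof (one_minus_sq_pos m ltac:(lra)).
      unfold k. apply Rmult_le_compat; try lra.
      - apply pow_le; lra.
      - assert (Cmod (mobius w' (g z)) ^ 2 <= m ^ 2)%R
          by (apply pow_incr; split; [apply Cmod_ge_0|lra]). lra.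
      - apply pow_incr; lra. }
    rewrite Ed in L.
    assert (HR : (1 - k / 4 <= Cmod (g z))%R).
    { rewrite Ehm, Hz by assumption. specialize (Hhz z ltac:(lra)).
      assert (r * (1 - k / 8) <= r * Cmod (h z))%R by (apply Rmult_le_compat_l; lra).
      unfold r in *. pose proof (pow2_ge_0 (k / 8)). simpl in *. lra. }
    assert (HR2 : (1 - Cmod (g z) ^ 2 <= 2 * (k / 4))%R).
    { replace (1 - Cmod (g z) ^ 2)%R with ((1 + Cmod (g z)) * (1 - Cmod (g z)))%R by ring.
      apply Rmult_le_compat; lra. }
    pose proof (pow2_ge_0 (Cmod w')).
    pose proof (one_minus_sq_pos (Cmod (g z)) ltac:(lra)).
    assert ((1 - Cmod w' ^ 2) * (1 - Cmod (g z) ^ 2) <= 1 * (1 - Cmod (g z) ^ 2))%R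
      by (apply Rmult_le_compat_r; lra).
    lra.
  - rewrite Hg0, mobius_0_r. unfold m. lra.
  - assert (HzD : unit_disc z) by (unfold unit_disc; lra).
    assert (Hpz : unit_disc (mobius p z)) by now apply mobius_disc.
    apply mobius_eq_0 in E; [|assumption|now apply Hg].
    exists (mobius p z). rewrite mobius_involutive by assumption.
    repeat split; try assumption.
    + symmetry. apply (mobius_inj (F p)); try assumption. now apply HF.
    + fold w'. rewrite E, Ehm by assumption. rewrite Rmult_comm.
      apply Rmult_le_compat_l; [apply Cmod_ge_0|]. specialize (Hhz z Hz). lra.
Qed.

(** * Forward iterates and their limits *)

(** The factor [b (n + m) o ... o b (n + 1)] of the iterate of order [n + m]. *)
Fixpoint tail_iterate (b : nat -> C -> C) (n m : nat) (z : C) : C :=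
  match m with
  | O => z
  | S m => b (S (n + m)) (tail_iterate b n m z)
  end.

Lemma forward_iterate_tail (b : nat -> C -> C) (n m : nat) (z : C) :
  forward_iterate b (n + m) z = tail_iterate b n m (forward_iterate b n z).
Proof.
  induction m as [|m IH]; [now rewrite Nat.add_0_r|].
  rewrite Nat.add_succ_r. cbn [forward_iterate tail_iterate]. now rewrite IH.
Qed.

Lemma disc_self_map_id : disc_self_map (fun z => z).
Proof. split; intros z Hz; [apply hol_at_id|assumption]. Qed.

Lemma disc_self_map_tail (b : nat -> C -> C) (n m : nat) :
  (forall n, (1 <= n)%nat -> disc_self_map (b n)) -> disc_self_map (tail_iterate b n m).
Proof.
  intros Hb. induction m as [|m IH]; [apply disc_self_map_id|].
  apply (disc_self_map_comp (b (S (n + m))) (tail_iterate b n m)); [apply Hb; lia|assumption].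
Qed.

Lemma disc_self_map_forward (b : nat -> C -> C) (n : nat) :
  (forall n, (1 <= n)%nat -> disc_self_map (b n)) -> disc_self_map (forward_iterate b n).
Proof.
  intros Hb. induction n as [|n IH]; [apply disc_self_map_id|].
  apply (disc_self_map_comp (b (S n)) (forward_iterate b n)); [apply Hb; lia|assumption].
Qed.

Lemma zeros_exhaust_forward (b : nat -> C -> C) (n : nat) :
  (forall n, (1 <= n)%nat -> disc_self_map (b n)) ->
  (forall n, (1 <= n)%nat -> indestructible_blaschke (b n)) ->
  forall c z0, unit_disc c -> unit_disc z0 ->
    zeros_exhaust (fun z => mobius c (forward_iterate b n z)) z0.
Proof.
  intros Hb Hind. induction n as [|n IH]; intros c z0 Hc Hz0.
  - intros eps Heps. exists (c :: nil). repeat split.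
    + now constructor.
    + intros z _. simpl. right. f_equal. ring.
    + simpl. replace (mobius c z0 * 1) with (mobius c z0) by ring. lra.
  - apply (zeros_exhaust_comp (fun z => mobius c (b (S n) z)) (forward_iterate b n) z0).
    + now apply disc_self_map_forward.
    + assumption.
    + apply indestructible_zeros_exhaust; [apply Hind; lia|assumption|].
      now apply disc_self_map_forward.
    + intros c' Hc'. now apply IH.
Qed.

Lemma C_lim_cluster (u : nat -> C) (l : C) : C_seq_lim u l -> C_cluster u l.
Proof.
  intros H eps N Heps. destruct (proj1 (C_seq_lim_iff _ _) H eps Heps) as [M HM].
  exists (max N M). split; [lia|]. apply HM. lia.
Qed.

Lemma den_perturb (x y x' y' : C) (e : R) :
  (Cmod x' <= 1)%R -> (Cmod y <= 1)%R ->
  (Cmod (x' - x) <= e)%R -> (Cmod (y' - y) <= e)%R ->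
  (Cmod ((1 - Cconj x * y) - (1 - Cconj x' * y')) <= 2 * e)%R.
Proof.
  intros Hx' Hy Hx Hyy.
  replace (1 - Cconj x * y - (1 - Cconj x' * y'))
    with (Cconj (x' - x) * y + Cconj x' * (y' - y))
    by (rewrite Cminus_conj; ring).
  eapply Rle_trans; [apply Cmod_triangle|]. rewrite !Cmod_mult, !Cmod_conj.
  pose proof (Cmod_ge_0 (x' - x)). pose proof (Cmod_ge_0 (y' - y)).
  pose proof (Cmod_ge_0 x'). pose proof (Cmod_ge_0 y).
  assert (Cmod (x' - x) * Cmod y <= e * 1)%R by (apply Rmult_le_compat; lra).
  assert (Cmod x' * Cmod (y' - y) <= 1 * e)%R by (apply Rmult_le_compat; lra).
  lra.
Qed.

(** Inequalities of Schwarz-Pick type pass to the limit even when the limit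
    point [x0] may lie on the circle. *)
Lemma schwarz_pick_closed (x y : nat -> C) (x0 y0 : C) (t : R) (N : nat) :
  (0 <= t)%R -> (forall n, (Cmod (x n) <= 1)%R) -> (Cmod y0 <= 1)%R ->
  C_cluster x x0 -> C_seq_lim y y0 ->
  (forall n, (N <= n)%nat -> (Cmod (x n - y n) <= t * Cmod (1 - Cconj (x n) * y n))%R) ->
  (Cmod (x0 - y0) <= t * Cmod (1 - Cconj x0 * y0))%R.
Proof.
  intros Ht Hx1 Hy1 Hx Hy H. apply le_of_forall_gt. intros M HM.
  set (d := (M - t * Cmod (1 - Cconj x0 * y0))%R). assert (Hd : (0 < d)%R) by (unfold d; lra).
  set (e := (d / (2 * (t + 1)))%R). assert (He : (0 < e)%R) by (apply Rdiv_lt_0_compat; lra).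
  destruct (proj1 (C_seq_lim_iff _ _) Hy e He) as [N2 HN2].
  destruct (Hx e (max N N2) He) as [n [Hn Hxn]].
  specialize (HN2 n ltac:(lia)). specialize (H n ltac:(lia)).
  pose proof (den_perturb x0 y0 (x n) (y n) e (Hx1 n) Hy1 (Rlt_le _ _ Hxn) (Rlt_le _ _ HN2)) as Hden.
  rewrite Cmod_minus_sym in Hden.
  pose proof (Cmod_triangle_inv (1 - Cconj (x n) * y n) (1 - Cconj x0 * y0)) as T0.
  pose proof (Cmod_triangle_via (x n) x0 y0) as T1. rewrite (Cmod_minus_sym x0 (x n)) in T1.
  pose proof (Cmod_triangle_via (y n) (x n) y0) as T2.
  assert (t * Cmod (1 - Cconj (x n) * y n) <= t * (Cmod (1 - Cconj x0 * y0) + 2 * e))%R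
    by (apply Rmult_le_compat_l; lra).
  assert (2 * (t + 1) * e = d)%R by (unfold e; field; lra).
  unfold d in *. lra.
Qed.

(** For [x] outside the disc, [Cmod (x - y)] is at least [Cmod (1 - Cconj x * y)]:
    the image of a point under self-maps cannot escape to the circle while the
    image of another point stays inside. *)
Lemma disc_of_schwarz_pick (x y : C) (t : R) :
  (t < 1)%R -> unit_disc y -> (Cmod (x - y) <= t * Cmod (1 - Cconj x * y))%R ->
  unit_disc x.
Proof.
  intros Ht Hy H. unfold unit_disc in *. apply Rnot_le_lt. intros Hx.
  pose proof (mobius_sq_identity x y) as E.
  pose proof (one_minus_sq_pos (Cmod y) ltac:(pose proof (Cmod_ge_0 y); lra)) as H1.
  assert (H2 : (1 <= Cmod x ^ 2)%R) by (rewrite <- (pow1 2); apply pow_incr; lra).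
  assert (H3 : (0 <= (Cmod x ^ 2 - 1) * (1 - Cmod y ^ 2))%R) by (apply Rmult_le_pos; lra).
  pose proof (Cmod_triangle_inv x y) as T.
  set (X := Cmod (x - y)) in *. pose proof (Cmod_ge_0 (1 - Cconj x * y)) as HY.
  set (Y := Cmod (1 - Cconj x * y)) in *.
  assert (HX : (0 < X)%R) by lra.
  assert (HYX : (Y <= X)%R).
  { apply Rnot_lt_le. intros Hlt. assert (X ^ 2 < Y ^ 2)%R.
    { simpl. rewrite !Rmult_1_r. apply Rmult_le_0_lt_compat; lra. }
    lra. }
  assert (HtY : (t * Y <= Y)%R).
  { rewrite <- (Rmult_1_l Y) at 2. apply Rmult_le_compat_r; lra. }
  assert (Y = X)%R by lra.
  assert (0 < (1 - t) * Y)%R by (apply Rmult_lt_0_compat; lra). lra.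
Qed.

Lemma mobius_eventually_le (x y : nat -> C) (x0 y0 : C) (M : R) :
  (forall n, unit_disc (x n)) -> (forall n, unit_disc (y n)) ->
  unit_disc x0 -> unit_disc y0 -> C_seq_lim x x0 -> C_seq_lim y y0 ->
  (Cmod (mobius x0 y0) < M)%R ->
  exists N, forall n, (N <= n)%nat -> (Cmod (mobius (x n) (y n)) <= M)%R.
Proof.
  intros Hx Hy Hx0 Hy0 Lx Ly HM. unfold unit_disc in *.
  pose proof (mobius_den_pos x0 y0 Hx0 ltac:(lra)) as HY.
  pose proof (Cmod_ge_0 (mobius x0 y0)) as Hd0.
  assert (Ed : Cmod (x0 - y0) = (Cmod (mobius x0 y0) * Cmod (1 - Cconj x0 * y0))%R).
  { rewrite Cmod_mobius by (assumption || lra). field. lra. }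
  set (d := Cmod (mobius x0 y0)) in *. set (Y := Cmod (1 - Cconj x0 * y0)) in *.
  set (e := ((M - d) * Y / (2 * (1 + M)))%R).
  assert (He : (0 < e)%R).
  { apply Rdiv_lt_0_compat; [apply Rmult_lt_0_compat; lra|lra]. }
  destruct (proj1 (C_seq_lim_iff _ _) Lx e He) as [N1 H1].
  destruct (proj1 (C_seq_lim_iff _ _) Ly e He) as [N2 H2].
  exists (max N1 N2). intros n Hn.
  specialize (H1 n ltac:(lia)). specialize (H2 n ltac:(lia)).
  apply mobius_le_iff; [apply Hx|left; apply Hy|].
  pose proof (den_perturb x0 y0 (x n) (y n) e (Rlt_le _ _ (Hx n)) (Rlt_le _ _ Hy0)
    (Rlt_le _ _ H1) (Rlt_le _ _ H2)) as Hden.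
  pose proof (Cmod_triangle_inv (1 - Cconj x0 * y0) (1 - Cconj (x n) * y n)) as T0.
  fold Y in T0.
  pose proof (Cmod_triangle_via x0 (x n) (y n)) as T1.
  pose proof (Cmod_triangle_via y0 x0 (y n)) as T2. rewrite (Cmod_minus_sym y0) in T2.
  assert (M * (Y - 2 * e) <= M * Cmod (1 - Cconj (x n) * y n))%R
    by (apply Rmult_le_compat_l; lra).
  assert (2 * (1 + M) * e = (M - d) * Y)%R by (unfold e; field; lra).
  lra.
Qed.

Lemma C_seq_lim_const (c : C) : C_seq_lim (fun _ => c) c.
Proof.
  apply C_seq_lim_iff. intros eps Heps. exists 0%nat. intros n _.
  replace (c - c) with (RtoC 0) by ring. now rewrite Cmod_0.
Qed.

Lemma C_seq_lim_shift (u : nat -> C) (l : C) (k : nat) :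
  C_seq_lim u l -> C_seq_lim (fun m => u (k + m)%nat) l.
Proof.
  rewrite !C_seq_lim_iff. intros H eps Heps. destruct (H eps Heps) as [N HN].
  exists N. intros n Hn. apply HN. lia.
Qed.

(** The limit of Schwarz-Pick for the tails. It replaces a limit of the tails
    themselves: with [w] in the role of the image of [c], [B] behaves as if it
    were the composition of a self-map with the iterate of order [n]. *)
Lemma cluster_domination (b : nat -> C -> C) (B : C -> C) (n : nat) (c w z : C) :
  (forall n, (1 <= n)%nat -> disc_self_map (b n)) -> disc_self_map B ->
  cvg_on_disc (forward_iterate b) B -> unit_disc c -> unit_disc z ->
  C_cluster (fun m => tail_iterate b n m c) w ->
  unit_disc w /\ (Cmod (mobius w (B z)) <= Cmod (mobius c (forward_iterate b n z)))%R.
Proof.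
  intros Hb HB Hlim Hc Hz Hw.
  pose proof (proj2 (disc_self_map_forward b n Hb) z Hz) as Hbz.
  pose proof (proj2 HB z Hz) as HBz.
  assert (H : (Cmod (w - B z) <=
    Cmod (mobius c (forward_iterate b n z)) * Cmod (1 - Cconj w * B z))%R).
  { apply (schwarz_pick_closed (fun m => tail_iterate b n m c)
      (fun m => forward_iterate b (n + m) z) w (B z) _ 0).
    - apply Cmod_ge_0.
    - intros m. left. now apply disc_self_map_tail.
    - now left.
    - assumption.
    - now apply (C_seq_lim_shift (fun k => forward_iterate b k z)), Hlim.
    - intros m _. rewrite forward_iterate_tail.
      apply schwarz_pick; try assumption.
      now apply disc_self_map_schur, disc_self_map_tail. }
  assert (HwD : unit_disc w).
  { eapply disc_of_schwarz_pick; [|exact HBz|exact H]. apply mobius_disc; assumption. }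
  split; [assumption|]. apply mobius_le_iff; [assumption|now left|assumption].
Qed.

(** [mobius w o B] is a multiple of [mobius c o B_n] in the Schur class, where
    [B_n] is the iterate of order [n], and a divisor of a function exhausted by
    its zeros is exhausted by its zeros. Finally [push_zeros] passes from
    [mobius c o b_n o B_(n-1)] to [mobius c o b_n]. *)
Lemma factor_indestructible (b : nat -> C -> C) (B : C -> C) :
  (forall n, (1 <= n)%nat -> disc_self_map (b n)) -> disc_self_map B ->
  cvg_on_disc (forward_iterate b) B -> nonconstant_on_disc B ->
  indestructible_blaschke B -> forall n, (1 <= n)%nat -> indestructible_blaschke (b n).
Proof.
  intros Hb HB Hlim (x1 & x2 & Hx1 & Hx2 & Hx12) Hind [|j] Hj; [lia|].
  apply zeros_exhaust_indestructible; [now apply Hb|]. intros c Hc.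
  set (beta := forward_iterate b j).
  assert (Hbeta : disc_self_map beta) by now apply disc_self_map_forward.
  destruct (C_bounded_cluster (fun m => tail_iterate b (S j) m c) 1) as [w Hw].
  { intros m. left. now apply disc_self_map_tail. }
  assert (HwD : unit_disc w)
    by (apply (cluster_domination b B (S j) c w x1); assumption).
  assert (Hdom : forall z, unit_disc z ->
    (Cmod (mobius w (B z)) <= Cmod (mobius c (b (S j) (beta z))))%R).
  { intros z Hz. now apply (cluster_domination b B (S j) c w z). }
  assert (Hz0 : exists z0, unit_disc z0 /\ B z0 <> w).
  { destruct (Ceq_dec (B x1) w) as [E|E]; [|now exists x1].
    exists x2. split; [assumption|]. congruence. }
  destruct Hz0 as (z0 & Hz0 & Hne).
  assert (Hk0 : mobius w (B z0) <> 0).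
  { apply mobius_neq_0; [assumption|now apply HB|congruence]. }
  set (u := fun y => mobius c (b (S j) y)).
  assert (Hu : schur u).
  { apply disc_self_map_schur, (disc_self_map_comp (mobius c) (b (S j)));
      [now apply disc_self_map_mobius|now apply Hb]. }
  assert (Hub : schur (fun z => u (beta z))) by now apply schur_comp.
  assert (Hk : schur (fun z => mobius w (B z))).
  { apply disc_self_map_schur, (disc_self_map_comp (mobius w) B);
      [now apply disc_self_map_mobius|assumption]. }
  assert (Hub0 : u (beta z0) <> 0).
  { apply Cmod_gt_0. apply Cmod_gt_0 in Hk0. specialize (Hdom z0 Hz0). unfold u. lra. }
  exists (beta z0). split; [now apply Hbeta|]. split.
  { intros E. apply Hub0. unfold u. rewrite E. apply mobius_self. }
  destruct (schur_quotient _ _ z0 Hk Hub Hz0 Hub0 Hdom) as [v [Hv Ev]].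
  assert (Hv0 : (0 < Cmod (v z0))%R).
  { apply Cmod_gt_0. intros E. apply Hk0. rewrite (Ev z0 Hz0), E. ring. }
  intros eps Heps.
  destruct (indestructible_zeros_exhaust B w z0 Hind HwD Hz0 (eps * Cmod (v z0))%R)
    as (A & HA & HA1 & HA2); [now apply Rmult_lt_0_compat|].
  destruct (split_zeros A (fun z => u (beta z)) v HA Hub Hv)
    as (A1 & A2 & H1 & H2 & _ & H4 & H5 & H6).
  { intros z Hz. rewrite <- Ev by assumption. now apply HA1. }
  destruct (push_zeros beta A1 u Hbeta H1 Hu H5) as (X & HX & HX1 & HX2).
  exists X. split; [assumption|]. split; [assumption|].
  eapply Rle_trans; [now apply HX2|].
  apply Rmult_le_reg_r with (Cmod (v z0)); [assumption|].
  apply Rle_trans with (Cmod (mobius_prod A z0)).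
  - rewrite H4, Cmod_mult. apply Rmult_le_compat_l; [apply Cmod_ge_0|now apply H6].
  - eapply Rle_trans; [exact HA2|]. rewrite (Ev z0 Hz0), Cmod_mult.
    right. change (mobius c (b (S j) (beta z0))) with (u (beta z0)). ring.
Qed.

(** For large [n] the tails nearly preserve the distance of the images of [z0]
    and [z1], because the distances of [B_m z0] and [B_m z1] decrease to a
    positive limit. So they take the value [w] at points [cs m] that are not much
    farther from [B_n z0] than [w] is from [B z0]. At a cluster point [c] of
    these, the zeros of [mobius c o B_n] are zeros of [mobius w o B], and they
    suffice to exhaust it at [z0] up to a small error. *)
Lemma limit_indestructible (b : nat -> C -> C) (B : C -> C) :
  (forall n, (1 <= n)%nat -> disc_self_map (b n)) -> disc_self_map B ->
  cvg_on_disc (forward_iterate b) B -> nonconstant_on_disc B ->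
  (forall n, (1 <= n)%nat -> indestructible_blaschke (b n)) -> indestructible_blaschke B.
Proof.
  intros Hb HB Hlim (x1 & x2 & Hx1 & Hx2 & Hx12) Hind.
  apply zeros_exhaust_indestructible; [assumption|]. intros w Hw.
  assert (Hz : exists z0 z1, unit_disc z0 /\ unit_disc z1 /\ B z0 <> w /\ B z0 <> B z1).
  { destruct (Ceq_dec (B x1) w) as [E|E].
    - exists x2, x1. repeat split; try assumption; congruence.
    - exists x1, x2. repeat split; assumption. }
  destruct Hz as (z0 & z1 & Hz0 & Hz1 & Hz0w & Hz01).
  exists z0. split; [assumption|]. split; [assumption|]. intros eps Heps.
  set (Bn := forward_iterate b).
  assert (HBn : forall n, disc_self_map (Bn n)) by (intros; now apply disc_self_map_forward).
  pose proof (proj2 HB z0 Hz0) as HB0. pose proof (proj2 HB z1 Hz1) as HB1.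
  set (s := Cmod (mobius (B z0) w)).
  assert (Hs : (0 <= s < 1)%R) by (split; [apply Cmod_ge_0|now apply mobius_disc]).
  set (tau := Cmod (mobius z0 z1)).
  assert (Htau : (0 <= tau < 1)%R) by (split; [apply Cmod_ge_0|now apply mobius_disc]).
  (* The final bound is [(s + e) / (1 - e) + e], at most [s + 5 * e]. *)
  set (e := Rmin (1 / 2) (eps / 5)).
  assert (He : (0 < e)%R) by (apply Rmin_pos; lra).
  assert (He1 : (e <= 1 / 2)%R) by apply Rmin_l.
  assert (He2 : (e <= eps / 5)%R) by apply Rmin_r.
  destruct (near_isometry_covers ((1 + s) / 2) tau e) as (delta & r & Hdelta & Hr & Hcov);
    try lra.
  set (d := Cmod (mobius (B z0) (B z1))).
  assert (Hd : (0 < d)%R) by (apply Cmod_gt_0, mobius_neq_0; assumption).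
  assert (Hd_low : forall n, (d <= Cmod (mobius (Bn n z0) (Bn n z1)))%R).
  { intros n.
    assert (Hcl : C_cluster (fun m => tail_iterate b n m (Bn n z0)) (B z0)).
    { apply C_lim_cluster. apply C_seq_lim_iff. intros e' He'.
      destruct (proj1 (C_seq_lim_iff _ _) (Hlim z0 Hz0) e' He') as [N HN].
      exists N. intros m Hm. unfold Bn. rewrite <- forward_iterate_tail. apply HN. lia. }
    destruct (cluster_domination b B n (Bn n z0) (B z0) z1 Hb HB Hlim) as [_ H];
      try assumption. now apply HBn. }
  destruct (mobius_eventually_le (fun n => Bn n z0) (fun n => Bn n z1) (B z0) (B z1)
    (d / (1 - delta))) as [N1 HN1]; try assumption.
  { intros n. now apply HBn. }
  { intros n. now apply HBn. }
  { now apply Hlim. }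
  { now apply Hlim. }
  { fold d. apply Rmult_lt_reg_r with (1 - delta)%R; [lra|].
    unfold Rdiv. rewrite Rmult_assoc, Rinv_l, Rmult_1_r by lra.
    rewrite <- (Rmult_1_r d) at 2. apply Rmult_lt_compat_l; lra. }
  destruct (mobius_eventually_le (fun n => Bn n z0) (fun n => w) (B z0) w
    ((1 + s) / 2)) as [N2 HN2]; try assumption.
  { intros n. now apply HBn. }
  { intros n. exact Hw. }
  { now apply Hlim. }
  { apply C_seq_lim_const. }
  { fold s. lra. }
  destruct (mobius_eventually_le (fun n => Bn n z0) (fun n => w) (B z0) w
    (s + e)) as [N3 HN3]; try assumption.
  { intros n. now apply HBn. }
  { intros n. exact Hw. }
  { now apply Hlim. }
  { apply C_seq_lim_const. }
  { fold s. lra. }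
  set (n := max N1 (max N2 N3)).
  set (p := Bn n z0). assert (Hp : unit_disc p) by now apply HBn.
  assert (Hc : forall m, exists c, unit_disc c /\ tail_iterate b n m c = w /\
    (Cmod (mobius p c) <= r)%R /\
    ((1 - e) * Cmod (mobius p c) <= s + e)%R).
  { intros m.
    assert (Ep : tail_iterate b n m p = Bn (n + m)%nat z0)
      by (symmetry; apply forward_iterate_tail).
    assert (Eq : tail_iterate b n m (Bn n z1) = Bn (n + m)%nat z1)
      by (symmetry; apply forward_iterate_tail).
    destruct (Hcov (tail_iterate b n m) p (Bn n z1) w) as (c & C1 & C2 & C3 & C4).
    - now apply disc_self_map_tail.
    - assumption.
    - now apply HBn.
    - assumption.
    - split; [apply Rlt_le_trans with d; [assumption|apply Hd_low]|].
      apply (schwarz_pick_mobius (Bn n)); try assumption.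
      now apply disc_self_map_schur.
    - rewrite Ep. apply HN2. lia.
    - rewrite Ep, Eq. apply Rle_trans with d; [|apply Hd_low].
      replace d with ((1 - delta) * (d / (1 - delta)))%R by (field; lra).
      apply Rmult_le_compat_l; [lra|]. apply HN1. lia.
    - exists c. repeat split; try assumption.
      eapply Rle_trans; [exact C4|]. rewrite Ep. apply HN3. lia. }
  destruct (choice _ Hc) as [cs Hcs].
  destruct (C_bounded_cluster cs 1) as [c Hcl]; [intros m; left; apply Hcs|].
  assert (Hcp : forall t, (0 <= t)%R -> (forall m, (Cmod (mobius p (cs m)) <= t)%R) ->
    (Cmod (c - p) <= t * Cmod (1 - Cconj c * p))%R).
  { intros t Ht H. apply (schwarz_pick_closed cs (fun _ => p) c p t 0 Ht).
    - intros m. left. apply Hcs.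
    - now left.
    - assumption.
    - apply C_seq_lim_const.
    - intros m _. destruct (Hcs m) as (C1 & _).
      apply mobius_le_iff; [assumption|now left|].
      rewrite mobius_sym by assumption. apply H. }
  assert (HcD : unit_disc c).
  { apply (disc_of_schwarz_pick c p r); [lra|assumption|].
    apply Hcp; [lra|]. intros m. apply Hcs. }
  assert (Hdist : (Cmod (mobius c p) <= (s + e) / (1 - e))%R).
  { apply mobius_le_iff; [assumption|now left|]. apply Hcp.
    - apply Rmult_le_pos; [lra|]. left. apply Rinv_0_lt_compat. lra.
    - intros m. destruct (Hcs m) as (_ & _ & _ & C4).
      apply Rmult_le_reg_l with (1 - e)%R; [lra|].
      replace ((1 - e) * ((s + e) / (1 - e)))%R with (s + e)%R by (field; lra). exact C4. }
  assert (Hcw : C_cluster (fun m => tail_iterate b n m c) w).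
  { intros e' N He'. assert (Hc1 : (0 < 1 - Cmod c)%R) by (unfold unit_disc in HcD; lra).
    destruct (Hcl (e' * (1 - Cmod c) / 2)%R N) as [m [Hm Hcm]].
    { apply Rdiv_lt_0_compat; [now apply Rmult_lt_0_compat|lra]. }
    exists m. split; [assumption|]. destruct (Hcs m) as (C1 & C2 & _).
    assert (HF : disc_self_map (tail_iterate b n m)) by now apply disc_self_map_tail.
    rewrite <- C2.
    eapply Rle_lt_trans; [apply schwarz_pick; [now apply disc_self_map_schur|assumption..]|].
    apply Rle_lt_trans with (Cmod (cs m - c) / (1 - Cmod c) * 2)%R.
    - apply Rmult_le_compat; try apply Cmod_ge_0; [now apply Cmod_mobius_le|].
      apply Cmod_den_le_2; now apply HF.
    - apply Rmult_lt_reg_r with ((1 - Cmod c) / 2)%R; [lra|].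
      replace (Cmod (cs m - c) / (1 - Cmod c) * 2 * ((1 - Cmod c) / 2))%R
        with (Cmod (cs m - c)) by (field; lra). lra. }
  destruct (zeros_exhaust_forward b n Hb Hind c z0 HcD Hz0 e He) as (A & HA & HA1 & HA2).
  exists A. split; [assumption|]. split.
  - intros z Hz. eapply Rle_trans; [|now apply HA1].
    now apply (cluster_domination b B n c w z).
  - eapply Rle_trans; [exact HA2|]. fold Bn. fold p.
    rewrite (mobius_sym w (B z0)) by assumption. fold s.
    assert ((s + e) / (1 - e) <= s + 4 * e)%R.
    { apply Rmult_le_reg_r with (1 - e)%R; [lra|].
      replace ((s + e) / (1 - e) * (1 - e))%R with (s + e)%R by (field; lra).
      assert (e * s <= e * 1)%R by (apply Rmult_le_compat_l; lra).
      assert (e * e <= e * (1 / 2))%R by (apply Rmult_le_compat_l; lra). lra. }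
    lra.
Qed.

Theorem theorem1p1 (b : nat -> C -> C) (B : C -> C)
  (b_self : forall n, (1 <= n)%nat -> holomorphic_self_map (b n))
  (B_self : holomorphic_self_map B)
  (B_lim : cvg_on_disc (forward_iterate b) B)
  (B_nonconstant : nonconstant_on_disc B) :
  (forall n, (1 <= n)%nat -> indestructible_blaschke (b n)) <->
  indestructible_blaschke B.
Proof.
  assert (Hb : forall n, (1 <= n)%nat -> disc_self_map (b n)).
  { intros n Hn. apply holomorphic_self_map_iff. now apply b_self. }
  assert (HB : disc_self_map B) by now apply holomorphic_self_map_iff.
  split.
  - now apply limit_indestructible.
  - now apply factor_indestructible.
Qed.
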